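(* Let $d\geq 2$ and let $\mathbf{F}_d$ be the free group on $x_1,\dots,x_d$ with generating system $S_{\mathbf{F}_d}=\{x_1^{\pm1},\dots,x_d^{\pm1}\}$. Let $\mathbf{F}_d=\Gamma_0\geq\Gamma_1\geq\dots\geq\Gamma_n\geq\cdots$ be a sequence of finite index subgroups, each normal in $\mathbf{F}_d$, such that (i) the sequence of Schreier graphs $\mathrm{Sch}(\mathbf{F}_d/\Gamma_n,S_{\mathbf{F}_d})$, $n\geq 0$, is not a family of expanders, and (ii) none of the Schreier graphs $\mathrm{Sch}(\mathbf{F}_d/\Gamma_n,S_{\mathbf{F}_d})$ is bipartite. Let $m_n$ denote the Haar probability measure on $\mathrm{Iso}(\mathbf{F}_d)/\Gamma_n$. Then the projective limit $$\mathbf{F}_d\curvearrowright\varprojlim\,(\mathrm{Iso}(\mathbf{F}_d)/\Gamma_n,m_n)$$ is a p.m.p. mixing action that is not strongly ergodic.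
   Context: $\mathrm{Iso}(\mathbf{F}_d)$ is the group of bijective isometries of the Cayley graph of $\mathbf{F}_d$ (vertex set $\mathbf{F}_d$, edges $\{\gamma,\gamma s\}$ with $s\in S_{\mathbf{F}_d}$, graph distance), a locally compact totally disconnected unimodular group for the topology of pointwise convergence, containing $\mathbf{F}_d$ as the left translations. For a finite index subgroup $\Lambda\leq\mathbf{F}_d$, $\mathrm{Iso}(\mathbf{F}_d)/\Lambda$ denotes the quotient of $\mathrm{Iso}(\mathbf{F}_d)$ by the action of $\Lambda$ by postcomposition, $\lambda\cdot f:\gamma\mapsto\lambda f(\gamma)$. It carries the action of $\mathrm{Iso}(\mathbf{F}_d)$ (hence of $\mathbf{F}_d$) induced by precomposition by the inverse, $g[f]=[f\circ g^{-1}]$. The Haar probability measure on $\mathrm{Iso}(\mathbf{F}_d)/\Lambda$ is the one induced by the Haar measure of $\mathrm{Iso}(\mathbf{F}_d)$ (image of its normalized restriction to a measurable fundamental domain of $\Lambda$); it is the unique $\mathrm{Iso}(\mathbf{F}_d)$-invariant Borel probability measure. The projective limit is taken with respect to the natural quotient maps $\mathrm{Iso}(\mathbf{F}_d)/\Gamma_{n+1}\to\mathrm{Iso}(\mathbf{F}_d)/\Gamma_n$, with the unique probability measure projecting to all the $m_n$. The Schreier graph $\mathrm{Sch}(\mathbf{F}_d/\Lambda,S_{\mathbf{F}_d})$ has vertex set $\mathbf{F}_d/\Lambda$ and an edge between $q$ and $sq$ for each $q\in\mathbf{F}_d/\Lambda$, $s\in S_{\mathbf{F}_d}$ (loops allowed;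 a graph with a loop is not bipartite). A sequence of finite graphs $G_n$ of uniformly bounded degree is a family of expanders if there is $c>0$ such that for all $n$ and all sets $A$ of vertices of $G_n$ of cardinality at most half the number of vertices, the number of edges between $A$ and its complement is at least $c|A|$. A p.m.p. action $\Gamma\curvearrowright(X,\mu)$ of a countable group on a standard probability space is an action by measure-preserving bimeasurable bijections. It is mixing if $\mu(\gamma A\cap B)\to\mu(A)\mu(B)$ as $\gamma\to\infty$ for all measurable $A,B\subseteq X$. It is strongly ergodic if for every sequence $(A_n)_{n\geq0}$ of measurable sets with $\lim_n\mu(A_n\triangle\gamma A_n)=0$ for all $\gamma\in\Gamma$, one has $\mu(A_n)(1-\mu(A_n))\to 0$. *)

(* Defs.v *)
From HB Require Import structures.
From mathcomp Require Import all_boot all_order all_algebra finmap.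
From mathcomp Require Import generic_quotient.
From mathcomp Require Import all_classical all_reals all_analysis.

Set Implicit Arguments.
Unset Strict Implicit.
Unset Printing Implicit Defensive.

Import Order.TTheory GRing.Theory Num.Theory.
Import numFieldNormedType.Exports.
Local Open Scope classical_set_scope.
Local Open Scope ring_scope.
Local Open Scope quotient_scope.

(** Reduced words: the letter [(i, false)] stands for [x_i] and
    [(i, true)] for its inverse. *)

Notation letter d := ('I_d * bool)%type.

Definition letter_inv d (a : letter d) : letter d := (a.1, ~~ a.2).

Definition reduced d (w : seq (letter d)) : bool :=
  sorted (fun a b => b != letter_inv a) w.

Record free_group (d : nat) : Type := FreeGroup {
  fg_word :> seq (letter d);
  fg_reduced : reduced fg_word }.

HB.instance Definition _ d := [isSub for @fg_word d].
HB.instance Definition _ d := [Countable of free_group d by <:].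

Section FreeGroupLaw.
Variable d : nat.
Implicit Types (a : letter d) (u v w : seq (letter d)).

Definition push a w : seq (letter d) :=
  if w is b :: w' then if b == letter_inv a then w' else a :: w else [:: a].

Definition word_mul u v : seq (letter d) := foldr push v u.
Definition word_inv u : seq (letter d) := rev (map (@letter_inv d) u).

Lemma letter_invK : involutive (@letter_inv d).
Proof. by case=> i b; rewrite /letter_inv /= negbK. Qed.

Lemma reduced_push a w : reduced w -> reduced (push a w).
Proof.
case: w => [//|b w] /= rw; case: eqP => [_|/eqP ba]; first exact: path_sorted rw.
by rewrite /= ba.
Qed.

Lemma pushK a w : reduced w -> push a (push (letter_inv a) w) = w.
Proof.
case: w => [|b w] rw; first by rewrite /= eqxx.
rewrite {2}/push letter_invK; case: (eqVneq b a) rw => [->|_] rw;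
  last by rewrite /= eqxx.
by case: w rw => [//|c w] /= /andP[/negPf ->].
Qed.

Lemma reduced_mul u v : reduced v -> reduced (word_mul u v).
Proof. by move=> rv; elim: u => //= a u; exact: reduced_push. Qed.

Lemma word_mul_push a u v : reduced u -> reduced v ->
  word_mul (push a u) v = push a (word_mul u v).
Proof.
move=> ru rv; case: u ru => [//|b u] /= ru.
case: eqP => [->|//]; rewrite pushK //; exact: reduced_mul.
Qed.

Lemma word_mulA u v w : reduced v -> reduced w ->
  word_mul u (word_mul v w) = word_mul (word_mul u v) w.
Proof.
move=> rv rw; elim: u => //= a u ->.
by rewrite word_mul_push // reduced_mul.
Qed.

Lemma word_mul1 u : reduced u -> word_mul u [::] = u.
Proof.
elim: u => //= a u IH ru; rewrite IH; last exact: path_sorted ru.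
by case: u ru {IH} => [//|b u] /= /andP[/negPf ->].
Qed.

Lemma reduced_inv u : reduced u -> reduced (word_inv u).
Proof.
rewrite /reduced /word_inv rev_sorted sorted_map; apply: sub_sorted => a b /=.
by apply: contra_neq => ->; rewrite letter_invK.
Qed.

Lemma word_mul_cat u v w : word_mul (u ++ v) w = word_mul u (word_mul v w).
Proof. exact: foldr_cat. Qed.

Lemma word_mulVw u : word_mul (word_inv u) u = [::].
Proof.
rewrite /word_inv; elim: u => //= a u IH.
rewrite rev_cons -cats1 word_mul_cat /= letter_invK eqxx; exact: IH.
Qed.

Lemma word_mulwV u : reduced u -> word_mul u (word_inv u) = [::].
Proof.
move=> _; rewrite -[X in word_mul X _](mapK letter_invK) -[map _ (map _ u)]revK.
by rewrite -map_rev; exact: word_mulVw.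
Qed.

Definition fg_one : free_group d := @FreeGroup d [::] isT.
Definition fg_mul (x y : free_group d) : free_group d :=
  FreeGroup (reduced_mul x (fg_reduced y)).
Definition fg_inv (x : free_group d) : free_group d :=
  FreeGroup (reduced_inv (fg_reduced x)).

Lemma fg_mulA : associative fg_mul.
Proof.
by move=> x y z; apply: val_inj; apply: word_mulA; exact: fg_reduced.
Qed.
Lemma fg_mul1g : left_id fg_one fg_mul.
Proof. by move=> x; apply: val_inj. Qed.
Lemma fg_mulg1 : right_id fg_one fg_mul.
Proof. by move=> x; apply/val_inj/word_mul1/fg_reduced. Qed.
Lemma fg_mulVg : left_inverse fg_one fg_inv fg_mul.
Proof. by move=> x; apply/val_inj/word_mulVw. Qed.
Lemma fg_mulgV : right_inverse fg_one fg_inv fg_mul.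
Proof. by move=> x; apply/val_inj/word_mulwV/fg_reduced. Qed.

End FreeGroupLaw.

HB.instance Definition _ d := isGroup.Build (free_group d)
  (@fg_mulA d) (@fg_mul1g d) (@fg_mulg1 d) (@fg_mulVg d) (@fg_mulgV d).


Definition fg_gen d (i : 'I_d) : free_group d := @FreeGroup d [:: (i, false)] isT.

Definition free_gens d : set (free_group d) :=
  [set s | exists i : 'I_d, s = fg_gen i \/ s = ((fg_gen i)^-1)%g].

(** A graph on [V] is given by its adjacency relation, loops being allowed. *)

Definition walk (V : eqType) (e : rel V) (x y : V) (n : nat) : Prop :=
  exists p : seq V, [/\ path e x p, last x p = y & size p = n].

(** The least length of a walk; the value 0 for disconnected vertices is never
    met below, Cayley graphs being connected. *)
Definition graph_dist (V : eqType) (e : rel V) (x y : V) : nat :=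
  if pselect (exists n, `[< walk e x y n >]) is left h then ex_minn h else 0%N.

Definition bipartite (V : Type) (e : rel V) : Prop :=
  exists c : V -> bool, forall x y, e x y -> c x != c y.

(** The edges between [A] and its complement are counted, without multiplicity,
    by their orientations leaving [A]. *)
Definition edge_boundary (V : choiceType) (e : rel V) (A : {fset V}) :
    set (V * V) :=
  [set xy | [/\ xy.1 \in A, xy.2 \notin A & e xy.1 xy.2]].

(** Only meant for sequences of finite graphs of uniformly bounded degree. *)
Definition expanders (R : realType) (V : nat -> choiceType)
    (e : forall n, rel (V n)) : Prop :=
  exists2 c : R, 0 < c & forall n (A : {fset V n}),
    (2 * #|` A| <= #|` fset_set [set: V n]|)%N ->
    c * (#|` A|)%:R <= (#|` fset_set (edge_boundary (@e n) A)|)%:R.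

Definition cayley (G : groupType) (S : set G) : rel G :=
  fun x y => `[< exists2 s, S s & y = (x * s)%g >].

Definition normal_subgroup (G : groupType) (L : groupClosed G) : Prop :=
  forall x g : G, x \in L -> (x ^ g)%g \in L.

Record subgroup_chain (G : groupType) := SubgroupChain {
  chain_sub :> nat -> groupClosed G;
  chain_le : forall n, {subset chain_sub n.+1 <= chain_sub n} }.

Section Cosets.
Variables (G : groupType) (L : groupClosed G).

Definition coset_rel : rel G := fun x y => (x^-1 * y)%g \in L.

Lemma coset_rel_equiv : equiv_class_of coset_rel.
Proof.
split=> [x|x y|y x z]; rewrite /coset_rel.
- by rewrite mulVg gpred1.
- by rewrite -gpredV invgM invgK.
- by move=> xy yz; rewrite -(mulVKg y z) mulgA gpredM.
Qed.

Canonical coset_equiv := EquivRelPack coset_rel_equiv.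

(** [G/L], the space of left cosets [xL] *)
Definition coset_space : choiceType := {eq_quot coset_equiv}.

Definition finite_index : Prop := finite_set [set: coset_space].

Definition coset_act (g : G) (q : coset_space) : coset_space :=
  \pi_coset_space (g * repr q)%g.

Definition schreier (S : set G) : rel coset_space :=
  fun q q' => `[< exists2 s, S s &
     (q' = coset_act s q) \/ (q = coset_act s q') >].

End Cosets.

(** The group Iso(F_d) of bijective isometries of the Cayley graph of F_d, with
    the topology of pointwise convergence. *)

Definition cayley_dist d : free_group d -> free_group d -> nat :=
  graph_dist (cayley (@free_gens d)).

Definition is_iso d : set {ptws free_group d -> discrete_topology (free_group d)} :=
  [set f | bijective f /\
     forall x y, cayley_dist (f x) (f y) = cayley_dist x y].

Definition Iso d : Type := set_type (@is_iso d).
HB.instance Definition _ d := Topological.on (Iso d).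

Definition iso_fun d (f : Iso d) : free_group d -> free_group d := sval f.

Definition mk_iso d (f : free_group d -> free_group d) (Hf : is_iso f) : Iso d :=
  exist _ f (mem_set Hf).

Section IsoOps.
Variable d : nat.
Local Notation F := (free_group d).

Lemma iso_funP (f : Iso d) : is_iso (iso_fun f).
Proof. by case: f => f /= /set_mem. Qed.

Lemma is_iso_id : is_iso (fun x : F => x).
Proof. by split=> //; exists id. Qed.

Lemma is_iso_comp (f g : Iso d) : is_iso (fun x => iso_fun f (iso_fun g x)).
Proof.
have [bf df] := iso_funP f; have [bg dg] := iso_funP g.
split; first exact: (bij_comp bf bg).
by move=> x y; rewrite df dg.
Qed.

Lemma walk_left (g x y : F) n :
  walk (cayley (@free_gens d)) x y n ->
  walk (cayley (@free_gens d)) (g * x)%g (g * y)%g n.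
Proof.
move=> [p [ep <- <-]]; exists [seq (g * z)%g | z <- p].
split; [|by rewrite last_map|by rewrite size_map].
rewrite path_map; apply: sub_path ep => a b /asboolP[s Ss ->].
by apply/asboolP; exists s => //; rewrite mulgA.
Qed.

Lemma is_iso_left (g : F) : is_iso (fun x => (g * x)%g).
Proof.
split; first by exists (fun x => (g^-1 * x)%g) => x; rewrite ?mulKg ?mulVKg.
move=> x y; rewrite /cayley_dist /graph_dist.
suff -> : walk (cayley (@free_gens d)) (g * x)%g (g * y)%g =
          walk (cayley (@free_gens d)) x y by [].
apply/funext => n; apply/propext; split; last exact: walk_left.
by move/(walk_left (g^-1)%g); rewrite !mulKg.
Qed.

Definition iso_id : Iso d := mk_iso is_iso_id.
Definition iso_comp (f g : Iso d) : Iso d := mk_iso (is_iso_comp f g).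
Definition iso_left (g : F) : Iso d := mk_iso (is_iso_left g).

Lemma iso_eqP (f g : Iso d) : iso_fun f =1 iso_fun g -> f = g.
Proof. by move=> fg; apply/val_inj/funext. Qed.

End IsoOps.

HB.instance Definition _ d := isPointed.Build (Iso d) (iso_id d).

(** The quotient of Iso(F_d) by [L] acting by postcomposition *)

Section IsoQuotient.
Variables (d : nat) (L : groupClosed (free_group d)).

Definition iso_rel : rel (Iso d) :=
  fun f g => `[< exists2 l, l \in L & g = iso_comp (iso_left l) f >].

Lemma iso_rel_equiv : equiv_class_of iso_rel.
Proof.
have sym f g : iso_rel f g -> iso_rel g f.
  move=> /asboolP[l Ll ->]; apply/asboolP; exists (l^-1)%g; first by rewrite gpredV.
  by apply: iso_eqP => x; rewrite /= mulKg.
split=> [f|f g|g f h].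
- apply/asboolP; exists 1%g; first exact: gpred1.
  by apply: iso_eqP => x; rewrite /= mul1g.
- by apply/idP/idP; exact: sym.
- move=> /asboolP[l Ll ->] /asboolP[k Lk ->]; apply/asboolP.
  exists (k * l)%g; first exact: gpredM.
  by apply: iso_eqP => x; rewrite /= mulgA.
Qed.

Canonical iso_equiv := EquivRelPack iso_rel_equiv.

Definition iso_quot : Type := quotient_topology {eq_quot iso_equiv}.
HB.instance Definition _ := PointedTopological.on iso_quot.
HB.instance Definition _ := Quotient.on iso_quot.

Definition iso_proj (f : Iso d) : iso_quot := \pi_iso_quot f.

(** [g [f] = [f \o g^-1]]; it does not depend on the representative [f] *)
Definition iso_quot_act (g : free_group d) (q : iso_quot) : iso_quot :=
  iso_proj (iso_comp (repr q) (iso_left (g^-1)%g)).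

End IsoQuotient.

Notation borel T := (g_sigma_algebraType (@open T)).

(** Iso(F_d) is second countable and locally compact, so that a Borel measure
    which is finite on compact sets is a Radon measure. *)
Record is_haar (R : realType) d (eta : {measure set (borel (Iso d)) -> \bar R})
    : Prop := {
  haar_neq0 : eta [set: Iso d] != 0%E;
  haar_compact : forall K : set (Iso d), compact K -> (eta K < +oo)%E;
  haar_left : forall (g : Iso d) (A : set (borel (Iso d))), measurable A ->
    eta (iso_comp g @` A) = eta A }.

Definition fundamental_domain d (L : groupClosed (free_group d))
    (D : set (Iso d)) : Prop :=
  forall f : Iso d, exists! g, D g /\ iso_proj L g = iso_proj L f.

(** Image of the normalized restriction of a Haar measure of Iso(F_d) to a
    measurable fundamental domain of [L] *)
Definition is_haar_prob (R : realType) d (L : groupClosed (free_group d))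
    (m : probability (borel (iso_quot L)) R) : Prop :=
  exists (eta : {measure set (borel (Iso d)) -> \bar R})
         (D : set (borel (Iso d))),
    [/\ is_haar eta, measurable D, fundamental_domain L D,
        (0 < eta D < +oo)%E &
        forall A : set (borel (iso_quot L)), measurable A ->
          m A = ((fine (eta D))^-1%:E * eta (D `&` iso_proj L @^-1` A))%E].

Section IsoLimit.
Variables (d : nat) (Gam : subgroup_chain (free_group d)).

(** [Gam n.+1 f |-> Gam n f] *)
Definition iso_quot_map n (q : iso_quot (Gam n.+1)) : iso_quot (Gam n) :=
  iso_proj (Gam n) (repr q).

Lemma iso_quot_mapE n (f : Iso d) :
  iso_quot_map (iso_proj (Gam n.+1) f) = iso_proj (Gam n) f.
Proof.
apply/eqmodP; have : iso_rel (Gam n.+1) (repr (iso_proj (Gam n.+1) f)) f.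
  by apply/eqmodP; rewrite /iso_proj reprK.
move=> /asboolP[l Ll Ef]; apply/asboolP; exists l => //; exact: (chain_le Ll).
Qed.

Lemma iso_quot_actE (L : groupClosed (free_group d)) g (f : Iso d) :
  iso_quot_act g (iso_proj L f) = iso_proj L (iso_comp f (iso_left (g^-1)%g)).
Proof.
apply/eqmodP; have : iso_rel L (repr (iso_proj L f)) f.
  by apply/eqmodP; rewrite /iso_proj reprK.
move=> /asboolP[l Ll Ef]; apply/asboolP; exists l => //; rewrite [in LHS]Ef.
exact: iso_eqP.
Qed.

Definition compatible (x : forall n, iso_quot (Gam n)) : Prop :=
  forall n, iso_quot_map (x n.+1) = x n.

Definition iso_lim : Type := {x | compatible x}.

HB.instance Definition _ := gen_eqMixin iso_lim.
HB.instance Definition _ := gen_choiceMixin iso_lim.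
HB.instance Definition _ := isPointed.Build iso_lim
  (exist compatible (fun n => iso_proj (Gam n) (iso_id d))
     (fun n => iso_quot_mapE n (iso_id d))).

Definition iso_lim_proj n (x : iso_lim) : iso_quot (Gam n) := sval x n.

Lemma iso_lim_act_subproof (g : free_group d) (x : iso_lim) n :
  iso_quot_map (iso_quot_act g (iso_lim_proj n.+1 x)) =
  iso_quot_act g (iso_lim_proj n x).
Proof.
rewrite -[iso_lim_proj n x](svalP x n) -/(iso_lim_proj n.+1 x).
by rewrite /iso_quot_map iso_quot_actE -[LHS]/(iso_quot_map _) iso_quot_mapE.
Qed.

Definition iso_lim_act (g : free_group d) (x : iso_lim) : iso_lim :=
  exist compatible (fun n => iso_quot_act g (iso_lim_proj n x))
    (iso_lim_act_subproof g x).

Definition iso_lim_cylinders : set (set iso_lim) :=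
  [set C | exists n, exists2 A : set (borel (iso_quot (Gam n))),
     measurable A & C = iso_lim_proj n @^-1` A].

Definition iso_lim_measurable := g_sigma_algebraType iso_lim_cylinders.
HB.instance Definition _ := Measurable.on iso_lim_measurable.

End IsoLimit.

Definition projective_limit_measure (R : realType) d
    (Gam : subgroup_chain (free_group d))
    (m : forall n, probability (borel (iso_quot (Gam n))) R)
    (mu : probability (iso_lim_measurable Gam) R) : Prop :=
  forall n (A : set (borel (iso_quot (Gam n)))), measurable A ->
    mu (iso_lim_proj n @^-1` A) = m n A.

(** The measurable sets of [X] are the Borel sets of a Polish topology. *)
Definition standard_borel (R : realType) d (X : measurableType d) : Prop :=
  exists (Y : completePseudoMetricType R) (h : X -> Y),
    [/\ hausdorff_space Y, @second_countable Y, bijective h &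
        forall A : set X,
          measurable A <-> exists2 B : set Y, <<s @open Y >> B & A = h @^-1` B].

Section Actions.
Variables (R : realType) (G : groupType) (d : measure_display).
Variables (X : measurableType d) (mu : probability X R) (act : G -> X -> X).

(** The inverse of [act g] is [act g^-1], so that [act g] is a bimeasurable
    bijection. *)
Record pmp_action : Prop := {
  pmp_standard : standard_borel R X;
  pmp_act1 : forall x, act 1%g x = x;
  pmp_actM : forall g h x, act (g * h)%g x = act g (act h x);
  pmp_measurable : forall g, measurable_fun setT (act g);
  pmp_preserving : forall g A, measurable A -> mu (act g @` A) = mu A }.

Definition mixing : Prop :=
  forall A B : set X, measurable A -> measurable B ->
  forall eps : R, 0 < eps ->
    finite_set [set g | eps <=
      `|fine (mu (act g @` A `&` B)) - fine (mu A) * fine (mu B)|].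

Definition strongly_ergodic : Prop :=
  forall A : nat -> set X, (forall n, measurable (A n)) ->
    (forall g, (fun n => fine (mu (A n `+` act g @` A n))) @ \oo --> (0 : R)) ->
    (fun n => fine (mu (A n)) * (1 - fine (mu (A n)))) @ \oo --> (0 : R).

End Actions.

(* Main.v *)
Require Import Defs.
From HB Require Import structures.
From mathcomp Require Import all_boot all_order all_algebra finmap.
From mathcomp Require Import zify lra.
From mathcomp Require Import all_classical all_reals all_analysis.
From mathcomp Require Import measurable_realfun.

Set Implicit Arguments.
Unset Strict Implicit.
Unset Printing Implicit Defensive.

Import Order.TTheory GRing.Theory Num.Theory.
Import numFieldNormedType.Exports.
Local Open Scope classical_set_scope.
Local Open Scope ring_scope.
Local Open Scope quotient_scope.

(** Let [T] be the Cayley tree of the free group [F], [G] its isometry group and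
[L] one of the subgroups [Gam n]. A point of the limit is a compatible
sequence of classes [L f] of isometries, and it carries two kinds of
information: for each [n], the coset of [f 1], and one isometry
[x |-> (f 1)^-1 * f x] fixing [1], the same for all [n].

Invariance. The acting group translates [f] on the right, whereas a Haar
measure is only assumed to be left invariant, so [G] has to be shown
unimodular. The stabilisers of two adjacent vertices both contain the
stabiliser of the edge with index [2 d], hence all vertex stabilisers have the
same measure; and a left-invariant measure is determined, on sets given by
finitely many values of [f], by its value on one vertex stabiliser
([stab_adj], [left_invariant_unique], [right_invariance]).

Mixing. Let [A] and [B] be sets of isometries depending on finitely many
values of [f] modulo [L]. For [g] long, any isometry [t] that fixes the part
of the tree seen by [B] may be inserted without changing the measure of
[f \in B] and [f g \in A], which can thus be replaced by [f \in B] and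
[f t g \in A] and averaged over a finite list of such [t]. The average of the
indicator of [f t g \in A] is almost independent of [f]: moving back along
the geodesic from [g] to [1], it only depends on the image modulo [L] of one
oriented edge, and evolves under the transition operator of the
nonbacktracking walk on the finite graph [F / L]. As [d >= 2] and the graph is
not bipartite, that walk is primitive, i.e. all classes of oriented edges are
joined by nonbacktracking paths of every large length, so the oscillation
decreases geometrically ([primitive], [averaged_step],
[averages_equidistribute], [defect_cyl]). Dynkin induction in [A] and in [B]
extends mixing to all measurable sets ([limit_mixing]).

Failure of strong ergodicity. Without expansion there are sets [A] of cosets
with [2 #|A| <= #|F / L|] and boundary at most [c #|A|], [c] arbitrarily
small, but their proportion may tend to [0]. Since [L] is normal, right
translations of [F / L] commute with the edges of the graph; a union of well
chosen right translates of [A] has proportion between [1/4] and [1/2] and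
boundary at most [c #|F / L|] ([almost_invariant_half]). The set of points of
the limit lying over it is moved by at most [2 c] by each generator.

Standardness. Cosets and values of the isometry fixing [1] and of its inverse
are countably many discrete observations which separate points, generate the
measurable sets and are realised by a point as soon as they are finitely
consistent ([standard_borel_of_code], [limit_standard_borel]). *)

(** * Reduced words *)

Section Words.
Variable d : nat.
Implicit Types (a b c : letter d) (u v w : seq (letter d)) (x y z : free_group d).

Definition gl a : free_group d := @FreeGroup d [:: a] isT.

Lemma letter_invN a : letter_inv a != a.
Proof. by case: a => i [] /=; rewrite /letter_inv /= xpair_eqE andbF. Qed.

Lemma letter_inv_inj : injective (@letter_inv d).
Proof. exact: can_inj (@letter_invK d). Qed.

Lemma glV a : ((gl a)^-1)%g = gl (letter_inv a).
Proof. exact/val_inj. Qed.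

Lemma free_gensP x : free_gens x <-> exists a, x = gl a.
Proof.
split=> [[i [->|->]]|[[i b] ->]]; [by exists (i, false)|exists (i, true)|].
  exact/val_inj.
by exists i; case: b; [right|left] => //; exact/val_inj.
Qed.

Lemma fg_valM x y : fg_word (x * y)%g = word_mul x y. Proof. by []. Qed.

Lemma reduced_cat_rcons u b v : reduced (rcons u b ++ v) =
  reduced (rcons u b) && reduced (b :: v).
Proof.
case: u => [|a u] /=; first by [].
by rewrite /reduced /= cat_path last_rcons.
Qed.

Lemma word_mul_reduced u v : reduced (u ++ v) -> word_mul u v = u ++ v.
Proof.
elim: u => //= a u IH /[dup] r /path_sorted /IH ->.
by case: (u ++ v) r => [//|b w] /= /andP[/negPf ->].
Qed.

Lemma fg_mulE x y : reduced (fg_word x ++ fg_word y) ->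
  fg_word (x * y)%g = fg_word x ++ fg_word y.
Proof. exact: word_mul_reduced. Qed.

Lemma fg_mulglN u b a (r : reduced (rcons u b)) : a != letter_inv b ->
  fg_word (FreeGroup r * gl a)%g = rcons (rcons u b) a.
Proof.
move=> ab; rewrite fg_mulE /=; first by rewrite -[RHS]cats1.
by rewrite reduced_cat_rcons r /reduced /= ab.
Qed.

Lemma reduced_rconsW u a : reduced (rcons u a) -> reduced u.
Proof. by case: u => [//|b u]; rewrite /reduced /= rcons_path => /andP[]. Qed.

(** Right multiplication by a letter erases the last letter or appends one;
    the tree structure is used through this alternative only. *)
Lemma fg_word_mulgl x a :
  (exists2 y, x = (y * gl (letter_inv a))%g &
     fg_word x = rcons y (letter_inv a) /\ fg_word (x * gl a)%g = fg_word y) \/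
  fg_word (x * gl a)%g = rcons x a.
Proof.
case: x => x r; case/lastP: x r => [|u b] r; first by right.
have [ab|ab] := eqVneq a (letter_inv b); last first.
  by right; rewrite fg_mulglN.
left; have ru := reduced_rconsW r; exists (FreeGroup ru).
  apply/val_inj; rewrite /= -[LHS]cats1 ab letter_invK word_mul_reduced //.
  by rewrite cats1.
split; first by rewrite /= ab letter_invK.
have -> : FreeGroup r = (FreeGroup ru * gl b)%g.
  by apply/val_inj; rewrite /= word_mul_reduced ?cats1.
by rewrite ab -glV mulgK.
Qed.

Lemma fg_ind (P : free_group d -> Prop) : P 1%g ->
  (forall x a, fg_word (x * gl a)%g = rcons x a -> P x -> P (x * gl a)%g) ->
  forall x, P x.
Proof.
move=> P1 PS [w r]; elim/last_ind: w r => [|w a IH] r.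
  by have -> : FreeGroup r = 1%g by exact/val_inj.
have rw := reduced_rconsW r.
have E : FreeGroup r = (FreeGroup rw * gl a)%g.
  by apply/val_inj; rewrite /= word_mul_reduced ?cats1.
by rewrite E; apply: PS => //; rewrite -E.
Qed.

Lemma fg_size_mulgl x a : (size (fg_word (x * gl a)%g) <= (size x).+1)%N.
Proof.
case: (fg_word_mulgl x a) => [[y _ [-> ->]]|->]; rewrite size_rcons //.
by lia.
Qed.

Lemma fg_size_mulgl_odd x a : odd (size (fg_word (x * gl a)%g)) = ~~ odd (size x).
Proof.
by case: (fg_word_mulgl x a) => [[y _ [-> ->]]|->]; rewrite size_rcons /= ?negbK.
Qed.

Lemma fg_size_mul_odd x y :
  odd (size (fg_word (x * y)%g)) = odd (size x) (+) odd (size y).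
Proof.
elim/fg_ind: y => [|y a E IH]; first by rewrite mulg1 addbF.
by rewrite mulgA !fg_size_mulgl_odd IH addbN.
Qed.

Lemma fg_sizeV x : size (fg_word (x^-1)%g) = size x.
Proof. by rewrite /= /word_inv size_rev size_map. Qed.

Lemma fg_size0 x : size (fg_word x) = 0%N -> x = 1%g.
Proof. by move/size0nil => E; apply/val_inj. Qed.

End Words.

(** * Isometries of the Cayley tree *)

Section Tree.
Variable d : nat.
Local Notation F := (free_group d).
Implicit Types (a b c : letter d) (x y z w : F).

Definition adj x y : Prop := exists a, y = (x * gl a)%g.

Lemma cayleyP x y : cayley (@free_gens d) x y <-> adj x y.
Proof.
split=> [/asboolP[s /free_gensP[a ->] ->]|[a ->]]; first by exists a.
by apply/asboolP; exists (gl a) => //; apply/free_gensP; exists a.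
Qed.

Lemma adj_sym x y : adj x y -> adj y x.
Proof. by case=> a ->; exists (letter_inv a); rewrite -glV mulgK. Qed.

Lemma adj_neq x y : adj x y -> x != y.
Proof.
case=> a ->; rewrite eq_sym -[X in _ != X]mulg1; apply/eqP => /mulgI.
by move/(congr1 (@fg_word d)).
Qed.

Lemma adj_left g x y : adj (g * x)%g (g * y)%g <-> adj x y.
Proof.
split=> [[a]|[a ->]]; last by exists a; rewrite mulgA.
by rewrite -mulgA => /mulgI ->; exists a.
Qed.

Lemma adj_dist x y : adj x y <-> cayley_dist x y = 1%N.
Proof.
rewrite /cayley_dist /graph_dist; case: pselect => [h|h]; last first.
  split=> // xy; case: h; exists 1%N; apply/asboolP; exists [:: y].
  by split=> //=; rewrite andbT; apply/cayleyP.
case: ex_minnP => n /asboolP[p [ep lp sp]] nmin; split=> [xy|n1].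
  have: (n <= 1)%N.
    apply: nmin; apply/asboolP; exists [:: y].
    by split=> //=; rewrite andbT; apply/cayleyP.
  case: n sp {nmin} => [|[|n]] // sp _.
  by move: (adj_neq xy); rewrite -lp (size0nil sp) eqxx.
rewrite n1 in sp; case: p sp ep lp => [|z [|]] // _ /=.
by rewrite andbT => /cayleyP + <-.
Qed.

Lemma adj_path x y n : walk (cayley (@free_gens d)) x y n <->
  exists p : seq F, [/\ path (fun x y => `[< adj x y >]) x p, last x p = y & size p = n].
Proof.
have E : cayley (@free_gens d) =2 (fun x y => `[< adj x y >]).
  move=> u v; apply/idP/idP => [/cayleyP H|/asboolP H]; first exact/asboolP.
  exact/cayleyP.
by split=> -[p [e l s]]; exists p; split=> //; rewrite ?(eq_path E) // -(eq_path E).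
Qed.

(** The distance is defined by walks, so it is enough to respect adjacency in
    both directions. *)
Lemma is_isoP (f : F -> F) : bijective f ->
  (forall x y, adj (f x) (f y) <-> adj x y) -> is_iso f.
Proof.
move=> bf fadj; split=> // x y; have [g gK fK] := bf.
rewrite /cayley_dist /graph_dist.
suff -> : walk (cayley (@free_gens d)) (f x) (f y) =
          walk (cayley (@free_gens d)) x y by [].
apply/funext => n; apply/propext; rewrite !adj_path.
split=> -[p [ep lp sp]].
  exists (map g p); rewrite size_map; split=> //.
    rewrite -[x]gK path_map; apply: sub_path ep => u v /= /asboolP uv.
    by apply/asboolP/fadj; rewrite !fK.
  by rewrite -[x]gK last_map lp gK.
exists (map f p); rewrite size_map last_map lp; split=> //.
rewrite path_map; apply: sub_path ep => u v /= /asboolP uv.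
exact/asboolP/fadj.
Qed.

Implicit Types f h : Iso d.

Lemma iso_adj f x y : adj (iso_fun f x) (iso_fun f y) <-> adj x y.
Proof. by have [_ df] := iso_funP f; rewrite !adj_dist df. Qed.

Lemma iso_bij f : bijective (iso_fun f).
Proof. by have [] := iso_funP f. Qed.

Lemma iso_inj f : injective (iso_fun f).
Proof. exact: bij_inj (iso_bij f). Qed.

Lemma iso_inv_ex f : exists h, cancel (iso_fun f) (iso_fun h) /\
  cancel (iso_fun h) (iso_fun f).
Proof.
have [g fK gK] := iso_bij f.
have Hg : is_iso g.
  apply: is_isoP; first by exists (iso_fun f).
  by move=> x y; rewrite -(iso_adj f) !gK.
by exists (mk_iso Hg).
Qed.

Definition iso_inv f : Iso d := sval (cid (iso_inv_ex f)).
Lemma iso_invK f : cancel (iso_fun f) (iso_fun (iso_inv f)).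
Proof. by rewrite /iso_inv; case: cid => h []. Qed.
Lemma iso_invKV f : cancel (iso_fun (iso_inv f)) (iso_fun f).
Proof. by rewrite /iso_inv; case: cid => h []. Qed.

Lemma iso_compE f h x : iso_fun (iso_comp f h) x = iso_fun f (iso_fun h x).
Proof. by []. Qed.
Lemma iso_leftE g x : iso_fun (iso_left g) x = (g * x)%g. Proof. by []. Qed.

Lemma iso_size_le f x : (size (fg_word ((iso_fun f 1)^-1 * iso_fun f x))%g <= size x)%N.
Proof.
elim/fg_ind: x => [|x a E IH]; first by rewrite mulVg.
have [c ->] : adj (iso_fun f x) (iso_fun f (x * gl a)%g).
  by apply/iso_adj; exists a.
by rewrite mulgA E size_rcons (leq_trans (fg_size_mulgl _ _)).
Qed.

(** Along a geodesic each step changes the length by at most one, so no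
    isometry increases lengths; apply this to its inverse as well. *)
Lemma iso_sizeVM f p x :
  size (fg_word ((iso_fun f p)^-1 * iso_fun f x))%g = size (fg_word (p^-1 * x)%g).
Proof.
have H k q y : (size (fg_word ((iso_fun k q)^-1 * iso_fun k y))%g <=
    size (fg_word (q^-1 * y)%g))%N.
  have := iso_size_le (iso_comp k (iso_left q)) (q^-1 * y)%g.
  by rewrite !iso_compE !iso_leftE mulg1 mulVKg.
apply/eqP; rewrite eqn_leq H /=.
by have := H (iso_inv f) (iso_fun f p) (iso_fun f x); rewrite !iso_invK.
Qed.

Lemma iso_size1 f x : iso_fun f 1%g = 1%g ->
  size (fg_word (iso_fun f x)) = size x.
Proof. by move=> f1; have := iso_sizeVM f 1%g x; rewrite f1 !invg1 !mul1g. Qed.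

(** Rooting the tree at [1], an edge pointing away from the root is encoded by
    its origin [p] and its label [a]. *)
Definition ext (p : F) a : bool := fg_word (p * gl a)%g == rcons p a.

Lemma extP p a : reflect (fg_word (p * gl a)%g = rcons p a) (ext p a).
Proof. exact: eqP. Qed.

Lemma ext_reduced p a : ext p a = reduced (rcons p a).
Proof.
apply/extP/idP => [<-|r]; first exact: fg_reduced.
by rewrite fg_mulE /= cats1.
Qed.

Lemma ext_last x : x != 1%g -> exists p a, ext p a /\ x = (p * gl a)%g.
Proof.
by elim/fg_ind: x => [|x a E _ _]; [rewrite eqxx|exists x, a; split=> //; exact/extP].
Qed.

Lemma ext_size p a : ext p a -> size (fg_word (p * gl a)%g) = (size p).+1.
Proof. by move/extP => ->; rewrite size_rcons. Qed.

Lemma ext_inj p a q b : ext p a -> ext q b -> (p * gl a = q * gl b)%g ->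
  p = q /\ a = b.
Proof.
move=> /extP E1 /extP E2 /(congr1 (@fg_word d)); rewrite E1 E2.
by move=> /rcons_inj[/val_inj -> ->].
Qed.

Lemma adj_cases x y : adj x y ->
  (exists2 a, ext x a & y = (x * gl a)%g) \/ (exists2 a, ext y a & x = (y * gl a)%g).
Proof.
case=> a ->; case: (fg_word_mulgl x a) => [[z Ex [Ez _]]|/extP E].
  have E : (x * gl a)%g = z by rewrite Ex -glV -mulgA mulVg mulg1.
  by right; exists (letter_inv a); rewrite E //; apply/extP; rewrite -Ex.
by left; exists a.
Qed.

Lemma shorter_nbr_uniq z y y' : adj z y -> adj z y' ->
  (size y < size z)%N -> (size y' < size z)%N -> y = y'.
Proof.
move=> /adj_cases[[a /ext_size + ->]|[a ea ->]].
  by move=> -> _; lia.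
move=> /adj_cases[[b /ext_size + ->]|[b eb E]].
  by move=> -> _; lia.
by have [] := ext_inj ea eb E.
Qed.

(** The branch hanging at [w] in the tree rooted at [1]. *)
Definition below w x : bool := prefix (fg_word w) (fg_word x).

Lemma below_refl w : below w w. Proof. exact: prefix_refl. Qed.
Lemma below_trans w x y : below w x -> below x y -> below w y.
Proof. exact: prefix_trans. Qed.
Lemma below_size w x : below w x -> (size w <= size x)%N.
Proof. exact: size_prefix. Qed.

Lemma below_ext w x a : ext x a ->
  below w (x * gl a)%g = (w == x * gl a)%g || below w x.
Proof.
move/extP => E; rewrite /below E; case: (eqVneq w (x * gl a)%g) => [->|ne].
  by rewrite -E prefix_refl.
rewrite orFb; apply/idP/idP => [|h]; last exact: prefix_trans h (prefix_rcons _ _).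
case/prefixP => s; case/lastP: s => [|s b] Es.
  case/eqP: ne; apply/val_inj.
    suff : fg_word w = fg_word (x * gl a)%g by [].
    by rewrite E Es cats0.
by move: Es; rewrite -rcons_cat => /rcons_inj[-> _]; exact: prefix_prefix.
Qed.

Lemma below_parent p a : ext p a -> below (p * gl a)%g p = false.
Proof. by move=> e; apply/negP => /below_size; rewrite ext_size // ltnn. Qed.

(** This is where the absence of cycles is used: a branch is joined to its
    complement by a single edge. *)
Lemma crossing p a x y : ext p a -> adj x y ->
  below (p * gl a)%g x -> ~~ below (p * gl a)%g y -> x = (p * gl a)%g /\ y = p.
Proof.
move=> e /adj_cases[[b eb ->]|[b eb ->]].
  by move=> bx; rewrite below_ext // bx orbT.
rewrite below_ext // => /orP[/eqP E|->//] _.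
by have [-> ->] := ext_inj e eb E.
Qed.

Lemma is_iso_pair (f g : F -> F) : cancel f g -> cancel g f ->
  (forall x y, adj x y -> adj (f x) (f y)) ->
  (forall x y, adj x y -> adj (g x) (g y)) -> is_iso f.
Proof.
move=> fK gK af ag; apply: is_isoP; first by exists g.
by move=> x y; split=> [/ag|/af//]; rewrite !fK.
Qed.

Lemma below_stable p a h x : ext p a -> iso_fun h p = p ->
  iso_fun h (p * gl a)%g = (p * gl a)%g ->
  below (p * gl a)%g x -> below (p * gl a)%g (iso_fun h x).
Proof.
move=> e hp hw; elim/fg_ind: x => [|x c /extP ec IH].
  by move/below_size; rewrite ext_size.
rewrite below_ext // => /orP[/eqP <-|bx]; first by rewrite hw below_refl.
apply/negPn/negP => nb.
have A : adj (iso_fun h x) (iso_fun h (x * gl c)%g) by apply/iso_adj; exists c.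
have [_ E] := crossing e A (IH bx) nb.
have : (x * gl c)%g = p by apply: (@iso_inj h); rewrite hp.
move=> E'; have := below_ext (p * gl a)%g ec; rewrite bx orbT E'.
by rewrite below_parent.
Qed.

(** The branch at [p * gl a] meets its complement in one edge, which [h] fixes;
    so [h] can be applied on the branch alone. *)
Lemma glue_below p a h : ext p a -> iso_fun h p = p ->
  iso_fun h (p * gl a)%g = (p * gl a)%g ->
  exists k : Iso d, forall x,
    iso_fun k x = if below (p * gl a)%g x then iso_fun h x else x.
Proof.
move=> e hp hw; set w := (p * gl a)%g in hw *.
pose gf (h : Iso d) x := if below w x then iso_fun h x else x.
pose h' := iso_inv h.
have h'p : iso_fun h' p = p by rewrite -{1}hp iso_invK.
have h'w : iso_fun h' w = w by rewrite -[in LHS]hw iso_invK.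
have K u v x : iso_fun u p = p -> iso_fun u w = w ->
    cancel (iso_fun u) (iso_fun v) -> gf v (gf u x) = x.
  move=> up uw uK; rewrite /gf; case: (boolP (below w x)) => bx.
    by rewrite (below_stable e up uw bx) uK.
  by rewrite (negPf bx).
have A u : iso_fun u p = p -> iso_fun u w = w -> forall x y, adj x y -> adj (gf u x) (gf u y).
  move=> up uw.
  suff H x y : adj x y -> below w x -> adj (gf u x) (gf u y).
    move=> x y xy; case: (boolP (below w x)) => bx; first exact: H.
    case: (boolP (below w y)) => by_; first by apply/adj_sym/H => //; exact: adj_sym.
    by rewrite /gf (negPf bx) (negPf by_).
  move=> xy bx; rewrite /gf bx; case: (boolP (below w y)) => by_.
    exact/iso_adj.
  have [-> ->] := crossing e xy bx by_; rewrite uw.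
  by apply: adj_sym; exists a.
have G : is_iso (gf h).
  apply: (@is_iso_pair _ (gf h')).
  - by move=> x; apply: K => //; exact: iso_invK.
  - by move=> x; apply: K => //; exact: iso_invKV.
  - exact: A.
  - exact: A.
by exists (mk_iso G).
Qed.

(** The inverses of [a] and [b] are exchanged too, so as to induce an
    automorphism of the free group. *)
Definition lswap a b c : letter d :=
  if c == a then b else if c == b then a
  else if c == letter_inv a then letter_inv b
  else if c == letter_inv b then letter_inv a else c.

Lemma lswapK a b : involutive (lswap a b).
Proof.
case: a b => [i s] [j t] [k u]; rewrite /lswap /letter_inv /= !xpair_eqE.
have [<-|ki] := eqVneq k i; have [<-|kj] := eqVneq k j;
  try (have [?|ij] := eqVneq i j); subst;
  case: s t u => [] [] [];
  rewrite /= ?xpair_eqE ?eqxx ?(negPf ki) ?(negPf kj) ?(negPf ij)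
     ?[j == i]eq_sym ?[j == k]eq_sym ?[i == k]eq_sym ?(negPf ki) ?(negPf kj) ?(negPf ij) ?eqxx //=.
Qed.

Lemma lswapV a b c : lswap a b (letter_inv c) = letter_inv (lswap a b c).
Proof.
case: a b c => [i s] [j t] [k u]; rewrite /lswap /letter_inv /= !xpair_eqE.
by case: (eqVneq k i) => [->|ki]; case: (eqVneq _ j) => [?|kj]; subst;
  case: s t u => [] [] []; rewrite /= ?xpair_eqE ?eqxx ?(negPf ki) ?(negPf kj)
  ?[j == i]eq_sym ?(negPf kj) /=.
Qed.

Lemma lswapl a b : lswap a b a = b. Proof. by rewrite /lswap eqxx. Qed.

Lemma lswap_branch a b c : (lswap a b c \in [:: a; b]) = (c \in [:: a; b]).
Proof.
apply/idP/idP.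
  rewrite -[X in _ -> X \in _](lswapK a b); move: (lswap a b c) => {}c.
  rewrite !inE /lswap => /orP[]/eqP ->; rewrite ?eqxx ?orbT //.
  by case: ifP => _; rewrite eqxx ?orbT.
rewrite !inE /lswap => /orP[]/eqP ->; rewrite ?eqxx ?orbT //.
by case: ifP => _; rewrite eqxx ?orbT.
Qed.

Lemma reduced_wswap a b (w : seq (letter d)) :
  reduced w -> reduced (map (lswap a b) w).
Proof.
rewrite /reduced sorted_map; apply: sub_sorted => u v /=.
by rewrite -lswapV (inj_eq (can_inj (lswapK a b))).
Qed.

Definition wswap a b x : F := FreeGroup (reduced_wswap a b (fg_reduced x)).

Lemma wswapK a b : involutive (wswap a b).
Proof. by move=> x; apply/val_inj; rewrite /= mapK //; exact: lswapK. Qed.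

Lemma wswap_ext a b x c : ext x c -> wswap a b (x * gl c)%g = (wswap a b x * gl (lswap a b c))%g.
Proof.
move/extP => E; apply/val_inj.
have r : reduced (rcons (map (lswap a b) x) (lswap a b c)).
  by rewrite -map_rcons -E; exact: reduced_wswap (fg_reduced _).
rewrite [RHS]/= word_mul_reduced /= ?cats1 //.
by rewrite -map_rcons; congr map; exact: E.
Qed.

Lemma ohead_ext x c : ext x c -> x != 1%g -> ohead (fg_word (x * gl c)%g) = ohead (fg_word x).
Proof. by move=> /extP -> x1; case: x x1 => -[|b u]. Qed.

(** The automorphism exchanging [a] and [b] also moves the branches at their
    inverses; it is therefore applied on the branches at [a] and [b] only. *)
Definition swapf a b x : F :=
  if ohead (fg_word x) \in [:: Some a; Some b] then wswap a b x else x.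

Lemma ohead_wswap a b x :
  (ohead (fg_word (wswap a b x)) \in [:: Some a; Some b]) =
  (ohead (fg_word x) \in [:: Some a; Some b]).
Proof.
case: x => -[|c u] r //=; have := lswap_branch a b c.
by rewrite !inE /= .
Qed.

Lemma swapfK a b : involutive (swapf a b).
Proof.
move=> x; rewrite {2}/swapf; case: ifP => h; last by rewrite /swapf h.
by rewrite /swapf ohead_wswap h wswapK.
Qed.

Lemma swapf_adj a b x y : adj x y -> adj (swapf a b x) (swapf a b y).
Proof.
suff H z c : ext z c -> adj (swapf a b z) (swapf a b (z * gl c)%g).
  by case/adj_cases => -[c e ->]; [exact: H|apply: adj_sym; exact: H].
move=> e; have [->|z1] := eqVneq z 1%g.
  rewrite mul1g; have -> : swapf a b 1%g = 1%g by [].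
  rewrite /swapf; case: ifP => _; last by exists c; rewrite mul1g.
  by exists (lswap a b c); rewrite mul1g; exact/val_inj.
rewrite /swapf (ohead_ext e z1); case: ifP => _; last by exists c.
by exists (lswap a b c); rewrite wswap_ext.
Qed.

Lemma swap_iso_subproof a b : is_iso (swapf a b).
Proof. by apply: is_iso_pair (@swapf_adj a b) (@swapf_adj a b); exact: swapfK. Qed.

(** Fixes [v] and exchanges its neighbours [v * gl a] and [v * gl b]. *)
Definition swap_at v a b : Iso d :=
  iso_comp (iso_left v) (iso_comp (mk_iso (swap_iso_subproof a b)) (iso_left v^-1%g)).

Lemma swap_atE v a b : iso_fun (swap_at v a b) (v * gl a)%g = (v * gl b)%g.
Proof.
rewrite !iso_compE !iso_leftE mulKg; congr (v * _)%g.
rewrite /= /swapf /= inE eqxx /=; apply/val_inj; by rewrite /= lswapl.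
Qed.

Lemma swap_at_center v a b : iso_fun (swap_at v a b) v = v.
Proof. by rewrite !iso_compE !iso_leftE mulVg /= mulg1. Qed.

Lemma swap_at_off v a b x : ext v a -> ext v b -> ~~ below v x ->
  iso_fun (swap_at v a b) x = x.
Proof.
move=> ea eb nx; rewrite !iso_compE !iso_leftE /= /swapf.
case: ifP => [|_]; last by rewrite mulVKg.
suff H c : ext v c -> ohead (fg_word (v^-1 * x)%g) == Some c -> below v x.
  by rewrite !inE => /orP[/(H _ ea)|/(H _ eb)]; rewrite (negPf nx).
rewrite ext_reduced => rc; case E : (fg_word (v^-1 * x)%g) => [|e u] //= /eqP[ec].
have r : reduced (fg_word v ++ fg_word (v^-1 * x)%g).
  rewrite E ec -cat_rcons.
  rewrite reduced_cat_rcons rc /=; have := fg_reduced (v^-1 * x)%g.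
  by rewrite E ec.
have := fg_mulE r; rewrite mulVKg /below => ->; exact: prefix_prefix.
Qed.

(** Move the parent of [z] to the parent of [z'] first, then correct the last
    letter by exchanging two branches below that parent, which fixes everything
    outside. *)
Lemma homogeneous w z z' : w != 1%g -> below w z -> below w z' ->
  size (fg_word z) = size (fg_word z') ->
  exists t : Iso d, (forall x, ~~ below w x -> iso_fun t x = x) /\ iso_fun t z = z'.
Proof.
move=> w1; elim/fg_ind: z z' => [z'|z0 c /extP e IH z'].
  move/below_size; case: w w1 => -[|//] r /eqP[]; exact/val_inj.
rewrite below_ext // => /orP[/eqP Ew bz'|bz bz'] sz.
  exists (iso_id d); split=> //=; apply/val_inj.
  move: bz'; rewrite /below Ew => /prefixP[s Es].
  move: (congr1 size Es); rewrite size_cat -sz => /eqP.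
  rewrite -[X in X == _]addn0 eqn_add2l eq_sym => /eqP/size0nil s0.
  by rewrite [RHS]/= Es s0 cats0.
have z'1 : z' != 1%g.
  by apply: contra_eq_neq sz => ->; rewrite ext_size.
have [z0' [c' [e' Ez']]] := ext_last z'1; subst z'.
move: sz; rewrite !ext_size // => -[sz].
have bz0' : below w z0'.
  move: bz'; rewrite below_ext // => /orP[/eqP E|//].
  by move: (below_size bz); rewrite E (ext_size e') -sz ltnn.
have [t [toff tz]] := IH _ bz bz0' sz.
have t1 : iso_fun t 1%g = 1%g.
  apply: toff; apply/negP => /below_size; rewrite leqn0 => /eqP /fg_size0 E.
  by rewrite E eqxx in w1.
have [f Ef] : adj (iso_fun t z0) (iso_fun t (z0 * gl c)%g).
  by apply/iso_adj; exists c.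
rewrite tz in Ef.
have ef : ext z0' f.
  apply/extP; have := iso_size1 (z0 * gl c)%g t1; rewrite Ef => Es.
  move: (Es); rewrite [RHS]ext_size // sz.
  case: (fg_word_mulgl z0' f) => [[y -> [E1 E2]]|//].
  by rewrite E2 E1 size_rcons; lia.
exists (iso_comp (swap_at z0' f c') t); split=> [x nx|].
  rewrite iso_compE toff // swap_at_off //; apply: contra nx.
  exact: below_trans.
by rewrite iso_compE Ef swap_atE.
Qed.

End Tree.

(** * Reduced words of given length and ends in a coset *)

Section Primitive.
Variable d : nat.
Local Notation F := (free_group d).
Implicit Types (a b c : letter d) (x y z w h : F).

(** [x] has length [n], first letter [a] and last letter [b]. *)
Definition seg x a b n : Prop :=
  exists u, [/\ fg_word x = a :: u, last a u = b & (size u).+1 = n].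

Lemma seg_size x a b n : seg x a b n -> size x = n.
Proof. by case=> u [-> _ <-]. Qed.

Lemma seg_letter a : seg (gl a) a a 1.
Proof. by exists [::]. Qed.

Lemma seg_mul x y a b c e n m : seg x a b n -> seg y c e m ->
  c != letter_inv b -> seg (x * y)%g a e (n + m)%N.
Proof.
move=> [u [Ex lu su]] [v [Ey lv sv]] cb; exists (u ++ c :: v); split.
- rewrite fg_mulE Ex Ey //= /reduced /= cat_path lu /=.
  move: (fg_reduced x) (fg_reduced y); rewrite Ex Ey /reduced /= => -> ->.
  by rewrite cb.
- by rewrite last_cat.
- by rewrite size_cat /= -su -sv; lia.
Qed.

Lemma seg_exp a n : (0 < n)%N -> seg (gl a ^+ n)%g a a n.
Proof.
case: n => // n _; elim: n => [|n IH]; first by rewrite expg1; exact: seg_letter.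
rewrite expgS -[n.+2]/(1 + n.+1)%N; apply: seg_mul IH _; first exact: seg_letter.
by rewrite eq_sym letter_invN.
Qed.

Lemma seg_nontriv x : x != 1%g -> exists a b n, seg x a b n.
Proof.
case: x => -[|a u] r x1; first by case/eqP: x1; exact/val_inj.
by exists a, (last a u), (size u).+1; exists u.
Qed.

Hypothesis d2 : (2 <= d)%N.

Lemma letter_avoid a b : exists c, c != a /\ c != b.
Proof.
have /existsP[c /negP hc] : [exists c, c \notin [set a; b]%SET].
  rewrite -negb_forall; apply/negP => /forallP H.
  have : (#|{: letter d}| <= #|[set a; b]%SET|)%N.
    by apply/subset_leq_card/fintype.subsetP => c _; exact: H.
  rewrite card_prod card_ord card_bool cards2; case: (a != b) => /=; lia.
by move: hc; rewrite !inE => /negP; rewrite negb_or => /andP[ca cb]; exists c.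
Qed.

Variable L : groupClosed F.
Hypothesis Lfin : finite_index L.
Hypothesis Lnorm : normal_subgroup L.

Lemma normalJ x g : x \in L -> (g * x * g^-1)%g \in L.
Proof. by move/(@Lnorm _ (g^-1)%g); rewrite /conjg invgK mulgA. Qed.

Definition cong x y : bool := (x * y^-1)%g \in L.

Lemma cong_trans x y z : cong x y -> cong y z -> cong x z.
Proof. by move=> xy yz; rewrite /cong -(mulgVK y x) -mulgA gpredM. Qed.

Lemma cong_l x y : x \in L -> cong (x * y)%g y.
Proof. by rewrite /cong mulgK. Qed.

Lemma cong_r x y : x \in L -> cong (y * x)%g y.
Proof. exact: normalJ. Qed.

Lemma coset_eq x y : \pi_(coset_space L) x = \pi_(coset_space L) y <-> (x^-1 * y)%g \in L.
Proof. by split=> [/eqmodP|h]; [|apply/eqmodP]. Qed.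

Lemma cong_coset x y : \pi_(coset_space L) x = \pi_(coset_space L) y -> cong x y.
Proof.
move/esym/coset_eq => h; rewrite /cong.
by have := normalJ y h; rewrite mulVKg.
Qed.

(** Even exponents are wanted so that inserting such powers in a word does not
    change the parity of its length. *)
Lemma exp_in x : exists2 n, (0 < n)%N && ~~ odd n & (x ^+ n)%g \in L.
Proof.
have [i [j [ij E]]] : exists i j, i <> j /\
    \pi_(coset_space L) (x ^+ i)%g = \pi_(coset_space L) (x ^+ j)%g.
  apply: contrapT => H; apply: infinite_nat.
  rewrite (_ : setT = (fun i => \pi_(coset_space L) (x ^+ i)%g) @^-1` setT) //.
  apply: finite_preimage => // i j _ _ E; apply: contrapT => ij.
  by apply: H; exists i, j.
wlog lij : i j ij E / (i < j)%N => [W|].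
  have [/W|/W|//] := ltngtP i j; [exact|by apply=> //; exact: nesym].
have h : (x ^+ (j - i))%g \in L.
  move/coset_eq: E; have -> : j = (i + (j - i))%N by lia.
  by rewrite expgnDr mulKg addKn.
exists ((j - i) + (j - i))%N; last by rewrite expgnDr gpredM.
by rewrite addnn odd_double andbT double_gt0; lia.
Qed.

(** Append to [h] a power of a letter that cancels neither with [h] nor with
    [b], and then a power of [b], both in [L]. *)
Lemma right_ext h b : exists y c n, [/\ seg y c b n, cong y h & odd n = odd (size h)].
Proof.
have [M /andP[M0 Mo] Mb] := exp_in (gl b).
have [->|h1] := eqVneq h 1%g.
  by exists (gl b ^+ M)%g, b, M; split;
    [exact: seg_exp|rewrite /cong invg1 mulg1|rewrite (negPf Mo)].
have [a0 [l0 [n0 sh]]] := seg_nontriv h1.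
have [a' [a'1 a'2]] := letter_avoid (letter_inv l0) (letter_inv b).
have [N /andP[N0 No] Na] := exp_in (gl a').
exists (h * gl a' ^+ N * gl b ^+ M)%g, a0, (n0 + N + M)%N; split.
- apply: seg_mul (seg_exp b M0) _.
    by apply: seg_mul sh (seg_exp a' N0) _.
  by apply: contra_neq a'2 => ->; rewrite letter_invK.
- exact: cong_trans (cong_r _ Mb) (cong_r _ Na).
- by rewrite !oddD (negPf Mo) (negPf No) !addbF (seg_size sh).
Qed.

(** The conjugates [s ^+ j * e ^+ M * s ^- j] of an element [e ^+ M] of [L] are
    in [L] for every [j]: used as a prefix, they adjust the length by steps of
    two. *)
Lemma lengthen h s b : exists k0, odd k0 = odd (size h) /\
  forall j, (0 < j)%N -> exists2 v, seg v s b (k0 + j.*2)%N & cong v h.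
Proof.
have [y [c [n [sy yh on]]]] := right_ext h b.
have [a [a1 a2]] := letter_avoid s (letter_inv c).
have [e [e1 e2]] := letter_avoid (letter_inv s) s.
have [N /andP[N0 No] Na] := exp_in (gl a).
have [M /andP[M0 Mo] Me] := exp_in (gl e).
exists (M + N + n)%N; split; first by rewrite !oddD (negPf Mo) (negPf No) on.
move=> j j0.
exists ((gl s ^+ j * gl e ^+ M * gl (letter_inv s) ^+ j) * gl a ^+ N * y)%g; last first.
  apply: cong_trans yh; rewrite -mulgA; apply: cong_trans (cong_l _ Na).
  by apply: cong_l; rewrite -glV expVgn normalJ.
have -> : (M + N + n + j.*2 = j + M + j + N + n)%N by lia.
apply: (@seg_mul _ _ _ a) sy _; last by apply: contra_neq a2 => ->; rewrite letter_invK.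
apply: (@seg_mul _ _ _ (letter_inv s)) (seg_exp _ N0) _; last by rewrite letter_invK.
apply: (@seg_mul _ _ _ e) (seg_exp _ j0) _.
  exact: (seg_mul (seg_exp _ j0) (seg_exp _ M0) e1).
by rewrite (inj_eq (@letter_inv_inj d)) eq_sym.
Qed.

Hypothesis Lodd : ~ bipartite (@schreier _ L (@free_gens d)).

Lemma coset_actE g x : @coset_act F L g (\pi_(coset_space L) x) = \pi_(coset_space L) (g * x)%g.
Proof.
apply/coset_eq; rewrite invgM -mulgA mulKg; apply/coset_eq; by rewrite reprK.
Qed.

(** Otherwise the parity of lengths would be well defined on cosets and would
    colour the graph with two colours. *)
Lemma odd_in : exists2 o, o \in L & odd (size (fg_word o)).
Proof.
apply: contrapT => H; apply: Lodd.
have ev x : x \in L -> odd (size x) = false.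
  by move=> xL; apply/negP => ox; apply: H; exists x.
have par x y : \pi_(coset_space L) x = \pi_(coset_space L) y -> odd (size x) = odd (size y).
  move/coset_eq/ev; rewrite fg_size_mul_odd fg_sizeV.
  by case: odd; case: odd.
exists (fun q => odd (size (fg_word (repr q)))) => q q'.
have flip s p : free_gens s -> odd (size (fg_word (repr (@coset_act F L s p)))) = ~~ odd (size (fg_word (repr p))).
  move=> /free_gensP[a ->].
  rewrite (@par (repr (@coset_act F L (gl a) p)) (gl a * repr p)%g) ?reprK //.
  by rewrite fg_size_mul_odd.
by move=> /asboolP[s Ss [->|->]]; rewrite flip //; case: odd.
Qed.

Lemma primitive_one h s b : exists m0, forall m, (m0 <= m)%N ->
  exists2 v, seg v s b m & cong v h.
Proof.
have [z zL zo] := odd_in.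
have [k0 [ok0 H0]] := lengthen h s b.
have [k1 [ok1 H1]] := lengthen (h * z)%g s b.
exists (k0 + k1 + 2)%N => m le_m.
have [e|ne] := eqVneq (odd m) (odd k0).
  have [|v sv vh] := H0 (m - k0)./2; first by rewrite half_gt0; lia.
  exists v => //; suff -> : m = (k0 + (m - k0)./2.*2)%N by [].
  have k0m : (k0 <= m)%N by lia.
  by rewrite even_halfK ?oddB ?e ?addbb ?subnKC.
have [|v sv vh] := H1 (m - k1)./2; first by rewrite half_gt0; lia.
exists v; last exact: cong_trans vh (cong_r _ zL).
suff -> : m = (k1 + (m - k1)./2.*2)%N by [].
have k1m : (k1 <= m)%N by lia.
rewrite even_halfK ?oddB ?ok1 ?fg_size_mul_odd ?zo -?ok0 ?subnKC //.
by move: ne; case: (odd m); case: (odd k0).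
Qed.

(** Primitivity of the nonbacktracking walk on the quotient: [lengthen] gives all
    large lengths of one parity, and multiplying [h] by an odd element of [L] gives
    the other one. Uniformity in [h] comes from the finiteness of the quotient. *)
Lemma primitive : exists m0, forall m, (m0 <= m)%N -> forall h s b,
  exists2 v, seg v s b m & cong v h.
Proof.
have [f fP] : exists f : coset_space L * (letter d * letter d) -> nat, forall q m, (f q <= m)%N ->
    exists2 v, seg v q.2.1 q.2.2 m & cong v (repr q.1).
  have /choice[f fP] := fun q : coset_space L * (letter d * letter d) => primitive_one (repr q.1) q.2.1 q.2.2.
  by exists f.
exists (\max_(q <- fset_set [set: coset_space L]) \max_(p : letter d * letter d) f (q, p)).
move=> m le_m h s b; pose q := \pi_(coset_space L) h.
have [|v sv vq] := fP (q, (s, b)) m.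
  apply: leq_trans le_m; apply: (@leq_trans (\max_p f (q, p))).
    exact: (leq_bigmax (F := fun p => f (q, p)) (s, b)).
  apply: (@leq_bigmax_seq _ _ xpredT (fun q => \max_p f (q, p))) => //.
  by rewrite in_fset_set // inE.
exists v => //; apply: cong_trans vq _; apply: cong_coset.
by rewrite reprK.
Qed.

End Primitive.

(** * Averaging over the isometries supported on a branch *)

Section Finiteness.
Variable d : nat.
Local Notation F := (free_group d).

Lemma finite_ball k : finite_set [set x : F | (size x <= k)%N].
Proof.
apply: (@sub_finite_set _ _ (@fg_word d @^-1` ((fun b : k.-bseq (letter d) => val b) @` setT))).
  by move=> x /= xk; exists (Bseq xk).
apply: finite_preimage; first by move=> x y _ _ /val_inj.
by apply: finite_image; exact: finite_finset.
Qed.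

Definition box n k : set (seq F) :=
  [set s | size s = n /\ forall x, x \in s -> (size (fg_word x) <= k)%N].

Lemma finite_box n k : finite_set (box n k).
Proof.
elim: n => [|n IH].
  by apply: (@sub_finite_set _ _ [set [::]]) => // s [/size0nil].
apply: (@sub_finite_set _ _ [set x.1 :: x.2 | x in [set x : F | (size x <= k)%N] `*` box n k]).
  case=> [|x s] [] //= [ss] h; exists (x, s) => //; split => /=.
    by apply: h; rewrite mem_head.
  by split=> // y ys; apply: h; rewrite inE ys orbT.
by apply: finite_image; apply: finite_setX => //; exact: finite_ball.
Qed.

End Finiteness.

Section Average.
Variables (R : realType) (d : nat) (L : groupClosed (free_group d)).
Local Notation F := (free_group d).
Implicit Types (a b c : letter d) (p q w x y z g : F) (f t h : Iso d) (E : seq F).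

(** [f] and [f'] have the same restriction to [E] up to left translation by
    [L]. *)
Definition cong_on E f f' : Prop :=
  exists2 l, l \in L & forall x, x \in E -> iso_fun f' x = (l * iso_fun f x)%g.

Definition fixes_off w t : Prop := forall x, ~~ below w x -> iso_fun t x = x.

Lemma fixes_off_below w t x : fixes_off w t -> below w x -> below w (iso_fun t x).
Proof.
move=> tw bx; apply/negPn/negP => nb; have /iso_inj := tw _ nb.
by move=> E; rewrite E bx in nb.
Qed.

Lemma fixes_off_comp w t h : fixes_off w t -> fixes_off w h -> fixes_off w (iso_comp t h).
Proof. by move=> tw hw x nx; rewrite iso_compE hw // tw. Qed.

Lemma fixes_offS w z t : below w z -> fixes_off z t -> fixes_off w t.
Proof. by move=> wz tz x nx; apply: tz; apply: contra nx; exact: below_trans. Qed.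

(** The isometries supported on the branch act on its possible restrictions to
    [E]; [Ls] contains one representative of each restriction, and averaging over it
    is averaging over an orbit. If [f'] agrees with [f] modulo [L] on the edge at the
    top of the branch, the two differ on the branch by one of these isometries, so
    they have the same average. The bound on [size Ls] only involves [size E]
    and the radius [k], which makes the later contraction uniform. *)
Lemma average_below p a E k : ext p a ->
  (forall x, x \in E -> below (p * gl a)%g x /\ (size (fg_word (p^-1 * x)%g) <= k)%N) ->
  exists Ls : seq (Iso d), [/\ (0 < size Ls)%N,
    (size Ls <= #|` fset_set (@box d (size E) k)|)%N,
    forall t, t \in Ls -> fixes_off (p * gl a)%g t,
    forall t, fixes_off (p * gl a)%g t ->
      exists2 t', t' \in Ls & forall x, x \in E -> iso_fun t x = iso_fun t' x &
    forall psi : Iso d -> R, (forall f f', cong_on E f f' -> psi f = psi f') ->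
      forall f f', cong_on [:: p; (p * gl a)%g] f f' ->
      \sum_(t <- Ls) psi (iso_comp f t) = \sum_(t <- Ls) psi (iso_comp f' t)].
Proof.
move=> e HE; set w := (p * gl a)%g in HE *.
pose germ t := [seq (p^-1 * iso_fun t x)%g | x <- E].
pose O := [set germ t | t in fixes_off w].
have np : ~~ below w p by rewrite below_parent.
have Obox : O `<=` @box d (size E) k.
  move=> _ [t tw <-]; split; first by rewrite size_map.
  move=> _ /mapP[x xE ->]; rewrite -{1}(tw p np) iso_sizeVM.
  by case: (HE x xE).
have Ofin : finite_set O := sub_finite_set Obox (finite_box _ _ _).
have [rep repP] : {rep & forall o, O o -> fixes_off w (rep o) /\ germ (rep o) = o}.
  apply: (@choice _ _ (fun o t => O o -> fixes_off w t /\ germ t = o)) => o.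
  have [[t tw to]|nO] := pselect (O o); first by exists t.
  by exists (iso_id d).
have germE t t' : germ t = germ t' -> forall x, x \in E -> iso_fun t x = iso_fun t' x.
  by move=> /eq_in_map H x xE; apply: (mulgI (p^-1)%g); exact: H.
pose Os : seq (seq F) := fset_set O.
have OsE o : o \in Os -> O o by rewrite /Os in_fset_set // inE.
have OsI o : O o -> o \in Os by move=> Oo; rewrite /Os in_fset_set // inE.
exists (map rep Os); split.
- rewrite size_map lt0n size_eq0; apply/negP => /eqP O0.
  have : germ (iso_id d) \in Os by apply: OsI; exists (iso_id d).
  by rewrite O0.
- rewrite size_map; apply: fsubset_leq_card.
  by apply/fsubsetP => s; rewrite !in_fset_set ?inE //; [exact: Obox|exact: finite_box].
- by move=> _ /mapP[gm /OsE/repP[? _] ->].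
- move=> t tw; have Og : O (germ t) by exists t.
  exists (rep (germ t)); first by apply: map_f; exact: OsI.
  by apply: germE; have [_ ->] := repP _ Og.
move=> psi psiE f f' [l lL ff'].
(* [h0] fixes both ends of the edge, and [f'] equals [l f h0] on the branch *)
pose h0 := iso_comp (iso_inv f) (iso_comp (iso_left (l^-1)%g) f').
have h0p : iso_fun h0 p = p.
  by rewrite !iso_compE ff' ?mem_head // iso_leftE mulKg iso_invK.
have h0w : iso_fun h0 w = w.
  by rewrite !iso_compE ff' ?inE ?eqxx ?orbT // iso_leftE mulKg iso_invK.
have [h hE] := glue_below e h0p h0w.
have hw : fixes_off w h by move=> x nx; rewrite hE (negPf nx).
have step t : fixes_off w t -> psi (iso_comp f' t) = psi (iso_comp f (iso_comp h t)).
  move=> tw; apply/esym/psiE; exists l => // x xE; rewrite !iso_compE.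
  have [bx _] := HE x xE.
  by rewrite hE (fixes_off_below tw bx) !iso_compE iso_invKV iso_leftE mulVKg.
rewrite [RHS]big_map [LHS]big_map.
have -> : \sum_(o <- Os) psi (iso_comp f' (rep o)) =
          \sum_(o <- Os) psi (iso_comp f (iso_comp h (rep o))).
  by rewrite !big_seq; apply: eq_bigr => o /OsE/repP[? _]; exact: step.
(* composition with [h] permutes the possible restrictions to [E] *)
pose s o := [seq (p^-1 * iso_fun h (p * y))%g | y <- o].
have sgerm t : s (germ t) = germ (iso_comp h t).
  by rewrite /s /germ -map_comp; apply: eq_map => x /=; rewrite mulVKg.
have sO o : O o -> O (s o).
  by move=> [t tw <-]; rewrite sgerm; exists (iso_comp h t) => //; exact: fixes_off_comp.
have sinj : injective s.
  apply: inj_map => x y /mulgI /iso_inj; exact: mulgI.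
have -> : \sum_(o <- Os) psi (iso_comp f (iso_comp h (rep o))) =
          \sum_(o <- Os) psi (iso_comp f (rep (s o))).
  rewrite !big_seq; apply: eq_bigr => o /OsE Oo; apply: psiE.
  exists 1%g; first exact: gpred1.
  move=> x xE; rewrite mul1g !iso_compE; congr iso_fun.
  have [_ gr] := repP _ Oo; have [_ gs] := repP _ (sO _ Oo).
  rewrite -iso_compE; apply: germE => //.
  by rewrite gs -sgerm gr.
rewrite -(big_map s xpredT (fun o => psi (iso_comp f (rep o)))).
apply: perm_big; apply: uniq_perm.
- exact: fset_uniq.
- by rewrite map_inj_uniq // fset_uniq.
have [| | |_ H] := @uniq_min_size _ (map s Os) Os _ _.
- by rewrite map_inj_uniq // fset_uniq.
- by move=> _ /mapP[gm /OsE Oo ->]; exact/OsI/sO.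
- by rewrite size_map.
by move=> o; rewrite H.
Qed.

End Average.

(** * Contraction of averages along a geodesic *)

Section Descent.
Variable d : nat.
Local Notation F := (free_group d).
Implicit Types (a b c : letter d) (p q w x y z g : F).

(** Nothing cancels when a word starting with [a] is multiplied by [p]. *)
Lemma below_mul p a x u : ext p a -> fg_word x = a :: u ->
  below (p * gl a)%g (p * x)%g /\ size (fg_word (p * x)%g) = (size p + size x)%N.
Proof.
move=> e Ex.
have r : reduced (fg_word p ++ fg_word x).
  rewrite Ex -cat_rcons reduced_cat_rcons -ext_reduced e.
  by move: (fg_reduced x); rewrite Ex.
have Epx := fg_mulE r.
rewrite /below Epx size_cat; split=> //.
by move/extP: e => ->; rewrite Ex -cat_rcons prefix_prefix.
Qed.

Lemma below_split p a z : ext p a -> below (p * gl a)%g z ->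
  exists u, fg_word (p^-1 * z)%g = a :: u /\ size z = (size p + size (fg_word (p^-1 * z)%g))%N.
Proof.
move=> /[dup] e /extP E; rewrite /below E => /prefixP[u Ez].
have r : reduced (a :: u).
  by move: (fg_reduced z); rewrite Ez reduced_cat_rcons => /andP[].
have Ezp : z = (p * FreeGroup r)%g.
  apply/val_inj; rewrite /= word_mul_reduced.
    by rewrite /= Ez cat_rcons.
  by rewrite /= -cat_rcons -Ez fg_reduced.
exists u; rewrite {1 3}Ezp mulKg; split=> //.
by rewrite Ez size_cat size_rcons /=; lia.
Qed.

Lemma shorten_left a x : (size (fg_word (gl a * x)%g) < size x)%N ->
  exists u, fg_word x = letter_inv a :: u.
Proof.
case: x => -[|b u] r //=; case: eqP => [->|_] /=; last by lia.
by exists u.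
Qed.

End Descent.

Section Averages.
Variables (R : realType) (d : nat) (L : groupClosed (free_group d)).
Hypothesis Lnorm : normal_subgroup L.
Local Notation F := (free_group d).
Implicit Types (a b c : letter d) (p q w x y z g : F) (f t h : Iso d) (E : seq F).

(** A reduced word provided by primitivity leads from the image under [f] of the
    first edge to the image under [f'] of the second one, modulo [L]. It is pulled
    back by [f] to a path starting with the first edge, which homogeneity allows
    to use as the image of the geodesic from [p] to [q * gl b]. *)
Lemma reach (n : nat) p a q b f f' :
  (forall x s b, exists2 v, seg v s b n & cong L v x) ->
  ext p a -> ext q b -> below (p * gl a)%g (q * gl b)%g ->
  size (fg_word (p^-1 * (q * gl b))%g) = n ->
  exists t, fixes_off (p * gl a)%g t /\
    cong_on L [:: q; (q * gl b)%g] f' (iso_comp f t).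
Proof.
set w := (p * gl a)%g; set z := (q * gl b)%g => Hn ea eb wz szn.
have [a1 Ea1] : adj (iso_fun f p) (iso_fun f w) by apply/iso_adj; exists a.
have [b1 Eb1] : adj (iso_fun f' q) (iso_fun f' z) by apply/iso_adj; exists b.
have [v sv cv] := Hn ((iso_fun f p)^-1 * iso_fun f' z)%g a1 b1.
pose l := (iso_fun f p * v * (iso_fun f' z)^-1)%g.
have lL : l \in L.
  have := normalJ Lnorm (iso_fun f p) cv.
  by rewrite invgM invgK !mulgA mulgK.
have lE : (l * iso_fun f' z)%g = (iso_fun f p * v)%g by rewrite mulgVK.
(* [y] will be the image of [q * gl b] under the isometry to be built *)
pose y := iso_fun (iso_inv f) (iso_fun f p * v)%g.
have fy : iso_fun f y = (iso_fun f p * v)%g by rewrite /y iso_invKV.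
have spy : size (fg_word (p^-1 * y)%g) = n.
  by rewrite -(iso_sizeVM f) fy mulKg (seg_size sv).
have swy : (size (fg_word (w^-1 * y)%g)).+1 = n.
  rewrite -(iso_sizeVM f) fy Ea1 invgM -mulgA mulKg glV.
  by case: sv => u [Ev _ <-]; rewrite fg_valM Ev /= letter_invK eqxx.
have [u Eu] : exists u, fg_word (p^-1 * y)%g = a :: u.
  have := @shorten_left _ (letter_inv a) (p^-1 * y)%g.
  rewrite letter_invK; apply; rewrite spy -glV mulgA -invgM -/w -swy.
  exact: leqnn.
have [wy sy] := below_mul ea Eu; rewrite mulVKg in wy sy.
have [_ [_ sz]] := below_split ea wz; rewrite szn in sz.
have w1 : w != 1%g by apply/eqP => /(congr1 (fun x => size (fg_word x))); rewrite ext_size.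
have szy : size z = size y by rewrite sy spy sz.
have [t [tw tz]] := homogeneous w1 wz wy szy.
exists t; split=> //; exists l => // x; rewrite !inE => /orP[]/eqP ->; last first.
  by rewrite iso_compE tz fy lE.
have fp : iso_fun t p = p by apply: tw; rewrite below_parent.
rewrite iso_compE; apply: (mulgI (iso_fun f p)^-1%g).
have n0 : (0 < n)%N by rewrite -swy.
have pq : (size (fg_word (p^-1 * q)%g) < n)%N.
  have sz2 := ext_size eb; rewrite -/z sz in sz2; move: wz.
  rewrite below_ext // => /orP[/eqP wz'|wq].
    have [<- _] := ext_inj ea eb wz'; by rewrite mulVg.
  have [uq [_ sq]] := below_split ea wq.
  by rewrite sq in sz2; lia.
have vsz : size v = n := seg_size sv.
(* both candidates for the image of [q] are neighbours of [v] closer to [1] *)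
apply: (@shorter_nbr_uniq _ v).
- have -> : v = ((iso_fun f p)^-1 * iso_fun f (iso_fun t z))%g by rewrite tz fy mulKg.
  by apply/adj_left/iso_adj/iso_adj/adj_sym; exists b.
- have -> : v = ((iso_fun f p)^-1 * (l * iso_fun f' z))%g by rewrite lE mulKg.
  by apply/adj_left/adj_left/iso_adj/adj_sym; exists b.
- rewrite -{1}fp -iso_compE -(iso_compE f t q) iso_sizeVM vsz; exact: pq.
have -> : (l * iso_fun f' q)%g = (iso_fun f p * v * gl (letter_inv b1))%g.
  by rewrite -lE Eb1 -glV !mulgA mulgK.
rewrite !mulgA mulVg mul1g.
case: (fg_word_mulgl v (letter_inv b1)) => [[x' _ [Ev ->]]|].
  by rewrite Ev size_rcons.
case: sv => u' [Ev lv _] E; have := fg_reduced (v * gl (letter_inv b1))%g.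
by rewrite E Ev /reduced /= rcons_path lv eqxx andbF.
Qed.

Definition avg (Ls : seq (Iso d)) (phi : Iso d -> R) : R :=
  (\sum_(t <- Ls) phi t) / (size Ls)%:R.

(** If one term of each average takes the same value [v], the oscillation of the
    average is smaller than that of [phi] by the factor [1 - 1/N]. *)
Lemma avg_range (Ls : seq (Iso d)) phi lo u (v : R) t0 :
  t0 \in Ls -> phi t0 = v -> (forall t, lo <= phi t <= lo + u) ->
  lo + (v - lo) / (size Ls)%:R <= avg Ls phi <=
  lo + (v - lo) / (size Ls)%:R + (1 - (size Ls)%:R^-1) * u.
Proof.
move=> t0L phit0 bnd.
have s0 : (0 < size Ls)%N by case: (Ls) t0L.
have s0R : 0 < (size Ls)%:R :> R by rewrite ltr0n.
rewrite /avg (perm_big _ (perm_to_rem t0L)) big_cons phit0 /=.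
have Es : (size Ls)%:R = (size (rem t0 Ls))%:R + 1 :> R.
  by rewrite size_rem // natr1 prednK.
set s := \sum_(j <- _) _; set k := size (rem t0 Ls) in Es *.
have slo : lo * k%:R <= s.
  rewrite /s /k; elim: (rem t0 Ls) => [|t l IH]; first by rewrite big_nil mulr0.
  rewrite big_cons /= -natr1 mulrDr mulr1 addrC lerD //.
  by have /andP[] := bnd t.
have shi : s <= (lo + u) * k%:R.
  rewrite /s /k; elim: (rem t0 Ls) => [|t l IH]; first by rewrite big_nil mulr0.
  rewrite big_cons /= -natr1 mulrDr mulr1 addrC lerD //.
  by have /andP[] := bnd t.
move: s0R; rewrite Es => s0R.
have := mulVf (lt0r_neq0 s0R); set i := (_ + 1)^-1 => ik.
have lo1 : lo * (i * (k%:R + 1)) = lo by rewrite ik mulr1.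
have u1 : u * (i * (k%:R + 1)) = u by rewrite ik mulr1.
have E1 : lo + (v - lo) * i = (v + lo * k%:R) * i by lra.
have E2 : lo + (v - lo) * i + (1 - i) * u = (v + (lo + u) * k%:R) * i by lra.
by rewrite E2 E1 !ler_pM2r ?invr_gt0 // !lerD2l slo shi.
Qed.

End Averages.

Section Geodesic.
Variable d : nat.
Local Notation F := (free_group d).
Implicit Types (g x : F).

Lemma reduced_take g i : reduced (take i (fg_word g)).
Proof.
have := fg_reduced g; rewrite /reduced -{1}(cat_take_drop i (fg_word g)).
by case: (take i g) => [|a u] //=; rewrite cat_path => /andP[].
Qed.

(** The vertex at distance [i] from [1] on the geodesic from [1] to [g]. *)
Definition geod g i : F := FreeGroup (reduced_take g i).

Lemma geodS g i : (i < size g)%N ->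
  exists a, ext (geod g i) a /\ geod g i.+1 = (geod g i * gl a)%g.
Proof.
move=> ig; case E : (drop i g) => [|a u].
  by move: (size_drop i g); rewrite E /=; lia.
have Et : take i.+1 g = rcons (take i g) a.
  by rewrite -addn1 takeD E /= take0 cats1.
have ea : ext (geod g i) a by rewrite ext_reduced /= -Et reduced_take.
exists a; split=> //; apply/val_inj; rewrite [LHS]/= Et.
by symmetry; exact/extP.
Qed.

Lemma geod_size g i : (i <= size g)%N -> size (geod g i) = i.
Proof. by move=> ig; rewrite /= size_takel. Qed.

Lemma below_geod g i j : (i <= j)%N -> below (geod g i) (geod g j).
Proof. by move=> ij; rewrite /below /= -(take_takel _ ij) prefix_take. Qed.

Lemma geod_end g : geod g (size g) = g.
Proof. by apply/val_inj; rewrite /= take_size. Qed.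

(** Multiplying [g] by [x] erases at most [size x] letters of [g]. *)
Lemma geod_stay g x j : (size x <= j)%N -> (j <= size g)%N ->
  below (geod g (size g - j)) (g * x)%g.
Proof.
elim/fg_ind: x j => [|x a E IH] j xj jg.
  by rewrite mulg1 -{3}(geod_end g) below_geod // leq_subr.
case: j xj jg => [|j]; rewrite E size_rcons // ltnS => xj jg.
have hx := IH j xj (ltnW jg).
have [b [eb Eb]] := @geodS g (size g - j.+1) ltac:(lia).
have Ej : ((size g - j.+1).+1 = size g - j)%N by lia.
rewrite Ej in Eb; rewrite mulgA.
have [by_|nb] := boolP (below (geod g (size g - j)) (g * x * gl a)%g).
  by apply: below_trans by_; apply: below_geod; lia.
have A : adj (g * x)%g (g * x * gl a)%g by exists a.
rewrite Eb in hx nb; have [_ ->] := crossing eb A hx nb.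
exact: below_refl.
Qed.

End Geodesic.

Section Contraction.
Variables (R : realType) (d : nat) (L : groupClosed (free_group d)).
Hypothesis Lnorm : normal_subgroup L.
Local Notation F := (free_group d).
Implicit Types (a b c : letter d) (p q w x y z g : F) (f t h : Iso d) (E : seq F).

Lemma iso_compA f t h : iso_comp f (iso_comp t h) = iso_comp (iso_comp f t) h.
Proof. exact: iso_eqP. Qed.

(** After averaging over suitable isometries moving only the branch at the
    [i.+1]-st vertex of the geodesic to [g], the function [phi] depends only on the
    image modulo [L] of the [i]-th edge, and its oscillation is at most [u]. *)
Definition averaged (phi : Iso d -> R) g i (u : R) : Prop :=
  exists Ls : seq (Iso d), [/\ (0 < size Ls)%N,
    forall t, t \in Ls -> fixes_off (geod g i.+1) t,
    forall f f', cong_on L [:: geod g i; geod g i.+1] f f' ->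
      avg Ls (fun t => phi (iso_comp f t)) = avg Ls (fun t => phi (iso_comp f' t)) &
    exists lo, forall f, lo <= avg Ls (fun t => phi (iso_comp f t)) <= lo + u].

Lemma averaged_start (phi : Iso d -> R) g i E : (i < size g)%N ->
  (forall x, x \in E -> below (geod g i.+1) x) ->
  (forall f f', cong_on L E f f' -> phi f = phi f') ->
  (forall f, 0 <= phi f <= 1) -> averaged phi g i 1.
Proof.
move=> ig Eb phiE phi01.
have [a [ea Ea]] := geodS ig.
pose k := \max_(x <- E) size (fg_word ((geod g i)^-1 * x)%g).
have HE x : x \in E -> below (geod g i * gl a)%g x /\
    (size (fg_word ((geod g i)^-1 * x)%g) <= k)%N.
  move=> xE; rewrite -Ea; split; first exact: Eb.
  exact: (@leq_bigmax_seq _ E xpredT (fun x => size (fg_word ((geod g i)^-1 * x)%g))).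
have [Ls [L0 _ Loff _ Linv]] := average_below R L ea HE.
have L0R : 0 < (size Ls)%:R :> R by rewrite ltr0n.
exists Ls; split=> //; first by move=> t /Loff; rewrite Ea.
  move=> f f' ff'; congr (_ / _); apply: Linv => //.
  by rewrite -Ea.
exists 0 => f; rewrite add0r /avg divr_ge0 ?ler0n //=; last first.
  by apply: sumr_ge0 => t _; have /andP[] := phi01 (iso_comp f t).
rewrite ler_pdivrMr // mul1r -sum1_size natr_sum; apply: ler_sum => t _.
by have /andP[] := phi01 (iso_comp f t).
Qed.

(** One step of the Doeblin argument: by [reach] the new averages all contain a
    term equal to the old average at the identity, and the number of terms is bounded independently of [g]. *)
Lemma averaged_step (phi : Iso d -> R) g i n u :
  (forall x s b, exists2 v, seg v s b n.+2 & cong L v x) ->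
  (i + n.+1 < size g)%N -> 0 <= u ->
  averaged phi g (i + n.+1)%N u ->
  averaged phi g i ((1 - (#|` fset_set (@box d 2 n.+2)|)%:R^-1) * u).
Proof.
move=> Hn ig u0 [Ls [L0 Loff Linv [lo Lrg]]].
have [a [ea Ea]] := @geodS _ g i ltac:(lia).
have [b [eb Eb]] := geodS ig.
set p := geod g i in ea Ea *; set q := geod g (i + n.+1) in eb Eb Linv *.
set z := geod g (i + n.+1).+1 in Eb Linv Loff *; set w := geod g i.+1 in Ea *.
have wq : below w q by apply: below_geod; lia.
have wz : below w z by apply: below_geod; lia.
have sz : size (fg_word (p^-1 * z)%g) = n.+2.
  have [_ [_]] := below_split (z := z) ea ltac:(by rewrite -Ea).
  by rewrite !geod_size; lia.
have sq : size (fg_word (p^-1 * q)%g) = n.+1.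
  have [_ [_]] := below_split (z := q) ea ltac:(by rewrite -Ea).
  by rewrite !geod_size; lia.
pose psi f := avg Ls (fun t => phi (iso_comp f t)).
have HE x : x \in [:: q; z] -> below (p * gl a)%g x /\ (size (fg_word (p^-1 * x)%g) <= n.+2)%N.
  by rewrite !inE -Ea => /orP[]/eqP ->; rewrite ?sz ?sq; split.
have [Ms [M0 MN Moff Mrep Minv]] := average_below R L ea HE.
set N := #|` _| in MN *.
pose Ps := [seq iso_comp t t' | t <- Ms, t' <- Ls].
have PsE f : avg Ps (fun t => phi (iso_comp f t)) = avg Ms (fun t => psi (iso_comp f t)).
  rewrite /avg /Ps size_allpairs big_allpairs_dep /= natrM invfM mulrCA mulrC.
  congr (_ * _); rewrite mulr_suml; apply: eq_bigr => t _; congr (_ / _).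
  by apply: eq_bigr => t' _; rewrite iso_compA.
exists Ps; split.
- by rewrite size_allpairs muln_gt0 M0.
- move=> _ /allpairsP[[t t'] /= [tM t'L ->]]; apply: fixes_off_comp.
    by rewrite -/w Ea; exact: Moff.
  by apply: fixes_offS (Loff _ t'L).
- move=> f f' ff'; rewrite !PsE; congr (_ / _); apply: Minv => //.
  by rewrite -Ea.
(* any isometry would do: its value is the term common to all averages *)
pose f0 := iso_id d.
exists (lo + (psi f0 - lo) / (size Ms)%:R) => f; rewrite PsE.
have [t [tw t0]] : exists t, fixes_off (p * gl a)%g t /\ cong_on L [:: q; z] f0 (iso_comp f t).
  rewrite Eb; apply: reach Hn _ _ _ _ => //; by rewrite -?Ea -?Eb.
have [t' t'M tt'] := Mrep _ tw.
have psit' : psi (iso_comp f t') = psi f0.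
  apply/esym/Linv; case: t0 => l lL H; exists l => // x xE.
  by rewrite -H // !iso_compE tt'.
have := @avg_range _ _ Ms (fun t => psi (iso_comp f t)) lo u _ t' t'M psit'.
move=> /(_ (fun t => Lrg _)) /andP[-> /le_trans ->] //=.
rewrite lerD2l ler_wpM2r // lerD2l lerN2 lef_pV2 ?posrE ?ltr0n //.
  by rewrite ler_nat.
exact: leq_trans MN.
Qed.

Lemma averaged_iter (phi : Iso d -> R) g n i j :
  (forall x s b, exists2 v, seg v s b n.+2 & cong L v x) ->
  (i + j * n.+1 < size g)%N -> averaged phi g (i + j * n.+1)%N 1 ->
  averaged phi g i ((1 - (#|` fset_set (@box d 2 n.+2)|)%:R^-1) ^+ j).
Proof.
move=> Hn; elim: j => [|j IH] in i *; first by rewrite mul0n addn0 expr0.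
rewrite mulSn addnA => ig /(IH _ ig) H; rewrite exprS.
apply: averaged_step => //; first by lia.
apply: exprn_ge0; rewrite subr_ge0.
case: (#|` _|) => [|k]; first by rewrite invr0 ler01.
by rewrite invf_le1 ?ltr0n // ler1n.
Qed.

(** Translated by [g], the set [A] is seen from [1] through a branch far away
    along the geodesic to [g]. The contraction can be repeated as often as the length
    of [g] allows before it reaches the ball of radius [r]. *)
Lemma averages_equidistribute (A : set (Iso d)) (E : seq F) r (eps : R) :
  (exists m0, forall m, (m0 <= m)%N -> forall x s b, exists2 v, seg v s b m & cong L v x) ->
  (forall f f', cong_on L E f f' -> A f -> A f') -> 0 < eps ->
  exists k0, forall g, (k0 <= size g)%N -> exists Ls : seq (Iso d),
    [/\ (0 < size Ls)%N,
      forall t, t \in Ls -> forall x, (size x <= r)%N -> iso_fun t x = x &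
      exists lo, forall f,
        lo <= avg Ls (fun t => \1_A (iso_comp (iso_comp f t) (iso_left g)) : R) <= lo + eps].
Proof.
move=> [m0 Hm0] AE eps0.
pose n := m0.
have Hn := Hm0 n.+2 ltac:(lia).
set N := (#|` fset_set (@box d 2 n.+2)|).
have N0 : (0 < N)%N.
  rewrite /N cardfs_gt0; apply/fset0Pn; exists [:: 1%g; 1%g].
  rewrite in_fset_set ?inE; last exact: finite_box.
  by split=> // x; rewrite !inE => /orP[]/eqP ->.
have [j Hj] : exists j, (1 - N%:R^-1 : R) ^+ j <= eps.
  have : (fun j => (1 - N%:R^-1 : R) ^+ j) @ \oo --> (0 : R).
    apply: cvg_expr; rewrite ger0_norm ?ltrBlDr ?ltrDl ?invr_gt0 ?ltr0n //.
    by rewrite subr_ge0 invf_le1 ?ltr0n // ler1n.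
  move=> /cvgrPdist_le /(_ _ eps0)[j _ /(_ j (leqnn j)) /=].
  rewrite sub0r normrN => H; exists j; apply: le_trans H; exact: ler_norm.
pose r0 := \max_(x <- E) size (fg_word x).
(* room for [j] blocks between the ball of radius [r] around [1], on which the
   isometries are trivial, and the ball of radius [r0] around [g], which [A] sees *)
exists (r + j * n.+1 + r0).+1 => g gk.
pose phi f : R := \1_A (iso_comp f (iso_left g)).
have : averaged phi g (size g - r0).-1 1.
  apply: (@averaged_start _ _ _ [seq (g * x)%g | x <- E]); first by lia.
  - move=> _ /mapP[x xE ->]; have -> : ((size g - r0).-1.+1 = size g - r0)%N by lia.
    apply: geod_stay; last by lia.
    exact: (@leq_bigmax_seq _ E xpredT (fun x => size (fg_word x))).
  - suff H f f' : cong_on L [seq (g * x)%g | x <- E] f f' ->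
        A (iso_comp f (iso_left g)) -> A (iso_comp f' (iso_left g)).
      move=> f f' ff'; rewrite /phi !indicE; congr (nat_of_bool _)%:R.
      apply/idP/idP; rewrite !inE; apply: H => //.
      case: ff' => l lL H'; exists (l^-1)%g; first by rewrite gpredV.
      by move=> x xE; rewrite H' // mulKg.
    case=> l lL H; apply: AE; exists l => // x xE.
    by rewrite !iso_compE !iso_leftE H //; exact: map_f.
  by move=> f; rewrite /phi indicE; case: (_ \in _); rewrite ?ler01 ?lexx.
have -> : ((size g - r0).-1 = ((size g - r0).-1 - j * n.+1) + j * n.+1)%N by lia.
move=> /(averaged_iter Hn) H.
have [|Ls [L0 Loff _ [c Hc]]] := H; first by lia.
exists Ls; split=> //.
  move=> t /Loff tw x xr; apply: tw; apply/negP => /below_size.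
  by rewrite geod_size; lia.
exists c => f; have /andP[-> /le_trans -> //] := Hc f.
by rewrite lerD2l.
Qed.

End Contraction.

(** * Topology of the isometry group *)

Section Topology.
Variable d : nat.
Local Notation F := (free_group d).
Implicit Types (f h : Iso d) (E : seq F) (x : F).

Definition agree E f : set (Iso d) := fun h => forall x, x \in E -> iso_fun h x = iso_fun f x.

(** Such sets are open, and by [iso_open_ex] they form a basis of the topology. *)
Definition supported E (B : set (Iso d)) : Prop :=
  forall f h, agree E f h -> B f -> B h.

(** Compare the filter of neighbourhoods of [f] with the filter generated by the
    sets [agree E f], which converges pointwise to [f]. *)
Lemma iso_open_ex (U : set (Iso d)) f : open U -> U f ->
  exists E, agree E f `<=` U.
Proof.
move=> [V oV <-] /= Vf.
pose T := {ptws F -> discrete_topology F}.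
pose Fl : set_system T := filter_from [set: seq F]
  (fun E => [set g : T | forall x, x \in E -> g x = iso_fun f x]).
have FF : Filter Fl.
  apply: filter_from_filter; first by exists [::].
  move=> E1 E2 _ _; exists (E1 ++ E2) => // g /= H.
  by split=> x xE; apply: H; rewrite mem_cat xE ?orbT.
have : Fl --> (iso_fun f : T).
  apply/(@pointwise_cvgP (discrete_topology F) (discrete_topology F)) => x A.
  rewrite nbhs_principalE => /principal_filterP Ax.
  by exists [:: x] => // g /= -> //; rewrite mem_head.
move=> /(_ V) []; first exact: open_nbhs_nbhs.
move=> E _ EV; exists E => h hE; apply: EV => x xE; exact: hE.
Qed.

Lemma agree_open E f : open (agree E f).
Proof.
elim: E => [|x E IH].
  have -> : agree [::] f = setT by apply/seteqP; split.
  exact: openT.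
rewrite (_ : agree _ _ = [set h | iso_fun h x = iso_fun f x] `&` agree E f); last first.
  apply/seteqP; split=> h /=.
    by move=> H; split=> [|y yE]; apply: H; rewrite inE ?eqxx ?yE ?orbT.
  by move=> [hx hE] y; rewrite inE => /orP[/eqP ->|/hE].
apply: openI IH.
exists ((fun g : {ptws F -> discrete_topology F} => g x) @^-1` [set iso_fun f x]) => //.
apply: open_comp; last exact: discrete_open.
by move=> g _; exact: (@proj_continuous F (fun=> discrete_topology F) x).
Qed.

Lemma supported_open E B : supported E B -> open B.
Proof.
move=> BE; rewrite openE => f Bf; rewrite /interior nbhsE.
exists (agree E f); last by move=> h fh; exact: BE fh Bf.
by split=> //; exact: agree_open.
Qed.

End Topology.

(** * Left-invariant measures and unimodularity *)

Section Haar.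
Variables (R : realType) (d : nat).
Local Notation F := (free_group d).
Implicit Types (f h g : Iso d) (E : seq F) (x v w : F).

Lemma iso_compVK g f : iso_comp (iso_inv g) (iso_comp g f) = f.
Proof. by apply: iso_eqP => x; rewrite !iso_compE iso_invK. Qed.
Lemma iso_compKV g f : iso_comp g (iso_comp (iso_inv g) f) = f.
Proof. by apply: iso_eqP => x; rewrite !iso_compE iso_invKV. Qed.
Lemma iso_compVKr g f : iso_comp (iso_comp f (iso_inv g)) g = f.
Proof. by apply: iso_eqP => x; rewrite !iso_compE iso_invK. Qed.
Lemma iso_compKVr g f : iso_comp (iso_comp f g) (iso_inv g) = f.
Proof. by apply: iso_eqP => x; rewrite !iso_compE iso_invKV. Qed.

Lemma open_left g (U : set (Iso d)) : open U -> open [set f | U (iso_comp g f)].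
Proof.
move=> oU; rewrite openE => f /= Uf; rewrite /interior nbhsE.
have [E EU] := iso_open_ex oU Uf.
exists (agree E f); first by split => //; exact: agree_open.
by move=> h hE; apply: EU => x xE; rewrite !iso_compE hE.
Qed.

Lemma open_right g (U : set (Iso d)) : open U -> open [set f | U (iso_comp f g)].
Proof.
move=> oU; rewrite openE => f /= Uf; rewrite /interior nbhsE.
have [E EU] := iso_open_ex oU Uf.
exists (agree [seq iso_fun g x | x <- E] f); first by split => //; exact: agree_open.
by move=> h hE; apply: EU => x xE; rewrite !iso_compE hE // map_f.
Qed.

Lemma borel_open (T : ptopologicalType) (U : set (borel T)) :
  open (U : set T) -> measurable U.
Proof. exact: sub_sigma_algebra. Qed.

Lemma measurable_left g : measurable_fun setT (iso_comp g : borel (Iso d) -> borel (Iso d)).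
Proof.
apply: (@measurability _ _ (borel (Iso d)) (borel (Iso d)) setT _ (@open (Iso d))) => // _ [U oU <-]; rewrite setTI.
by apply: (@borel_open (Iso d)); exact: open_left.
Qed.

Lemma measurable_right g :
  measurable_fun setT ((fun f => iso_comp f g) : borel (Iso d) -> borel (Iso d)).
Proof.
apply: (@measurability _ _ (borel (Iso d)) (borel (Iso d)) setT _ (@open (Iso d))) => // _ [U oU <-]; rewrite setTI.
by apply: (@borel_open (Iso d)); exact: open_right.
Qed.

Lemma supported_measurable E (B : set (borel (Iso d))) : @supported d E B -> measurable B.
Proof. by move=> BE; apply: (@borel_open (Iso d)); exact: supported_open BE. Qed.

Lemma supportedI E1 E2 (A B : set (Iso d)) : supported E1 A -> supported E2 B ->
  supported (E1 ++ E2) (A `&` B).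
Proof.
move=> h1 h2 f h fh [Af Bf]; split; [apply: h1 Af|apply: h2 Bf] => x xE;
  by rewrite fh // mem_cat xE ?orbT.
Qed.

Lemma supportedW E1 E2 (A : set (Iso d)) : {subset E1 <= E2} ->
  supported E1 A -> supported E2 A.
Proof. by move=> s12 h f k fk; apply: h => x /s12; exact: fk. Qed.

Lemma supported_right E (B : set (Iso d)) g : supported E B ->
  supported [seq iso_fun g x | x <- E] [set f | B (iso_comp f g)].
Proof.
move=> BE f h fh; apply: BE => x xE; rewrite !iso_compE; apply: fh; exact: map_f.
Qed.

Definition germ_on E f : seq F := [seq iso_fun f x | x <- E].

Lemma germ_onP E f h : germ_on E f = germ_on E h <-> agree E f h.
Proof.
split=> [/eq_in_map fh x xE|fh]; first by rewrite fh.
by apply/eq_in_map => x xE; rewrite fh.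
Qed.

Lemma supported_germ_on E o : supported E [set f | germ_on E f = o].
Proof. by move=> f h /germ_onP fh /= <-. Qed.

Definition left_invariant (nu : set (borel (Iso d)) -> \bar R) : Prop :=
  forall (g : Iso d) (A : set (borel (Iso d))), measurable A ->
  nu (iso_comp g @` A) = nu A.

Section LeftInvariant.
Variable nu : {measure set (borel (Iso d)) -> \bar R}.
Hypothesis nuL : left_invariant nu.

Lemma left_preimage g (A : set (borel (Iso d))) : measurable A ->
  nu [set f | A (iso_comp g f)] = nu A.
Proof.
move=> mA; rewrite -(nuL (iso_inv g) mA); congr (nu _).
apply/seteqP; split=> [f Af|_ [f Af <-]] /=; last by rewrite iso_compKV.
by exists (iso_comp g f) => //; rewrite iso_compVK.
Qed.

Lemma agree_measure E f : nu (agree E f) = nu (agree E (iso_id d)).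
Proof.
have mf h : measurable (agree E h : set (borel (Iso d))).
  by apply: (@borel_open (Iso d)); exact: agree_open.
rewrite -(left_preimage f (mf f)); congr (nu _); apply/seteqP; split=> h H x xE.
  by apply: (@iso_inj _ f); rewrite -iso_compE H.
by rewrite iso_compE H.
Qed.

Lemma measure_by_key (T : choiceType) (k : Iso d -> T) (V : set (borel (Iso d))) (O : set T) :
  (forall o, measurable (V `&` [set f | k f = o])) -> finite_set O ->
  (forall f, V f -> O (k f)) ->
  nu V = \sum_(o \in O) nu (V `&` [set f | k f = o]).
Proof.
move=> mV Of VO.
have {1}-> : V = \bigcup_(o in O) (V `&` [set f | k f = o]).
  apply/seteqP; split=> [f Vf|f [s _ []]//].
  by exists (k f) => //; exact: VO.
apply: measure_fin_bigcup => //.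
by move=> o o' _ _ [f [[_ <-] [_ <-]]].
Qed.

Definition fixes1 v : set (Iso d) := agree [:: v] (iso_id d).

Lemma fixes1P v f : fixes1 v f <-> iso_fun f v = v.
Proof.
split=> [->//|fv x]; [by rewrite mem_head|by rewrite inE => /eqP ->].
Qed.

Lemma fixes1_supported v : supported [:: v] (fixes1 v).
Proof. by move=> f h fh /fixes1P ff; apply/fixes1P; rewrite fh ?mem_head. Qed.

(** The image of a fixed neighbour cuts the stabiliser of a vertex into [2 d] left
    translates of the pointwise stabiliser of the edge, which is the same for both
    ends. *)
Lemma stab_adj v a : nu (fixes1 v) = nu (fixes1 (v * gl a)%g).
Proof.
have H u c : nu (fixes1 u) = \sum_(o \in [set gl b | b in [set: letter d]])
      nu (agree [:: u; (u * gl c)%g] (iso_id d)).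
  pose k f := ((iso_fun f u)^-1 * iso_fun f (u * gl c))%g.
  have mk o : measurable (fixes1 u `&` [set f | k f = o] : set (borel (Iso d))).
    apply: (supported_measurable (E := [:: u] ++ [:: u; (u * gl c)%g])).
    apply: supportedI; first exact: fixes1_supported.
    by move=> f h fh /= <-; rewrite /k !fh // !inE eqxx ?orbT.
  rewrite (measure_by_key mk (O := [set gl b | b in [set: letter d]])).
  - apply: eq_fsbigr => _ /set_mem[b _ <-].
    rewrite -(agree_measure _ (swap_at u c b)); congr (nu _).
    apply/seteqP; split=> f.
      move=> [/fixes1P fu fc] x; rewrite !inE => /orP[]/eqP ->.
        by rewrite fu swap_at_center.
      by rewrite swap_atE -[in RHS]fu -fc /k mulVKg.
    move=> H; split; first by apply/fixes1P; rewrite H ?mem_head // swap_at_center.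
    rewrite /= /k !H ?inE ?eqxx ?orbT // swap_atE swap_at_center.
    by rewrite mulKg.
  - exact/finite_image/finite_finset.
  - move=> f /fixes1P fu; have [b fb] : adj (iso_fun f u) (iso_fun f (u * gl c)%g).
      by apply/iso_adj; exists c.
    by exists b => //=; rewrite /k fb mulKg.
rewrite (H v a) (H (v * gl a)%g (letter_inv a)) -glV mulgK.
apply: eq_fsbigr => _ _; congr (nu _); apply/seteqP.
by split=> f fh x; rewrite !inE orbC => xE; apply: fh; rewrite !inE.
Qed.

Lemma stab_const v w : nu (fixes1 v) = nu (fixes1 w).
Proof.
suff H u : nu (fixes1 u) = nu (fixes1 1%g) by rewrite (H v) (H w).
by elim/fg_ind: u => // x a _ <-; rewrite -stab_adj.
Qed.

End LeftInvariant.

Lemma sume_const (T : Type) (s : seq T) (a : \bar R) : (0 <= a)%E ->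
  (\sum_(i <- s) a = (size s)%:R%:E * a)%E.
Proof.
move=> a0; elim: s => [|x s IH]; first by rewrite big_nil mul0e.
by rewrite big_cons IH /= -natr1 EFinD ge0_muleDl ?lee_fin // mul1e addeC.
Qed.

Lemma natmule_inj n (a b : \bar R) : (0 < n)%N ->
  (n%:R%:E * a = n%:R%:E * b)%E -> a = b.
Proof.
move=> n0 E; have n0' : (0 < n%:R%:E :> \bar R)%E by rewrite lte_fin ltr0n.
have fn : (n%:R%:E : \bar R) \is a fin_num by [].
by apply/eqP; rewrite eq_le -(lee_pmul2l fn n0') E lexx -(lee_pmul2l fn n0') E lexx.
Qed.

(** Adding [1] to [E], the set [B] is a countable disjoint union of left
    translates of the pointwise stabiliser of [E], and the stabiliser of [1] is a
    finite union of them; their number does not depend on the measure. *)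
Lemma left_invariant_unique (nu nu' : {measure set (borel (Iso d)) -> \bar R}) :
  left_invariant nu ->
  left_invariant nu' ->
  nu (fixes1 1%g) = nu' (fixes1 1%g) ->
  forall E B, supported E B -> nu B = nu' B.
Proof.
move=> nuL nuL' nu1.
have agr E : 1%g \in E -> nu (agree E (iso_id d)) = nu' (agree E (iso_id d)).
  move=> E1; pose O := [set germ_on E f | f in fixes1 1%g].
  have Of : finite_set O.
    apply: (@sub_finite_set _ _ (@box d (size E) (\max_(x <- E) size (fg_word x)))).
      move=> _ [f /fixes1P f1 <-]; split; first by rewrite size_map.
      move=> _ /mapP[x xE ->]; rewrite iso_size1 //.
      exact: (@leq_bigmax_seq _ E xpredT (fun x : F => size (fg_word x))).
    exact: finite_box.
  have On : (0 < size (fset_set O))%N.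
    rewrite -[size _]/(#|` fset_set O|) cardfs_gt0; apply/fset0Pn.
    exists (germ_on E (iso_id d)); rewrite in_fset_set // inE.
    by exists (iso_id d) => //; exact/fixes1P.
  have mk o : measurable (fixes1 1%g `&` [set f | germ_on E f = o] : set (borel (Iso d))).
    apply: (supported_measurable (E := [:: 1%g] ++ E)).
    by apply: supportedI; [exact: fixes1_supported|exact: supported_germ_on].
  have H (m : {measure set (borel (Iso d)) -> \bar R}) :
      left_invariant m ->
      m (fixes1 1%g) = ((size (fset_set O))%:R%:E * m (agree E (iso_id d)))%E.
    move=> mL; rewrite -sume_const // (measure_by_key m mk Of); last first.
      by move=> f f1; exists f.
    rewrite fsbig_finite //=; rewrite !big_seq; apply: eq_bigr => o.
    rewrite in_fset_set // inE => -[f /fixes1P f1 <-].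
    rewrite -(agree_measure mL _ f); congr (m _); apply/seteqP; split=> h.
      by move=> [_ /esym/germ_onP].
    by move=> fh; split; [apply/fixes1P; rewrite fh|apply/esym/germ_onP].
  apply: (natmule_inj On); rewrite -(H _ nuL) -(H _ nuL'); exact: nu1.
move=> E0 B BE0; pose E := 1%g :: E0.
have BE : supported E B by apply: supportedW BE0 => x; rewrite inE orbC => ->.
(* each piece is empty or a left translate of the pointwise stabiliser of [E] *)
pose W n := B `&` [set f | choice.pickle (germ_on E f) = n].
have mW n : measurable (W n : set (borel (Iso d))).
  apply: (supported_measurable (E := E ++ E)); apply: supportedI => //.
  by move=> f h /germ_onP fh En; rewrite /= -[RHS]En; exact: (congr1 _ (esym fh)).
have BW : B = \bigcup_n W n.
  by apply/seteqP; split=> [f Bf|f [n _ []]//]; exists (choice.pickle (germ_on E f)).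
have tW : trivIset setT W by move=> i j _ _ [f [[_ <-] [_ <-]]].
rewrite BW !measure_bigcup //; apply: eq_eseriesr => n _.
have [->|/set0P[f [Bf fn]]] := eqVneq (W n) set0; first by rewrite !measure0.
have -> : W n = agree E f.
  apply/seteqP; split=> h; first by move=> [_ hn]; apply/germ_onP/(pcan_inj choice.pickleK); rewrite fn.
  by move=> fh; split; [exact: BE fh Bf|move/germ_onP: fh => /= <-].
by rewrite (agree_measure nuL) (agree_measure nuL') agr // mem_head.
Qed.

Variable nu : {measure set (borel (Iso d)) -> \bar R}.
Hypothesis nuL : left_invariant nu.

(** Right translation sends [nu] to another left-invariant measure, and it sends
    the stabiliser of [1] to a left translate of the stabiliser of another vertex. *)
Lemma right_invariance g E B : supported E B -> nu [set f | B (iso_comp f g)] = nu B.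
Proof.
move=> BE.
pose nu' : {measure set (borel (Iso d)) -> \bar R} :=
  measure_function_pushforward__canonical__measure_function_Measure nu (measurable_right g).
have nu'E A : nu' A = nu [set f | A (iso_comp f g)] by [].
rewrite -nu'E; apply: left_invariant_unique BE => //.
  move=> k A mA; rewrite !nu'E.
  have mA' : measurable ([set f | A (iso_comp f g)] : set (borel (Iso d))).
    by rewrite -[X in measurable X]setTI; exact: measurable_right.
  rewrite -[RHS](nuL k) //; congr (nu _); apply/seteqP; split=> [f [h Ah E1]|_ [f Af <-]].
    exists (iso_comp h (iso_inv g)); first by rewrite /= iso_compVKr.
    by rewrite iso_compA E1 iso_compKVr.
  by exists (iso_comp f g) => //; rewrite iso_compA.
rewrite nu'E.
have -> : [set f | fixes1 1%g (iso_comp f g)] =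
    agree [:: iso_fun g 1%g] (iso_inv g).
  apply/seteqP; split=> f.
    by move=> /fixes1P f1 x; rewrite inE => /eqP ->; rewrite iso_invK.
  by move=> H; apply/fixes1P; rewrite iso_compE H ?mem_head // iso_invK.
by rewrite agree_measure //; exact: stab_const.
Qed.

End Haar.

(** * Haar probability of the quotients *)

Section Quotient.
Variables (R : realType) (d : nat) (L : groupClosed (free_group d)).
Local Notation F := (free_group d).
Implicit Types (f h g : Iso d) (E : seq F) (x v w l : F).

Lemma proj_eq f h : iso_proj L f = iso_proj L h <->
  exists2 l, l \in L & h = iso_comp (iso_left l) f.
Proof.
split=> [/eqmodP/asboolP//|H]; apply/eqmodP; exact/asboolP.
Qed.

Lemma proj_left l f : l \in L -> iso_proj L (iso_comp (iso_left l) f) = iso_proj L f.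
Proof. by move=> lL; apply/esym/proj_eq; exists l. Qed.

Lemma iso_left_inj l k f : iso_comp (iso_left l) f = iso_comp (iso_left k) f -> l = k.
Proof.
move=> /(congr1 (fun h => iso_fun h 1%g)); rewrite !iso_compE !iso_leftE.
exact: mulIg.
Qed.

Lemma iso_leftK l f : iso_comp (iso_left l^-1%g) (iso_comp (iso_left l) f) = f.
Proof. by apply: iso_eqP => x; rewrite !iso_compE !iso_leftE mulKg. Qed.

(** Saturated sets are the inverse images of subsets of the quotient by [L]. *)
Definition saturated (B : set (Iso d)) : Prop :=
  forall l f, l \in L -> B f -> B (iso_comp (iso_left l) f).

Lemma saturatedV B l f : saturated B -> l \in L -> B (iso_comp (iso_left l) f) -> B f.
Proof.
by move=> BL lL Bf; rewrite -(iso_leftK l f); apply: BL; rewrite ?gpredV.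
Qed.

Section Domains.
Variable nu : {measure set (borel (Iso d)) -> \bar R}.
Hypothesis nuL : left_invariant nu.

(** Cut [D] along the translates of [D'] by the countable group [L] and translate
    the pieces back into [D']. *)
Lemma domain_exchange (D D' B : set (borel (Iso d))) :
  measurable D -> measurable D' -> measurable B ->
  fundamental_domain L D -> fundamental_domain L D' -> saturated B ->
  nu (D `&` B) = nu (D' `&` B).
Proof.
move=> mD mD' mB fD fD' BL.
have ex (C : set (Iso d)) f : fundamental_domain L C ->
    exists2 l, l \in L & C (iso_comp (iso_left l) f).
  move=> fC; have [g [[Cg /esym/proj_eq[l lL E]] _]] := fC f.
  by exists l => //; rewrite -E.
have un (C : set (Iso d)) f l k : fundamental_domain L C -> l \in L -> k \in L ->
    C (iso_comp (iso_left l) f) -> C (iso_comp (iso_left k) f) -> l = k.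
  move=> fC lL kL Cl Ck; have [g [_ gu]] := fC f; apply: (@iso_left_inj _ _ f).
  by rewrite -(gu _ (conj Cl (proj_left _ lL))) -(gu _ (conj Ck (proj_left _ kL))).
(* [W] collects the part of [D] that [l] moves into [D'], and [W'] its image *)
pose W n : set (Iso d) := if choice.pickle_inv n is Some l then
  [set f | [/\ l \in L, D f, B f & D' (iso_comp (iso_left l) f)]] else set0.
pose W' n : set (Iso d) := if choice.pickle_inv n is Some l then
  [set f | [/\ l \in L, D' f, B f & D (iso_comp (iso_left l^-1%g) f)]] else set0.
have mleft l (A : set (borel (Iso d))) : measurable A ->
    measurable ([set f | A (iso_comp (iso_left l) f)] : set (borel (Iso d))).
  by move=> mA; rewrite -[X in measurable X]setTI; exact: measurable_left.
have mW n : measurable (W n : set (borel (Iso d))).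
  rewrite /W; case: choice.pickle_inv => [l|]; last exact: measurable0.
  have [lL|nL] := boolP (l \in L); last first.
    rewrite (_ : [set f | _] = set0); first exact: measurable0.
    by apply/seteqP; split=> // f [].
  rewrite (_ : [set f | _] = D `&` B `&` [set f | D' (iso_comp (iso_left l) f)]).
    by apply: measurableI; [exact: measurableI|exact: mleft].
  by apply/seteqP; split=> [f []//|f [[]]].
have mW' n : measurable (W' n : set (borel (Iso d))).
  rewrite /W'; case: choice.pickle_inv => [l|]; last exact: measurable0.
  have [lL|nL] := boolP (l \in L); last first.
    rewrite (_ : [set f | _] = set0); first exact: measurable0.
    by apply/seteqP; split=> // f [].
  rewrite (_ : [set f | _] = D' `&` B `&` [set f | D (iso_comp (iso_left l^-1%g) f)]).
    by apply: measurableI; [exact: measurableI|exact: mleft].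
  by apply/seteqP; split=> [f []//|f [[]]].
have tW : trivIset setT W.
  move=> i j _ _ [f []]; rewrite /W.
  have := @choice.pickle_invK [the countType of F] i; case: choice.pickle_inv => [l|//] /= <-.
  have := @choice.pickle_invK [the countType of F] j; case: choice.pickle_inv => [k|//] /= <-.
  move=> [lL _ _ Dl] [kL _ _ Dk]; congr choice.pickle; exact: un fD' lL kL Dl Dk.
have tW' : trivIset setT W'.
  move=> i j _ _ [f []]; rewrite /W'.
  have := @choice.pickle_invK [the countType of F] i; case: choice.pickle_inv => [l|//] /= <-.
  have := @choice.pickle_invK [the countType of F] j; case: choice.pickle_inv => [k|//] /= <-.
  move=> [lL _ _ Dl] [kL _ _ Dk]; congr choice.pickle; apply: invg_inj.
  by apply: un fD _ _ Dl Dk; rewrite gpredV.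
have -> : D `&` B = \bigcup_n W n.
  apply/seteqP; split=> [f [Df Bf]|f [n _]].
    have [l lL D'l] := ex _ f fD'; exists (choice.pickle l) => //.
    by rewrite /W choice.pickleK_inv.
  by rewrite /W; case: choice.pickle_inv => [l []|].
have -> : D' `&` B = \bigcup_n W' n.
  apply/seteqP; split=> [f [Df Bf]|f [n _]].
    have [l lL Dl] := ex _ f fD; exists (choice.pickle l^-1%g) => //.
    by rewrite /W' choice.pickleK_inv; split; rewrite ?gpredV ?invgK.
  by rewrite /W'; case: choice.pickle_inv => [l []|].
rewrite !measure_bigcup //; apply: eq_eseriesr => n _.
have := mW' n; rewrite /W /W'; case: choice.pickle_inv => [l|//] mWl.
rewrite -(left_preimage nuL (iso_left l) mWl); congr (nu _).
apply/seteqP; split=> f /=; rewrite iso_leftK => -[lL H1 H2 H3]; split=> //.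
  exact: BL.
exact: saturatedV BL lL H2.
Qed.

Definition icoset f : coset_space L := \pi_(coset_space L) (iso_fun f 1)^-1%g.

(** A fundamental domain of finite support: the isometries sending [1] to the
    inverse of the chosen representative of a coset. Inverses are taken because [L]
    acts on the left on isometries, while the cosets are left cosets. *)
Definition base_domain : set (borel (Iso d)) :=
  [set f | (iso_fun f 1)^-1%g = repr (icoset f)].

Lemma base_domain_supported : supported [:: 1%g] base_domain.
Proof. by move=> f h fh; rewrite /base_domain /icoset /= fh ?mem_head. Qed.

Lemma icoset_left l f : l \in L -> icoset (iso_comp (iso_left l) f) = icoset f.
Proof.
move=> lL; apply/coset_eq; rewrite iso_compE iso_leftE invgM invgM !invgK -mulgA mulgV mulg1.
exact: lL.
Qed.

Lemma base_domainP : fundamental_domain L base_domain.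
Proof.
move=> f; pose l := ((iso_fun f 1)^-1^-1 * repr (icoset f))%g.
have lL : l \in L by apply/coset_eq; rewrite reprK.
pose g := iso_comp (iso_left l^-1%g) f.
have l'L : (l^-1)%g \in L by rewrite gpredV.
have Dg : base_domain g.
  rewrite /base_domain /= icoset_left // invgM invgK /l invgK mulKg //.
exists g; split; first by split=> //; exact: proj_left.
move=> h [Dh /esym/proj_eq[k kL Eh]]; rewrite Eh /g; congr (iso_comp (iso_left _) f).
move: Dh; rewrite Eh /base_domain /= icoset_left //.
rewrite invgM => Ek; apply: invg_inj; rewrite invgK /l -Ek invgK mulVKg //.
Qed.

Lemma base_domain_icoset (q : coset_space L) :
  nu (base_domain `&` [set f | icoset f = q]) = nu (fixes1 1%g).
Proof.
rewrite -(agree_measure nuL _ (iso_left (repr q)^-1%g)); congr (nu _).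
apply/seteqP; split=> f.
  by move=> [Df fq] x; rewrite inE => /eqP ->; rewrite iso_leftE mulg1 -fq -Df invgK.
move=> H; have f1 := H _ (mem_head _ _); rewrite iso_leftE mulg1 in f1.
have fq : icoset f = q by rewrite /icoset f1 invgK reprK.
by split=> //; rewrite /base_domain /= fq f1 invgK.
Qed.

End Domains.

(** The subset of the quotient whose inverse image is the saturated set [B]. *)
Definition qset (B : set (Iso d)) : set (borel (iso_quot L)) := [set q | B (repr q)].

Lemma repr_proj f : exists2 l, l \in L & repr (iso_proj L f) = iso_comp (iso_left l) f.
Proof. by apply/proj_eq; rewrite /iso_proj reprK. Qed.

Lemma qset_proj B f : saturated B -> qset B (iso_proj L f) <-> B f.
Proof.
move=> BL; rewrite /qset /=; have [l lL ->] := repr_proj f.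
by split; [exact: saturatedV|exact: BL].
Qed.

Lemma proj_repr (q : iso_quot L) : iso_proj L (repr q) = q.
Proof. exact: reprK. Qed.

Lemma qset_preimage B : saturated B -> iso_proj L @^-1` qset B = B.
Proof. by move=> BL; apply/seteqP; split=> f /(qset_proj f BL). Qed.

Lemma qset_measurable E B : saturated B -> supported E B -> measurable (qset B).
Proof.
move=> BL BE; apply: (@borel_open (iso_quot L)).
suff : open (iso_proj L @^-1` qset B) by [].
by rewrite qset_preimage //; exact: supported_open BE.
Qed.

Variable m : probability (borel (iso_quot L)) R.
Hypothesis mH : is_haar_prob m.

(** The fundamental domain given with a Haar probability is only measurable; it
    can be exchanged for [base_domain], which has finite support. *)
Lemma haar_prob_formula : exists nu : {measure set (borel (Iso d)) -> \bar R},
  [/\ left_invariant nu,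
    nu base_domain \is a fin_num &
    forall E B, saturated B -> supported E B ->
      m (qset B) = ((fine (nu base_domain))^-1%:E * nu (base_domain `&` B))%E].
Proof.
have [nu [D [nuH mD fD /andP[D0 Doo] mE]]] := mH.
have nuL := haar_left nuH.
have mB0 : measurable base_domain := supported_measurable base_domain_supported.
have X B : measurable (B : set (borel (Iso d))) -> saturated B ->
    nu (D `&` B) = nu (base_domain `&` B).
  by move=> mB BL; apply: domain_exchange => //; exact: base_domainP.
have XT : nu D = nu base_domain by have := X setT measurableT (fun _ _ _ _ => I); rewrite !setIT.
exists nu; split=> //.
  by rewrite -XT ge0_fin_numE // ltW.
move=> E B BL BE; rewrite mE; last exact: qset_measurable BE.
rewrite qset_preimage // XT X //; exact: supported_measurable BE.
Qed.

(** A right translate of a fundamental domain is again a fundamental domain, so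
    the invariance of [nu] on the right passes to the quotient. *)
Lemma haar_prob_right g E B : saturated B -> supported E B ->
  m (qset [set f | B (iso_comp f g)]) = m (qset B).
Proof.
move=> BL BE; have [nu [nuL nufin H]] := haar_prob_formula.
have BgL : saturated [set f | B (iso_comp f g)].
  by move=> l f lL /= Bf; rewrite -iso_compA; exact: BL.
rewrite (H _ _ BL BE) (H _ _ BgL (@supported_right _ _ _ g BE)); congr (_ * _)%E.
pose D' := [set f | base_domain (iso_comp f g)].
have mD' : measurable (D' : set (borel (Iso d))).
  exact: supported_measurable (@supported_right _ _ _ g base_domain_supported).
have fD' : fundamental_domain L D'.
  move=> f; have [h [[Dh ph] hu]] := base_domainP (iso_comp f g).
  exists (iso_comp h (iso_inv g)); split.
    split; first by rewrite /D' /= iso_compVKr.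
    move/esym/proj_eq: ph => [l lL ->]; rewrite -iso_compA iso_compKVr.
    exact: proj_left.
  move=> k [Dk /esym/proj_eq[l lL Ek]].
  rewrite (hu (iso_comp k g)) ?iso_compKVr //; split=> //.
  by rewrite Ek -iso_compA proj_left.
rewrite (domain_exchange nuL _ mD' _ base_domainP fD' BgL).
- rewrite -(right_invariance nuL g (supportedI base_domain_supported BE)).
  by congr (nu _).
- exact: supported_measurable base_domain_supported.
- exact: supported_measurable (@supported_right _ _ _ g BE).
Qed.

Lemma icoset_saturated (P : set (coset_space L)) : saturated [set f | P (icoset f)].
Proof. by move=> l f lL /=; rewrite icoset_left. Qed.

Lemma icoset_supported (P : set (coset_space L)) : supported [:: 1%g] [set f | P (icoset f)].
Proof. by move=> f h fh; rewrite /= /icoset fh ?mem_head. Qed.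

Lemma haar_prob_icoset (q q' : coset_space L) :
  m (qset [set f | icoset f = q]) = m (qset [set f | icoset f = q']).
Proof.
have [nu [nuL nufin H]] := haar_prob_formula.
rewrite (H _ _ (@icoset_saturated [set q]) (@icoset_supported [set q])).
rewrite (H _ _ (@icoset_saturated [set q']) (@icoset_supported [set q'])).
by congr (_ * _)%E; rewrite !(base_domain_icoset nuL).
Qed.

End Quotient.

(** * Domination and Dynkin induction *)

Section Probability.
Variables (R : realType) (dd : measure_display) (X : measurableType dd).
Variable P : probability X R.
Implicit Types A B : set X.

Definition pr A : R := fine (P A).

Lemma prE A : measurable A -> P A = (pr A)%:E.
Proof. by move=> mA; rewrite /pr fineK // fin_num_measure. Qed.

Lemma pr_ge0 A : 0 <= pr A.
Proof. exact: fine_ge0. Qed.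

Lemma pr_le A B : measurable A -> measurable B -> A `<=` B -> pr A <= pr B.
Proof.
by move=> mA mB AB; rewrite -lee_fin -!prE //; apply: le_measure; rewrite ?inE.
Qed.

Lemma prT : pr setT = 1.
Proof. by rewrite /pr probability_setT. Qed.

Lemma pr_le1 A : measurable A -> pr A <= 1.
Proof. by move=> mA; rewrite -prT; exact: pr_le. Qed.

Lemma prU A B : measurable A -> measurable B -> A `&` B = set0 ->
  pr (A `|` B) = pr A + pr B.
Proof.
move=> mA mB AB; apply: EFin_inj; rewrite -prE; last exact: measurableU.
by rewrite EFinD -!prE // measureU.
Qed.

Lemma prI_setC A B : measurable A -> measurable B ->
  pr (B `&` ~` A) = pr B - pr (B `&` A).
Proof.
move=> mA mB; apply/eqP; rewrite eq_sym subr_eq addrC; apply/eqP.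
rewrite -prU; last first.
- by apply/seteqP; split=> // x [[_ Ax] [_]].
- by apply: measurableI => //; exact: measurableC.
- exact: measurableI.
by rewrite -setIUr setUv setIT.
Qed.

(** Integrate the pointwise inequality over [B]. *)
Lemma sum_pr_le (I : Type) (s : seq I) (A : I -> set X) B (C : R) :
  (forall i, measurable (A i)) -> measurable B ->
  (forall x, \sum_(i <- s) \1_(A i) x <= C) ->
  \sum_(i <- s) pr (A i `&` B) <= C * pr B.
Proof.
move=> mA mB H; rewrite -lee_fin EFinM -prE // -sumEFin.
have C0 : 0 <= C by apply: le_trans (H point); apply: sumr_ge0.
rewrite -(integral_cst P mB C%:E).
rewrite (eq_bigr (fun i => \int[P]_(x in B) (\1_(A i) x)%:E)%E); last first.
  by move=> i _; rewrite -prE; [rewrite integral_indic|exact: measurableI].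
rewrite -ge0_integral_sum //; last first.
  by move=> i; apply/measurable_EFinP; exact: measurable_indic.
apply: ge0_le_integral => //.
- by move=> x _; apply: sume_ge0 => i _; rewrite lee_fin.
- apply: emeasurable_sum => i; apply/measurable_EFinP; exact: measurable_indic.
- by move=> x _; rewrite sumEFin lee_fin.
Qed.

(** The lower bound is the upper bound for the complements of the [A i]. *)
Lemma avg_pr (I : Type) (s : seq I) (A : I -> set X) B (lo u : R) :
  (forall i, measurable (A i)) -> measurable B -> (0 < size s)%N ->
  (forall x, lo <= (\sum_(i <- s) \1_(A i) x) / (size s)%:R <= lo + u) ->
  lo * pr B <= (\sum_(i <- s) pr (A i `&` B)) / (size s)%:R <= (lo + u) * pr B.
Proof.
move=> mA mB s0 H; have s0R : 0 < (size s)%:R :> R by rewrite ltr0n.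
apply/andP; split.
  rewrite ler_pdivlMr //.
  have := @sum_pr_le _ s (fun i => ~` A i) B ((size s)%:R - lo * (size s)%:R).
  have -> : \sum_(i <- s) pr (~` A i `&` B) =
      (size s)%:R * pr B - \sum_(i <- s) pr (A i `&` B).
    rewrite (eq_bigr (fun i => pr B - pr (A i `&` B))); last first.
      by move=> i _; rewrite setIC prI_setC // setIC.
    by rewrite sumrB -sum1_size natr_sum mulr_suml; congr (_ - _); apply: eq_bigr => i _; rewrite mul1r.
  move=> /(_ (fun i => measurableC (mA i)) mB) HH.
  suff: (size s)%:R * pr B - \sum_(i <- s) pr (A i `&` B) <=
      ((size s)%:R - lo * (size s)%:R) * pr B by lra.
  apply: HH => x; have /andP[+ _] := H x; rewrite ler_pdivlMr // => Hx.
  have -> : \sum_(i <- s) \1_(~` A i) x = (size s)%:R - \sum_(i <- s) \1_(A i) x :> R.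
    rewrite -sum1_size natr_sum -sumrB; apply: eq_bigr => i _.
    rewrite !indicE in_setC; case: (x \in A i) => /=; lra.
  by lra.
rewrite ler_pdivrMr // mulrAC; apply: sum_pr_le => // x.
by have /andP[_] := H x; rewrite ler_pdivrMr.
Qed.

(** The functions [D i] stand for the defect of mixing, and [far k i] for
    [i] lying outside of the [k]-th finite set. Domination by the probability makes the
    tail of a countable disjoint union negligible uniformly in [i], so vanishing at
    infinity passes to such unions. *)
Lemma vanish_induction (J : Type) (far : nat -> J -> Prop) (G : set (set X))
    (D : J -> set X -> R) :
  (forall k l i, (k <= l)%N -> far l i -> far k i) ->
  @measurable _ X = <<s G >> -> setI_closed G ->
  (forall i A B, measurable A -> measurable B -> A `&` B = set0 ->
     D i (A `|` B) = D i A + D i B) ->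
  (forall i, D i setT = 0) ->
  (forall i A, measurable A -> `|D i A| <= pr A) ->
  (forall A, G A -> forall eps : R, 0 < eps -> exists k, forall i, far k i -> `|D i A| < eps) ->
  forall A, measurable A -> forall eps : R, 0 < eps ->
    exists k, forall i, far k i -> `|D i A| < eps.
Proof.
move=> farW GE GI DU DT Dle HG A mA.
rewrite GE in mA; move: A mA.
apply: dynkin_induction => //.
- by move=> eps e0; exists 0%N => i _; rewrite DT normr0.
- move=> A mA HA eps e0; have [k Hk] := HA _ e0; exists k => i fi.
  have : D i (A `|` ~` A) = D i A + D i (~` A).
    by apply: DU => //; [exact: measurableC|exact: setICr].
  rewrite setUv DT => /eqP; rewrite eq_sym addrC addr_eq0 => /eqP ->.
  by rewrite normrN; exact: Hk.
move=> Fs mF tF HF eps e0.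
have e2 : 0 < eps / 2 by rewrite divr_gt0.
pose U n := \bigcup_(k in [set k | (k < n)%N]) Fs k.
pose T := \bigcup_k Fs k.
have mU n : measurable (U n) by apply: bigcup_measurable => k _.
have mT : measurable T by apply: bigcup_measurable.
have US n : U n.+1 = U n `|` Fs n.
  apply/seteqP; split=> x.
    move=> [k /=]; rewrite ltnS leq_eqVlt => /orP[/eqP ->|kn] Fx; [by right|by left; exists k].
  by move=> [[k /= kn Fx]|Fx]; [exists k => //=; lia|exists n => /=].
have UF n : U n `&` Fs n = set0.
  apply/seteqP; split=> // x [[k /= kn Fk] Fn].
  have := tF k n I I; rewrite /= => E; have : k = n by apply: E; exists x.
  by lia.
(* the tail contributes at most its probability, whatever [i] is *)
have [n Hn] : exists n, pr (T `&` ~` U n) < eps / 2.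
  have : (P \o U) @ \oo --> P T.
    have -> : T = \bigcup_n U n.
      apply/seteqP; split=> [x [k _ Fx]|x [n _ [k _ Fx]]]; last by exists k.
      by exists k.+1 => //; exists k => /=.
    apply: nondecreasing_cvg_mu => //.
      exact: bigcup_measurable.
    by move=> i j ij; apply/subsetPset => x [k /= ki Fx]; exists k => //=; lia.
  rewrite (prE mT) => /fine_cvgP[_] /cvgrPdist_lt /(_ _ e2)[n _ /(_ n (leqnn n))] /=.
  rewrite -/(pr T) -/(pr (U n)) => H; exists n.
  rewrite prI_setC // setIC setIidl; first exact: le_lt_trans (ler_norm _) H.
  by move=> x [k _ Fx]; exists k.
have HU : forall n eps, 0 < eps -> exists k, forall i, far k i -> `|D i (U n)| < eps.
  elim=> [|j IH] e e0'.
    exists 0%N => i _; have -> : U 0%N = set0 by apply/seteqP; split=> // x [].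
    by apply: le_lt_trans (Dle i _ measurable0) _; rewrite /pr measure0.
  have e02 : 0 < e / 2 by rewrite divr_gt0.
  have [k1 H1] := IH _ e02; have [k2 H2] := HF j _ e02.
  exists (maxn k1 k2) => i fi; rewrite US DU //.
  have h1 := H1 i (farW _ _ _ (leq_maxl _ _) fi).
  have h2 := H2 i (farW _ _ _ (leq_maxr _ _) fi).
  by apply: le_lt_trans (ler_normD _ _) _; lra.
have [k Hk] := HU n _ e2; exists k => i fi.
have ET : T = U n `|` (T `&` ~` U n).
  apply/seteqP; split=> x; first by move=> Tx; have [|] := pselect (U n x); [left|right].
  by case=> [[k0 _ Fx]|[]//]; exists k0.
have mTU : measurable (T `&` ~` U n) by apply: measurableI => //; exact: measurableC.
rewrite -/T ET DU //; last by apply/seteqP; split=> // x [? []].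
have := Hk i fi; have := Dle i _ mTU; have := ler_normD (D i (U n)) (D i (T `&` ~` U n)).
by lra.
Qed.

End Probability.

(** * Cylinders of the projective limit and invariance of the measure *)

Section Limit.
Variables (R : realType) (d : nat) (Gam : subgroup_chain (free_group d)).
Local Notation F := (free_group d).
Local Notation X := (iso_lim_measurable Gam).
Implicit Types (f h t : Iso d) (E : seq F) (g x l : F) (z : iso_lim Gam).

Lemma chain_mono n k : (n <= k)%N -> {subset Gam k <= Gam n}.
Proof.
elim: k => [|k IH]; first by rewrite leqn0 => /eqP ->.
by rewrite leq_eqVlt => /orP[/eqP -> //|/IH H x /chain_le]; exact: H.
Qed.

Lemma saturatedW n k B : (n <= k)%N -> saturated (Gam n) B -> saturated (Gam k) B.
Proof. by move=> nk BL l f /(chain_mono nk); exact: BL. Qed.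

(** A representative of the [n]-th coordinate of a point of the limit. *)
Definition lim_rep z n : Iso d := repr (iso_lim_proj n z).

Lemma lim_rep_proj z n : iso_proj (Gam n) (lim_rep z n) = iso_lim_proj n z.
Proof. exact: proj_repr. Qed.

Lemma lim_rep_mono z n k : (n <= k)%N -> iso_proj (Gam n) (lim_rep z k) = iso_lim_proj n z.
Proof.
move=> nk; rewrite -(subnKC nk); elim: (k - n)%N => [|j IH].
  by rewrite addn0 lim_rep_proj.
rewrite -IH addnS; set i := (n + j)%N.
have : iso_proj (Gam i) (lim_rep z i.+1) = iso_proj (Gam i) (lim_rep z i).
  by rewrite lim_rep_proj; exact: svalP z i.
move=> /proj_eq[l lL ->]; rewrite proj_left //.
by apply: chain_mono lL; exact: leq_addr.
Qed.

Lemma lim_rep_level z n k : (n <= k)%N ->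
  exists2 l, l \in Gam n & lim_rep z n = iso_comp (iso_left l) (lim_rep z k).
Proof. by move=> nk; apply/proj_eq; rewrite lim_rep_mono // lim_rep_proj. Qed.

Definition cyl n (B : set (Iso d)) : set X := [set z | B (lim_rep z n)].

Lemma cylW n k B : (n <= k)%N -> saturated (Gam n) B -> cyl n B = cyl k B.
Proof.
move=> nk BL; apply/seteqP; split=> z; rewrite /cyl /=;
  have [l lL ->] := lim_rep_level z nk; [exact: saturatedV BL lL|exact: BL].
Qed.

Definition good_cylinders : set (set X) := [set C | exists n E B,
  [/\ saturated (Gam n) B, supported E B & C = cyl n B]].

Lemma good_common n k B B' E E' : saturated (Gam n) B -> supported E B ->
  saturated (Gam k) B' -> supported E' B' ->
  exists i, [/\ saturated (Gam i) B, saturated (Gam i) B',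
    cyl n B = cyl i B & cyl k B' = cyl i B'].
Proof.
move=> BL BE BL' BE'; exists (maxn n k); split.
- exact: saturatedW (leq_maxl _ _) BL.
- exact: saturatedW (leq_maxr _ _) BL'.
- exact: cylW (leq_maxl _ _) BL.
- exact: cylW (leq_maxr _ _) BL'.
Qed.

Lemma good_setI : setI_closed good_cylinders.
Proof.
move=> _ _ [n [E [B [BL BE ->]]]] [k [E' [B' [BL' BE' ->]]]].
have [i [B1 B2 -> ->]] := good_common BL BE BL' BE'.
exists i, (E ++ E'), (B `&` B'); split=> //; last exact: supportedI.
by move=> l f lL [Bf Bf']; split; [exact: B1|exact: B2].
Qed.

Lemma cyl_measurable n E B : saturated (Gam n) B -> supported E B -> measurable (cyl n B).
Proof.
move=> BL BE; apply: sub_sigma_algebra; exists n.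
by exists (@qset d (Gam n) B) => //; exact: qset_measurable BE.
Qed.

(** An open set of a quotient is a countable union of sets of finite support,
    because there are countably many finite lists of vertices; hence these cylinders
    generate all measurable sets. *)
Lemma good_generate : @measurable _ X = <<s good_cylinders >>.
Proof.
apply/seteqP; split; last first.
  apply: smallest_sub; first exact: sigma_algebra_measurable.
  by move=> _ [n [E [B [BL BE ->]]]]; exact: cyl_measurable BE.
apply: smallest_sub; first exact: smallest_sigma_algebra.
move=> _ [n [A mA ->]].
pose Y := g_sigma_algebraType good_cylinders.
have mp : measurable_fun setT (iso_lim_proj n : Y -> borel (iso_quot (Gam n))).
  apply: (@measurability _ _ Y (borel (iso_quot (Gam n))) setT _
    (@open (iso_quot (Gam n)))) => // _ [U oU <-]; rewrite setTI.
  (* the largest set supported on [E] inside the inverse image of [U] *)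
  pose V E : set (Iso d) := [set f | agree E f `<=` iso_proj (Gam n) @^-1` U].
  have VE E : supported E (V E).
    by move=> f h fh Vf k kh; apply: Vf => x xE; rewrite kh // fh.
  have VL E : saturated (Gam n) (V E).
    move=> l f lL Vf k kE; rewrite /= -(@proj_left _ _ l^-1%g) ?gpredV //.
    by apply: Vf => x xE; rewrite iso_compE kE // !iso_compE !iso_leftE mulKg.
  have -> : iso_lim_proj n @^-1` U =
      \bigcup_i cyl n (V (odflt [::] (choice.unpickle i))).
    apply/seteqP; split=> z.
      move=> Uz; have oU' : open (iso_proj (Gam n) @^-1` U) by [].
      have Uz' : U (iso_proj (Gam n) (lim_rep z n)) by rewrite lim_rep_proj.
      have [E EU] := iso_open_ex oU' Uz'.
      by exists (choice.pickle E) => //; rewrite choice.pickleK.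
    by move=> [i _] Vz; rewrite /= -lim_rep_proj; apply: Vz.
  apply: (@bigcup_measurable _ Y) => i _; apply: (@sub_sigma_algebra _ setT good_cylinders).
  by exists n, (odflt [::] (choice.unpickle i)), (V (odflt [::] (choice.unpickle i))); split.
by have := mp measurableT A mA; rewrite setTI.
Qed.

Lemma act_proj g z n : iso_lim_proj n (iso_lim_act g z) =
  iso_proj (Gam n) (iso_comp (lim_rep z n) (iso_left g^-1%g)).
Proof. by []. Qed.

Lemma cyl_act n B g : saturated (Gam n) B ->
  @iso_lim_act d Gam g @^-1` cyl n B = cyl n [set f | B (iso_comp f (iso_left g^-1%g))].
Proof.
move=> BL; have H z := qset_proj (iso_comp (lim_rep z n) (iso_left g^-1%g)) BL.
by apply/seteqP; split=> z /H.
Qed.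

Lemma iso_lim_eq z z' : (forall n, iso_lim_proj n z = iso_lim_proj n z') -> z = z'.
Proof.
case: z z' => [u Hu] [v Hv] H; apply: eq_exist.
by apply: functional_extensionality_dep => n; exact: H.
Qed.

Lemma limit_act1 z : iso_lim_act 1%g z = z.
Proof.
apply: iso_lim_eq => n; rewrite act_proj -[RHS]lim_rep_proj; congr iso_proj.
by apply: iso_eqP => x; rewrite iso_compE iso_leftE invg1 mul1g.
Qed.

Lemma limit_actM g g' z : iso_lim_act (g * g')%g z = iso_lim_act g (iso_lim_act g' z).
Proof.
apply: iso_lim_eq => n; rewrite [RHS](_ : _ = iso_quot_act g (iso_lim_proj n (iso_lim_act g' z))) //.
rewrite !act_proj iso_quot_actE -iso_compA; congr (iso_proj _ (iso_comp _ _)).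
by apply: iso_eqP => x; rewrite iso_compE !iso_leftE invgM mulgA.
Qed.

Lemma limit_actK g : cancel (@iso_lim_act d Gam g) (iso_lim_act g^-1%g).
Proof. by move=> z; rewrite -limit_actM mulVg limit_act1. Qed.

Lemma limit_actVK g : cancel (@iso_lim_act d Gam g^-1%g) (iso_lim_act g).
Proof. by move=> z; rewrite -limit_actM mulgV limit_act1. Qed.

Lemma act_image g (A : set X) :
  @iso_lim_act d Gam g @` A = @iso_lim_act d Gam g^-1%g @^-1` A.
Proof.
apply/seteqP; split=> [_ [z Az <-]|z Az] /=; first by rewrite limit_actK.
by exists (iso_lim_act g^-1%g z); rewrite ?limit_actVK.
Qed.

Lemma act_measurable g : measurable_fun setT (@iso_lim_act d Gam g : X -> X).
Proof.
apply: (@measurability _ _ X X setT _ good_cylinders good_generate).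
move=> _ [_ [n [E [B [BL BE ->]]]] <-]; rewrite setTI cyl_act //.
apply: cyl_measurable (@supported_right _ _ _ (iso_left g^-1%g) BE).
by move=> l f lL /= Bf; rewrite -iso_compA; exact: BL.
Qed.

Lemma act_preimage_measurable g (A : set X) : measurable A ->
  measurable (@iso_lim_act d Gam g @^-1` A : set X).
Proof. by move=> mA; rewrite -[X in measurable X]setTI; exact: act_measurable. Qed.

Variables (m : forall n, probability (borel (iso_quot (Gam n))) R)
  (mu : probability X R).
Hypothesis mH : forall n, is_haar_prob (m n).
Hypothesis muP : projective_limit_measure m mu.

Lemma mu_cyl n E B : saturated (Gam n) B -> supported E B ->
  mu (cyl n B) = m n (@qset d (Gam n) B).
Proof. by move=> BL BE; apply: muP; exact: qset_measurable BE. Qed.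

Lemma mu_right n E B t : saturated (Gam n) B -> supported E B ->
  mu (cyl n [set f | B (iso_comp f t)]) = mu (cyl n B).
Proof.
move=> BL BE; rewrite (mu_cyl BL BE) (@mu_cyl n [seq iso_fun t x | x <- E]).
- exact: (haar_prob_right (mH n)) BE.
- by move=> l f lL /= Bf; rewrite -iso_compA; exact: BL.
- exact: supported_right.
Qed.

(** Both sides are probabilities in [A], and they agree on the cylinders by the
    invariance on the right of the Haar probabilities. *)
Lemma mu_act g (A : set X) : measurable A -> mu (@iso_lim_act d Gam g @^-1` A) = mu A.
Proof.
rewrite good_generate => mA; move: A mA; apply: dynkin_induction => //.
- exact: good_generate.
- exact: good_setI.
- move=> _ [n [E [B [BL BE ->]]]]; rewrite cyl_act //; exact: mu_right BE.
- move=> A mA HA; have mA' := act_preimage_measurable g mA.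
  by rewrite preimage_setC !probability_setC // HA.
- move=> Fs mF tF HF; rewrite preimage_bigcup !measure_bigcup //.
  + by apply: eq_eseriesr => i _; exact: HF.
  + by move=> i _; exact: act_preimage_measurable.
  + move=> i j _ _ [z [Fi Fj]]; apply: (tF i j) => //.
    by exists (iso_lim_act g z).
Qed.

End Limit.

(** * Mixing *)

Section Mixing.
Variables (R : realType) (d : nat) (Gam : subgroup_chain (free_group d)).
Local Notation F := (free_group d).
Local Notation X := (iso_lim_measurable Gam).
Implicit Types (f h t : Iso d) (E : seq F) (g x l : F) (z : iso_lim Gam).
Variables (m : forall n, probability (borel (iso_quot (Gam n))) R)
  (mu : probability X R).
Hypothesis d2 : (2 <= d)%N.
Hypothesis Gfin : forall n, finite_index (Gam n).
Hypothesis Gnorm : forall n, normal_subgroup (Gam n).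
Hypothesis Godd : forall n, ~ bipartite (@schreier _ (Gam n) (@free_gens d)).
Hypothesis mH : forall n, is_haar_prob (m n).
Hypothesis muP : projective_limit_measure m mu.

Local Notation act := (@iso_lim_act d Gam).
Local Notation p := (pr mu).

Lemma pr_right n E B t : saturated (Gam n) B -> supported E B ->
  p (cyl n [set f | B (iso_comp f t)]) = p (cyl n B).
Proof. by move=> BL BE; rewrite /pr (mu_right mH muP t BL BE). Qed.

Definition defect g (A B : set X) : R :=
  p (act g^-1%g @^-1` A `&` B) - p A * p B.

(** For [t] in the list given by [averages_equidistribute], the intersection of
    the translate of [A0] with [B0] keeps its measure when [f] is replaced by [f t],
    because the measure is right invariant and [t] fixes what [B0] depends on.
    Averaging over [t] replaces the indicator of [A0] by an almost constant
    function, whose value is the measure of [A0]. *)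
Lemma defect_cyl n E1 E2 A0 B0 (eps : R) : 0 < eps ->
  saturated (Gam n) A0 -> supported E1 A0 -> saturated (Gam n) B0 -> supported E2 B0 ->
  exists k, forall g, (k <= size g)%N -> `|defect g (cyl n A0) (cyl n B0)| < eps.
Proof.
move=> e0 AL AE BL BE.
have e2 : 0 < eps / 2 by rewrite divr_gt0.
have prim := primitive d2 (Gfin n) (@Gnorm n) (@Godd n).
have Acong f f' : cong_on (Gam n) E1 f f' -> A0 f -> A0 f'.
  move=> [l lL H] Af; apply: (AE (iso_comp (iso_left l) f)); last exact: AL.
  by move=> x xE; rewrite iso_compE iso_leftE H.
have [k Hk] := averages_equidistribute (@Gnorm n) (\max_(x <- E2) size (fg_word x)) prim Acong e2.
exists k => g kg; have [Ls [L0 Loff [lo Hlo]]] := Hk g kg.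
pose At t : set X := cyl n [set f | A0 (iso_comp f (iso_comp t (iso_left g)))].
have mAt t : measurable (At t).
  apply: cyl_measurable (@supported_right _ _ _ (iso_comp t (iso_left g)) AE).
  by move=> l f lL /= Af; rewrite -iso_compA; exact: AL.
have mA : measurable (cyl n A0 : set X) by exact: cyl_measurable AL AE.
have mB : measurable (cyl n B0 : set X) by exact: cyl_measurable BL BE.
have Hrg z : lo <= (\sum_(t <- Ls) \1_(At t) z) / (size Ls)%:R <= lo + eps / 2.
  have := Hlo (lim_rep z n); rewrite /avg.
  rewrite (eq_bigr (fun t => \1_(At t) z : R)) // => t _.
  rewrite !indicE; congr (nat_of_bool _)%:R; apply/idP/idP; rewrite !inE /At /cyl /=;
    by rewrite iso_compA.
(* the intersection whose measure is to be compared with a product *)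
pose S := [set f | A0 (iso_comp f (iso_left g))] `&` B0.
have SL : saturated (Gam n) S.
  by move=> l f lL [Af Bf]; split; [rewrite /= -iso_compA; exact: AL|exact: BL].
have SE := supportedI (@supported_right _ _ _ (iso_left g) AE) BE.
have ES : act g^-1%g @^-1` cyl n A0 `&` cyl n B0 = cyl n S.
  by rewrite cyl_act // invgK.
have pS t : t \in Ls -> p (At t `&` cyl n B0) = p (cyl n S).
  move=> tL; rewrite -(@pr_right n _ S t SL SE); congr (p _).
  have Bt f : B0 (iso_comp f t) <-> B0 f.
    have H x : x \in E2 -> iso_fun t x = x.
      move=> xE; apply: (Loff _ tL).
      exact: (@leq_bigmax_seq _ E2 xpredT (fun x : F => size (fg_word x))).
    by split; apply: BE => x xE; rewrite iso_compE H.
  apply/seteqP; split=> z.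
    by move=> [Az Bz]; split; [rewrite /= -iso_compA|exact/Bt].
  by move=> [Az Bz]; split; [rewrite /At /cyl /= iso_compA|exact/Bt].
have pA t : p (At t `&` setT) = p (cyl n A0).
  by rewrite setIT; exact: pr_right AL AE.
have L0R : (size Ls)%:R != 0 :> R by rewrite pnatr_eq0 -lt0n.
have const (r : R) : (\sum_(t <- Ls) r) / (size Ls)%:R = r.
  by rewrite big_const_seq count_predT iter_addr_0 -[r *+ _]mulr_natr mulfK.
have := avg_pr mu mAt mB L0 Hrg.
have := avg_pr mu mAt (@measurableT _ X) L0 Hrg.
rewrite (eq_bigr (fun=> p (cyl n A0))) // const prT !mulr1.
rewrite (eq_big_seq (fun=> p (cyl n S))) // const => /andP[a1 a2] /andP[b1 b2].
rewrite /defect ES.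
have pB0 := pr_ge0 mu (cyl n B0); have pB1 := pr_le1 mu mB.
set a := p (cyl n A0) in a1 a2 *; set b := p (cyl n B0) in b1 b2 pB0 pB1 *.
set s := p (cyl n S) in b1 b2 *.
have h1 : lo * b <= a * b by rewrite ler_wpM2r.
have h2 : a * b <= (lo + eps / 2) * b by rewrite ler_wpM2r.
have h3 : eps / 2 * b <= eps / 2 by rewrite ler_piMr // ltW.
have h4 : (lo + eps / 2) * b = lo * b + eps / 2 * b by rewrite mulrDl.
by rewrite ltr_norml; apply/andP; split; lra.
Qed.

Lemma pre_measurable g (A : set X) : measurable A -> measurable (act g^-1%g @^-1` A : set X).
Proof. exact: act_preimage_measurable. Qed.

Lemma p_pre g (A : set X) : measurable A -> p (act g^-1%g @^-1` A) = p A.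
Proof. by move=> mA; rewrite /pr (mu_act mH muP). Qed.

Lemma defect_le_l g (A B : set X) : measurable A -> measurable B -> `|defect g A B| <= p A.
Proof.
move=> mA mB; have mA' := pre_measurable g mA.
have h1 : p (act g^-1%g @^-1` A `&` B) <= p A.
  by rewrite -(p_pre g mA); apply: pr_le => //; exact: measurableI.
have h0 := pr_ge0 mu (act g^-1%g @^-1` A `&` B).
have h2 : p A * p B <= p A by rewrite ler_piMr ?pr_le1 ?pr_ge0.
have h3 : 0 <= p A * p B by rewrite mulr_ge0 ?pr_ge0.
by rewrite /defect ler_norml; apply/andP; split; lra.
Qed.

Lemma defect_le_r g (A B : set X) : measurable A -> measurable B -> `|defect g A B| <= p B.
Proof.
move=> mA mB; have mA' := pre_measurable g mA.
have h1 : p (act g^-1%g @^-1` A `&` B) <= p B.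
  by apply: pr_le => //; exact: measurableI.
have h0 := pr_ge0 mu (act g^-1%g @^-1` A `&` B).
have h2 : p A * p B <= p B by rewrite ler_piMl ?pr_le1 ?pr_ge0.
have h3 : 0 <= p A * p B by rewrite mulr_ge0 ?pr_ge0.
by rewrite /defect ler_norml; apply/andP; split; lra.
Qed.

Lemma defect_vanishes (A B : set X) : measurable A -> measurable B ->
  forall eps : R, 0 < eps ->
  exists k, forall g, (k <= size g)%N -> `|defect g A B| < eps.
Proof.
pose far k (g : F) : Prop := (k <= size g)%N.
have farW k j g : (k <= j)%N -> far j g -> far k g by exact: leq_trans.
move=> mA mB; move: A mA.
suff HB A' : good_cylinders A' -> forall eps : R, 0 < eps ->
    exists k, forall g, (k <= size g)%N -> `|defect g A' B| < eps.
  apply: (@vanish_induction _ _ _ mu F far (@good_cylinders d Gam) (fun g A => defect g A B)) => //.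
  - exact: good_generate.
  - exact: good_setI.
  - move=> g A1 A2 m1 m2 A12; rewrite /defect preimage_setU setIUl !prU //.
    + by rewrite mulrDl opprD addrACA.
    + by apply: measurableI => //; exact: pre_measurable.
    + by apply: measurableI => //; exact: pre_measurable.
    + rewrite -setIIl -preimage_setI A12 preimage_set0 set0I //.
  - by move=> g; rewrite /defect preimage_setT setTI prT mul1r subrr.
  - by move=> g A1 m1; exact: defect_le_l.
move=> GA; have mA : measurable (A' : set X).
  by rewrite good_generate; exact: sub_sigma_algebra.
move: B mB.
apply: (@vanish_induction _ _ _ mu F far (@good_cylinders d Gam) (fun g B => defect g A' B)) => //.
- exact: good_generate.
- exact: good_setI.
- have mA' g := pre_measurable g mA.
  move=> g A1 A2 m1 m2 A12; rewrite /defect setIUr !prU //.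
  + by rewrite mulrDr opprD addrACA.
  + exact: measurableI.
  + exact: measurableI.
  + by rewrite setIACA setIid A12 setI0.
- by move=> g; rewrite /defect setIT prT mulr1 p_pre // subrr.
- by move=> g A1 m1; exact: defect_le_r.
move=> _ [n [E [B [BL BE ->]]]] eps e0.
move: GA => [n' [E' [A [AL AE ->]]]].
have [i [A1 B1 -> ->]] := good_common AL AE BL BE.
exact: defect_cyl AE B1 BE.
Qed.

Lemma limit_mixing : mixing mu act.
Proof.
move=> A B mA mB eps e0; have [k Hk] := defect_vanishes mA mB e0.
apply: sub_finite_set (finite_ball d k) => g /= H; rewrite leqNgt; apply/negP => kg.
have := Hk g (ltnW kg); rewrite /defect -act_image ltNge; move/negP; apply; exact: H.
Qed.

Lemma act_preserves g (A : set X) : measurable A -> mu (act g @` A) = mu A.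
Proof. by move=> mA; rewrite act_image; exact: (mu_act mH muP). Qed.

End Mixing.

(** The set [X] with the ultrametric for which [x] and [y] are close when many of
    their first observations agree. *)
Definition coded (R : realType) (X : Type) (code : nat -> X -> nat) : Type := X.

(** * Polish topologies defined by countably many observations *)

Section Coded.
Variables (R : realType) (X : pointedType) (code : nat -> X -> nat).
Local Notation Y := (coded R code).

(** The radius is required to be positive, without which the triangle inequality
    would fail for sums of radii of opposite signs. *)
Definition code_ball (x : Y) (e : R) (y : Y) : Prop :=
  0 < e /\ forall n, e <= n.+1%:R^-1 -> code n x = code n y.

Lemma code_ball_center x (e : R) : 0 < e -> code_ball x e x.
Proof. by []. Qed.

Lemma code_ball_sym x y (e : R) : code_ball x e y -> code_ball y e x.
Proof. by move=> [e0 H]; split=> // n /H. Qed.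

Lemma code_ball_triangle x y z (e1 e2 : R) :
  code_ball x e1 y -> code_ball y e2 z -> code_ball x (e1 + e2) z.
Proof.
move=> [e10 H1] [e20 H2]; split; first exact: addr_gt0.
move=> n le_n; rewrite H1 ?H2 //; apply: le_trans le_n;
  by rewrite ?lerDl ?lerDr ltW.
Qed.

HB.instance Definition _ := Pointed.on Y.
HB.instance Definition _ := Choice.on Y.
HB.instance Definition _ := hasNbhs.Build Y (nbhs_ (entourage_ code_ball)).
HB.instance Definition _ := @Nbhs_isPseudoMetric.Build R Y (entourage_ code_ball) erefl
  code_ball code_ball_center code_ball_sym code_ball_triangle erefl.

Hypothesis code_inj : forall x y, (forall n, code n x = code n y) -> x = y.
Hypothesis code_complete : forall v : nat -> nat,
  (forall N, exists x, forall n, (n <= N)%N -> code n x = v n) ->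
  exists x, forall n, code n x = v n.

Lemma code_nbhs (x : Y) N : nbhs x [set y : Y | forall n, (n <= N)%N -> code n x = code n y].
Proof.
apply/nbhs_ballP; exists (N.+1%:R^-1) => /=; first by rewrite invr_gt0 ltr0n.
move=> y [_ H] n nN; apply: H.
by rewrite lef_pV2 ?posrE ?ltr0n // ler_nat.
Qed.

Lemma code_nbhs_ex (x : Y) (A : set Y) : nbhs x A ->
  exists N, forall y : Y, (forall n, (n <= N)%N -> code n x = code n y) -> A y.
Proof.
move/nbhs_ballP => [e /= e0 eA]; exists (Num.truncn e^-1) => y H; apply: eA.
split=> // n en; apply: H; apply: ltnW; rewrite truncn_gt_nat.
by rewrite -[leLHS]invrK lef_pV2 ?posrE ?invr_gt0 ?ltr0n.
Qed.

(** The points whose first observations are prescribed by [s]; finite lists of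
    numbers being countable, these sets form a countable basis. *)
Definition code_basic (s : seq nat) : set Y :=
  [set y | forall i, (i < size s)%N -> code i y = nth 0%N s i].

Definition code_prefix (x : Y) N : seq nat := mkseq (fun i => code i x) N.

Lemma code_basicP (x y : Y) N :
  code_basic (code_prefix x N) y <-> forall i, (i < N)%N -> code i y = code i x.
Proof.
rewrite /code_basic /code_prefix /= size_mkseq.
by split=> H i iN; have := H i iN; rewrite nth_mkseq.
Qed.

Lemma code_basic_open s : open (code_basic s).
Proof.
rewrite openE => x xs; rewrite /interior; apply: filterS (code_nbhs x (size s)).
by move=> y xy i si; rewrite -xy ?xs // ltnW.
Qed.

Lemma code_second_countable : @second_countable Y.
Proof.
exists (range code_basic); first by apply: sub_countable (card_image_le _ _) _; exact: countableP.
split=> [_ [s _ <-]|x A /code_nbhs_ex[N NA]]; first exact: code_basic_open.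
exists (code_basic (code_prefix x N.+1)).
  by split; [exists (code_prefix x N.+1)|apply/code_basicP].
by move=> y /code_basicP xy; apply: NA => n nN; rewrite xy.
Qed.

Lemma code_hausdorff : hausdorff_space Y.
Proof.
move=> x y xy; apply: code_inj => n.
have [z [xz yz]] := xy _ _ (code_nbhs x n) (code_nbhs y n).
by rewrite xz // yz.
Qed.

Lemma code_cauchy (Fl : set_system Y) : ProperFilter Fl -> cauchy Fl -> cvg Fl.
Proof.
move=> PF cF.
have val n : exists v, Fl [set x : Y | code n x = v].
  have : entourage [set xy : Y * Y | ball xy.1 (n.+1%:R^-1 : R) xy.2].
    by rewrite -(@entourage_ballE R); exists (n.+1%:R^-1) => //=; rewrite invr_gt0 ltr0n.
  move=> /cF[[A B] /= [FA FB] AB].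
  have [x [Ax Bx]] := filter_ex (filterI FA FB).
  exists (code n x); apply: filterS FA => y Ay.
  by have [_ /(_ n (lexx _))] := AB (y, x) (conj Ay Bx).
have [v vP] := choice val.
have vN N : Fl [set x : Y | forall n, (n <= N)%N -> code n x = v n].
  elim: N => [|N IH].
    by apply: filterS (vP 0%N) => x x0 n; rewrite leqn0 => /eqP ->.
  apply: filterS (filterI IH (vP N.+1)) => x [H xN] n.
  by rewrite leq_eqVlt => /orP[/eqP -> //|]; exact: H.
have [x xP] := code_complete (fun N => filter_ex (vN N)).
apply/cvg_ex; exists x => A /code_nbhs_ex[N NA].
by apply: filterS (vN N) => y yP; apply: NA => n nN; rewrite xP yP.
Qed.

HB.instance Definition _ := Uniform_isComplete.Build Y code_cauchy.

Definition code_space : completePseudoMetricType R := Y.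

End Coded.

Section CodedBorel.
Variables (R : realType) (dd : measure_display) (X : measurableType dd).
Variable code : nat -> X -> nat.

Definition fibres : set (set X) :=
  [set C | exists n v, C = [set x | code n x = v]].

(** The values of the observations in [s] cut [S] into countably many pieces, each
    of which is empty or a finite intersection of fibres. *)
Lemma fibres_finite (s : seq nat) (S : set X) :
  (forall x y, (forall i, i \in s -> code i x = code i y) -> S x -> S y) ->
  <<s fibres >> S.
Proof.
move=> HS; pose T := g_sigma_algebraType fibres.
have mf i v : measurable ([set x | code i x = v] : set T).
  by apply: (@sub_sigma_algebra _ setT fibres); exists i, v.
have -> : S = \bigcup_n (S `&` [set x | choice.pickle [seq code i x | i <- s] = n]).
  apply/seteqP; split=> [x Sx|x [n _ []//]].
  by exists (choice.pickle [seq code i x | i <- s]).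
apply: (@bigcup_measurable _ T) => n _.
have [->|/set0P[x [Sx <-]]] := eqVneq (S `&` [set x | choice.pickle [seq code i x | i <- s] = n]) set0.
  exact: (@measurable0 _ T).
rewrite (_ : _ `&` _ = \bigcap_(i in [set` s]) [set y | code i y = code i x]).
  apply: (@fin_bigcap_measurable _ T) => // i _; exact: mf.
apply/seteqP; split=> y.
  by move=> [_ /(pcan_inj (@choice.pickleK _))/eq_in_map H] i /= /H.
move=> H; split; first by apply: HS Sx => i si; rewrite H.
by rewrite /=; congr choice.pickle; apply/eq_in_map => i si; exact: H.
Qed.

(** The second hypothesis is completeness for the metric of the observations;
    the last two identify the given measurable sets with the Borel sets. *)
Lemma standard_borel_of_code :
  (forall x y, (forall n, code n x = code n y) -> x = y) ->
  (forall v : nat -> nat,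
    (forall N, exists x, forall n, (n <= N)%N -> code n x = v n) ->
    exists x, forall n, code n x = v n) ->
  (forall n v, measurable [set x | code n x = v]) ->
  (forall A : set X, measurable A -> <<s fibres >> A) ->
  standard_borel R X.
Proof.
move=> inj compl mfib gen.
exists (code_space R compl), (fun x => x); split.
- exact: (code_hausdorff (R := R) inj).
- exact: code_second_countable.
- by exists (fun x => x).
move=> A; split=> [mA|[B oB ->]].
  exists A => //; move: (gen A mA); apply: smallest_sub.
    exact: smallest_sigma_algebra.
  move=> _ [n [v ->]]; apply: sub_sigma_algebra.
  rewrite openE => x /= xv; rewrite /interior; apply: filterS (@code_nbhs R X code x n).
  by move=> y /(_ n (leqnn n)) xy; rewrite /= -xy.
rewrite preimage_id.
have fibm : <<s fibres >> `<=` @measurable _ X.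
  apply: smallest_sub; first exact: sigma_algebra_measurable.
  by move=> _ [n [v ->]]; exact: mfib.
move: B oB; apply: smallest_sub; first exact: sigma_algebra_measurable.
move=> U oU.
pose W i : set X := @code_basic R X code (odflt [::] (choice.unpickle i)).
have -> : U = \bigcup_(i in [set i | W i `<=` U]) W i.
  apply/seteqP; split=> [x Ux|x [i /= WU /WU//]].
  have /code_nbhs_ex[N NU] : nbhs (x : coded R code) U by apply: open_nbhs_nbhs.
  exists (choice.pickle (@code_prefix R X code x N.+1)); rewrite /= /W choice.pickleK /=.
    by move=> y /code_basicP xy; apply: NU => n nN; rewrite xy.
  by apply/code_basicP.
apply: bigcup_measurable => i _; apply: fibm.
apply: (@fibres_finite (iota 0 (size (odflt [::] (choice.unpickle i))))).
move=> x y xy; rewrite /W => H j sj; rewrite -xy ?H // mem_iota /= add0n.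
exact: sj.
Qed.

End CodedBorel.

(** * The projective limit is a standard Borel space *)

Section LimitBorel.
Variables (R : realType) (d : nat) (Gam : subgroup_chain (free_group d)).
Local Notation F := (free_group d).
Local Notation X := (iso_lim_measurable Gam).
Implicit Types (f h t : Iso d) (E : seq F) (g x y l : F) (z : iso_lim Gam).

(** The isometry fixing [1] that is a left translate of [f]. *)
Definition normal f x : F := ((iso_fun f 1)^-1 * iso_fun f x)%g.
Definition normal_inv f x : F := iso_fun (iso_inv f) (iso_fun f 1 * x)%g.

Lemma normalK f : cancel (normal f) (normal_inv f).
Proof. by move=> x; rewrite /normal /normal_inv mulVKg iso_invK. Qed.
Lemma normalVK f : cancel (normal_inv f) (normal f).
Proof. by move=> x; rewrite /normal /normal_inv iso_invKV mulKg. Qed.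

Lemma normal_left l f : normal (iso_comp (iso_left l) f) =1 normal f.
Proof. by move=> x; rewrite /normal !iso_compE !iso_leftE invgM -mulgA mulKg. Qed.

Lemma normal_adj f x y : adj x y -> adj (normal f x) (normal f y).
Proof. by move=> xy; apply/adj_left/iso_adj. Qed.

Lemma normal_inv_adj f x y : adj x y -> adj (normal_inv f x) (normal_inv f y).
Proof. by move=> xy; apply/iso_adj/adj_left. Qed.

(** All coordinates of a point are left translates of each other, so one of them
    gives the isometry fixing [1] attached to the point. *)
Definition spin z : F -> F := normal (lim_rep z 0).
Definition spin_inv z : F -> F := normal_inv (lim_rep z 0).
Definition lim_coset n z : coset_space (Gam n) := icoset (Gam n) (lim_rep z n).

Lemma spinE z n x : normal (lim_rep z n) x = spin z x.
Proof.
by have [l _ E] := lim_rep_level z (leq0n n); rewrite /spin E normal_left.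
Qed.

(** The values of the inverse are recorded so that a pointwise limit of the
    isometries is automatically surjective. *)
Definition observation (i : nat + (F + F)) z : nat :=
  match i with
  | inl n => choice.pickle (repr (lim_coset n z))
  | inr (inl x) => choice.pickle (spin z x)
  | inr (inr x) => choice.pickle (spin_inv z x)
  end.

Definition lim_code (n : nat) (z : X) : nat :=
  if choice.unpickle n is Some i then observation i z else 0%N.

Lemma lim_code_pickle i z : lim_code (choice.pickle i) z = observation i z.
Proof. by rewrite /lim_code choice.pickleK. Qed.

Lemma pickle_inj (T : countType) : injective (@choice.pickle T).
Proof. exact: pcan_inj (@choice.pickleK T). Qed.

Lemma lim_coset_inj n z z' :
  choice.pickle (repr (lim_coset n z)) = choice.pickle (repr (lim_coset n z')) ->
  lim_coset n z = lim_coset n z'.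
Proof. by move=> /pickle_inj E; rewrite -[LHS]reprK E reprK. Qed.

(** A class modulo [Gam n] is recovered from its coset and its spin. *)
Lemma same_rep n z z' : lim_coset n z = lim_coset n z' ->
  exists2 l, l \in Gam n & forall x, spin z x = spin z' x ->
    iso_fun (lim_rep z' n) x = (l * iso_fun (lim_rep z n) x)%g.
Proof.
move=> /esym/coset_eq; rewrite invgK => lL.
exists (iso_fun (lim_rep z' n) 1 * (iso_fun (lim_rep z n) 1)^-1)%g => // x.
rewrite -!(spinE _ n) /normal => E.
by rewrite -mulgA E mulVKg.
Qed.

Lemma lim_code_inj (z z' : X) : (forall n, lim_code n z = lim_code n z') -> z = z'.
Proof.
move=> H; have Ho i : observation i z = observation i z' by rewrite -!lim_code_pickle.
apply: iso_lim_eq => n.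
have [l lL Hl] := same_rep (lim_coset_inj (Ho (inl n))).
rewrite -!lim_rep_proj; apply/proj_eq; exists l => //; apply: iso_eqP => x.
by rewrite iso_compE iso_leftE; apply: Hl; apply: pickle_inj; exact: (Ho (inr (inl x))).
Qed.

Lemma lim_coset_compat n z : \pi_(coset_space (Gam n)) (repr (lim_coset n.+1 z)) = lim_coset n z.
Proof.
have [l lL E] := lim_rep_level z (leqnSn n).
rewrite [RHS]/lim_coset E icoset_left //; apply/coset_eq.
by apply: chain_le; apply/coset_eq; rewrite reprK.
Qed.

(** The prescribed observations define a map with an inverse and a compatible
    sequence of cosets. Each required property involves finitely many observations,
    hence can be checked on an actual point of the limit. *)
Lemma lim_code_complete (v : nat -> nat) :
  (forall N, exists z : X, forall n, (n <= N)%N -> lim_code n z = v n) ->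
  exists z : X, forall n, lim_code n z = v n.
Proof.
move=> /choice[zz zzP].
(* [at_ i] is a point with the prescribed [i]-th observation *)
pose at_ (i : nat + (F + F)) := zz (choice.pickle i).
have atP (s : seq (nat + (F + F))) : exists z, forall i, i \in s -> observation i z = observation i (at_ i).
  exists (zz (\max_(i <- s) choice.pickle i)) => i si.
  rewrite -!lim_code_pickle (zzP _ _ (leqnn _)) zzP //.
  exact: (@leq_bigmax_seq _ s xpredT (fun i => choice.pickle i)).
pose kap x := spin (at_ (inr (inl x))) x.
pose iot x := spin_inv (at_ (inr (inr x))) x.
pose q n := lim_coset n (at_ (inl n)).
have good (sn : seq nat) (sx sy : seq F) : exists z, [/\
    forall n, n \in sn -> lim_coset n z = q n,
    forall x, x \in sx -> spin z x = kap x & forall x, x \in sy -> spin_inv z x = iot x].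
  have [z Hz] := atP ([seq inl n | n <- sn] ++ [seq inr (inl x) | x <- sx] ++
    [seq inr (inr x) | x <- sy]).
  exists z; split=> [n sn_n|x sx_x|x sy_x].
  - by apply: lim_coset_inj; apply: (Hz (inl n)); rewrite mem_cat map_f.
  - apply: pickle_inj; apply: (Hz (inr (inl x))); rewrite !mem_cat.
    by rewrite (map_f (fun x => inr (inl x))) ?orbT.
  - apply: pickle_inj; apply: (Hz (inr (inr x))); rewrite !mem_cat.
    by rewrite (map_f (fun x => inr (inr x))) ?orbT.
have kapK : cancel kap iot.
  move=> x; have [z [_ Hk Hi]] := good [::] [:: x] [:: kap x].
  by rewrite -Hi ?mem_head // -Hk ?mem_head // [LHS]normalK.
have iotK : cancel iot kap.
  move=> x; have [z [_ Hk Hi]] := good [::] [:: iot x] [:: x].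
  by rewrite -Hk ?mem_head // -Hi ?mem_head // [LHS]normalVK.
have kap_iso : is_iso kap.
  apply: (is_iso_pair kapK iotK) => x y xy.
    have [z [_ Hk _]] := good [::] [:: x; y] [::].
    by rewrite -!Hk ?inE ?eqxx ?orbT //; exact: normal_adj.
  have [z [_ _ Hi]] := good [::] [::] [:: x; y].
  by rewrite -!Hi ?inE ?eqxx ?orbT //; exact: normal_inv_adj.
pose K := mk_iso kap_iso.
have kap1 : kap 1%g = 1%g.
  have [z [_ Hk _]] := good [::] [:: 1%g] [::].
  by rewrite -Hk ?mem_head // /spin /normal mulVg.
have qq n : \pi_(coset_space (Gam n)) (repr (q n.+1)) = q n.
  have [z [Hq _ _]] := good [:: n; n.+1] [::] [::].
  by rewrite -!Hq ?inE ?eqxx ?orbT //; exact: lim_coset_compat.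
pose u n : iso_quot (Gam n) := iso_proj (Gam n) (iso_comp (iso_left (repr (q n))^-1%g) K).
have uP : compatible u.
  move=> n; rewrite /u iso_quot_mapE; apply/proj_eq.
  exists ((repr (q n))^-1 * repr (q n.+1))%g.
    by apply/coset_eq; rewrite reprK qq.
  by apply: iso_eqP => x; rewrite !iso_compE !iso_leftE -mulgA mulVKg.
pose z : X := exist _ u uP.
have repz n : exists2 l, l \in Gam n &
    lim_rep z n = iso_comp (iso_left l) (iso_comp (iso_left (repr (q n))^-1%g) K).
  by apply/proj_eq; rewrite lim_rep_proj.
have spinz x : spin z x = kap x.
  have [l _ E] := repz 0%N; rewrite /spin E !normal_left.
  by rewrite /normal /= kap1 invg1 mul1g.
have spinVz x : spin_inv z x = iot x.
  rewrite -[LHS]kapK; congr iot; rewrite -spinz; exact: normalVK.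
have cosz n : lim_coset n z = q n.
  have [l lL E] := repz n; rewrite /lim_coset E icoset_left //.
  by rewrite /icoset /= kap1 mulg1 invgK reprK.
have obs j : observation j z = observation j (at_ j).
  case: j => [k|[x|x]] /=; first by rewrite cosz.
  - by rewrite spinz.
  - by rewrite spinVz.
exists z => n; case E : (@choice.unpickle [the countType of (nat + (F + F))%type] n) => [i|]; last first.
  by rewrite -(zzP n n (leqnn n)) /lim_code E.
pose N := maxn n (choice.pickle i).
rewrite -(zzP N n (leq_maxl _ _)) {1 2}/lim_code E obs -!lim_code_pickle.
by rewrite [LHS]zzP // [RHS]zzP // leq_maxr.
Qed.

Lemma lim_code_measurable n v : measurable ([set z | lim_code n z = v] : set X).
Proof.
rewrite /lim_code; case: choice.unpickle => [i|]; last first.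
  have [<-|ne] := eqVneq 0%N v.
    by rewrite (_ : [set _ | _] = setT) //; apply/seteqP; split.
  by rewrite (_ : [set _ | _] = set0) //; apply/seteqP; split=> // z /= /eqP; rewrite (negPf ne).
case: i => [k|[x|x]] /=.
- apply: (@cyl_measurable d Gam k [:: 1%g] [set f | choice.pickle (repr (icoset (Gam k) f)) = v]).
    by move=> l f lL /=; rewrite icoset_left.
  by move=> f h fh; rewrite /= /icoset fh ?mem_head.
- apply: (@cyl_measurable d Gam 0%N [:: 1%g; x] [set f | choice.pickle (normal f x) = v]).
    by move=> l f lL /=; rewrite normal_left.
  by move=> f h fh; rewrite /= /normal !fh ?inE ?eqxx ?orbT.
rewrite (_ : [set _ | _] = \bigcup_(y in [set y : F | choice.pickle y = v])
    cyl 0 [set f | iso_fun f y = (iso_fun f 1 * x)%g]); last first.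
  apply/seteqP; split=> z /=.
    move=> zv; exists (spin_inv z x) => //=.
    by rewrite /cyl /= /spin_inv /normal_inv iso_invKV.
  by move=> [y /= <-] H; rewrite /spin_inv /normal_inv -H iso_invK.
have [[y yv]|ny] := pselect (exists y : F, choice.pickle y = v); last first.
  rewrite (_ : [set y | _] = set0) ?bigcup_set0 //.
  by apply/seteqP; split=> // y yv; case: ny; exists y.
rewrite (_ : [set y | _] = [set y]).
  rewrite bigcup_set1; apply: (@cyl_measurable d Gam 0%N [:: 1%g; y]).
    by move=> l f lL /=; rewrite /= => ->; rewrite mulgA.
  by move=> f h fh /=; rewrite !fh ?inE ?eqxx ?orbT.
apply/seteqP; split=> u /=; last by move=> ->.
by rewrite -yv; exact: pickle_inj.
Qed.

Lemma lim_code_generate (A : set X) : measurable A -> <<s fibres lim_code >> A.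
Proof.
rewrite good_generate; apply: smallest_sub; first exact: smallest_sigma_algebra.
move=> _ [n [E [B [BL BE ->]]]].
apply: (@fibres_finite _ _ _ (choice.pickle (inl n : nat + (F + F)) ::
  [seq choice.pickle (inr (inl x) : nat + (F + F)) | x <- E])).
move=> z z' H.
have Hn : lim_coset n z = lim_coset n z'.
  apply: lim_coset_inj; have := H (choice.pickle (inl n : nat + (F + F))).
  by rewrite !lim_code_pickle; apply; rewrite mem_head.
have [l lL Hl] := same_rep Hn.
move=> Bz; apply: (BE (iso_comp (iso_left l) (lim_rep z n))); last exact: BL.
move=> x xE; rewrite iso_compE iso_leftE; apply: Hl; apply: pickle_inj.
have := H (choice.pickle (inr (inl x) : nat + (F + F))).
rewrite !lim_code_pickle; apply; rewrite inE; apply/orP; right.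
exact: (map_f (fun x => choice.pickle (inr (inl x) : nat + (F + F)))).
Qed.

Lemma limit_standard_borel : standard_borel R X.
Proof.
apply: (@standard_borel_of_code R _ X lim_code).
- exact: lim_code_inj.
- exact: lim_code_complete.
- exact: lim_code_measurable.
- exact: lim_code_generate.
Qed.

End LimitBorel.

(** * Almost invariant subsets of fixed proportion *)

Section Translates.
Variables (R : realType) (d : nat) (L : groupClosed (free_group d)).
Local Notation F := (free_group d).
Local Notation Q := (coset_space L).
Hypothesis Lfin : finite_index L.
Hypothesis Lnorm : normal_subgroup L.
Implicit Types (A B : {fset Q}) (q : Q) (x y h : F).
Local Notation e := (@schreier _ L (@free_gens d)).

Definition transl h q : Q := \pi_Q (repr q * h)%g.

Lemma reprQ q : \pi_Q (repr q) = q.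
Proof. exact: reprK. Qed.

(** Right translation is well defined on left cosets because [L] is normal. *)
Lemma translE h x : transl h (\pi_Q x) = \pi_Q (x * h)%g.
Proof.
apply/coset_eq; rewrite invgM -mulgA (mulgA _ x).
have : ((repr (\pi_Q x : Q))^-1 * x)%g \in L by apply/coset_eq; rewrite reprK.
by move=> H; have := Lnorm h H; rewrite /conjg.
Qed.

Lemma translK h : cancel (transl h) (transl h^-1%g).
Proof. by move=> q; rewrite -[q]reprQ !translE mulgK. Qed.

Lemma translVK h : cancel (transl h^-1%g) (transl h).
Proof. by move=> q; rewrite -[q]reprQ !translE mulgVK. Qed.

Lemma transl_inj q : injective (fun c : Q => transl (repr c) q).
Proof.
move=> c c' /=; rewrite -{1 2}[q]reprQ !translE => /coset_eq.
by rewrite invgM -mulgA mulKg => /coset_eq; rewrite !reprQ.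
Qed.

Lemma transl_act g h q : coset_act g (transl h q) = transl h (coset_act g q).
Proof. by rewrite -[q]reprQ translE !coset_actE translE mulgA. Qed.

Lemma transl_edge h q q' : e q q' -> e (transl h q) (transl h q').
Proof.
move=> /asboolP[s Ss H]; apply/asboolP; exists s => //.
by rewrite !transl_act; case: H => [->|->]; [left|right].
Qed.

Definition all_cosets : {fset Q} := fset_set [set: Q].
Lemma in_all_cosets q : q \in all_cosets.
Proof. by rewrite in_fset_set // inE. Qed.

Definition boundary_size A : nat := #|` fset_set (edge_boundary e A)|.

Lemma boundary_finite A : finite_set (edge_boundary e A).
Proof.
apply: (@sub_finite_set _ _ ([set: Q] `*` [set: Q])) => //; exact: finite_setX.
Qed.

Lemma boundary_sizeU A B : (boundary_size (A `|` B)%fset <= boundary_size A + boundary_size B)%N.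
Proof.
apply: (@leq_trans #|` fset_set (edge_boundary e A) `|` fset_set (edge_boundary e B)|%fset); last first.
  by rewrite -(leq_add2r #|` fset_set (edge_boundary e A) `&` fset_set (edge_boundary e B)|%fset) cardfsUI leq_addr.
apply: fsubset_leq_card.
apply/fsubsetP => xy; rewrite inE !in_fset_set ?inE; try exact: boundary_finite.
case=> + + H; rewrite !inE negb_or => /orP[xA|xB] /andP[yA yB]; apply/orP; [left|right];
  by apply/mem_set; split.
Qed.

Definition translate h A : {fset Q} := [fset transl h q | q in A]%fset.

Lemma in_translate h A q : (q \in translate h A) = (transl h^-1%g q \in A).
Proof.
apply/imfsetP/idP => [[p /= pA ->]|qA]; first by rewrite translK.
by exists (transl h^-1%g q) => //=; rewrite translVK.
Qed.

Lemma card_translate h A : #|` translate h A| = #|` A|.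
Proof. by apply: card_imfset; exact: can_inj (translK h). Qed.

Lemma boundary_size_translate h A : (boundary_size (translate h A) <= boundary_size A)%N.
Proof.
rewrite /boundary_size; set Z := fset_set (edge_boundary e A).
apply: (@leq_trans #|` [fset (transl h p.1, transl h p.2) | p in Z]%fset|).
  apply/fsubset_leq_card/fsubsetP => -[q q'].
  rewrite in_fset_set ?inE; last exact: boundary_finite.
  case=> /=; rewrite !in_translate => qA q'A qq'.
  apply/imfsetP; exists (transl h^-1%g q, transl h^-1%g q') => /=; last by rewrite !translVK.
  rewrite /Z in_fset_set; last exact: boundary_finite.
  by rewrite inE; split=> //=; exact: transl_edge.
exact: leq_imfset_card.
Qed.

(** The average over all translates of [A] of the size of the intersection with
    [B] is [#|A| * #|B|] divided by the number of cosets. *)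
Lemma good_translate A B : exists h, (#|` (translate h A `&` B)%fset| * #|` all_cosets| <= #|` A| * #|` B|)%N.
Proof.
apply: contrapT => H.
have {}H (c : Q) : (#|` A| * #|` B| < #|` (translate (repr c) A `&` B)%fset| * #|` all_cosets|)%N.
  by rewrite ltnNge; apply/negP => Hc; apply: H; exists (repr c).
pose P (c a : Q) : nat := transl (repr c) a \in B.
have cnt (c : Q) : #|` (translate (repr c) A `&` B)%fset| = (\sum_(a <- A) P c a)%N.
  have -> : (translate (repr c) A `&` B = translate (repr c) [fset a in A | transl (repr c) a \in B])%fset.
    by apply/fsetP => q; rewrite !inE !in_translate !inE /= translVK.
  rewrite card_translate card_fset_sum1 big_fset /= big_mkcond /=.
  by apply: eq_bigr => a _; rewrite /P; case: (_ \in B).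
have tot : (\sum_(c <- all_cosets) \sum_(a <- A) P c a <= #|` A| * #|` B|)%N.
  rewrite exchange_big /= card_fset_sum1 big_distrl /=; apply: leq_sum => a _.
  rewrite mul1n.
  pose D : {fset Q} := ((fun c : Q => transl (repr c) (a : Q)) @` [fset c in all_cosets | transl (repr c) (a : Q) \in B])%fset.
  apply: (@leq_trans #|` D|); rewrite /D.
    rewrite card_imfset; last exact: transl_inj.
    rewrite card_fset_sum1 big_fset /= [leqRHS]big_mkcond /=.
    by apply: leq_sum => c _; rewrite /P; case: (_ \in B).
  apply/fsubset_leq_card/fsubsetP => q /imfsetP[c /=]; rewrite !inE => /andP[_ cB] ->.
  exact: cB.
have : (\sum_(c <- all_cosets) (#|` A| * #|` B|).+1 <= \sum_(c <- all_cosets) (#|` (translate (repr c) A `&` B)%fset| * #|` all_cosets|))%N.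
  by apply: leq_sum => c _; exact: H.
rewrite -[leqRHS]big_distrl /= [X in (_ <= X * _)%N](eq_bigr (fun c => (\sum_(a <- A) P c a)%N)) //.
rewrite big_const_seq count_predT iter_addn_0 => /leq_trans /(_ (leq_mul tot (leqnn _))).
rewrite leq_pmul2r ?ltnn // cardfs_gt0; apply/fset0Pn.
by exists (\pi_Q 1%g); exact: in_all_cosets.
Qed.

(** As long as [B] has less than a quarter of the cosets, some translate of [A]
    meets it in at most a quarter of [A], and adds at least three quarters of [#|A|]
    to it. Stopping there keeps [B] below one half, since [A] is below a quarter. *)
Lemma grow A k : (0 < #|` A|)%N -> (4 * #|` A| < #|` all_cosets|)%N -> exists B,
  [/\ (boundary_size B <= k * boundary_size A)%N, (2 * #|` B| <= #|` all_cosets|)%N &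
      (#|` all_cosets| <= 4 * #|` B|)%N \/ (3 * k * #|` A| <= 4 * #|` B|)%N].
Proof.
move=> A0 A4; elim: k => [|k [B [bB B2 HB]]].
  exists fset0; rewrite cardfs0; split=> //; last by right.
  rewrite mul0n leqn0 /boundary_size cardfs_eq0; apply/eqP/fsetP => xy.
  by rewrite in_fset_set ?inE; [apply/negP; rewrite inE => -[]|exact: boundary_finite].
have [B4|B4] := leqP #|` all_cosets| (4 * #|` B|).
  by exists B; split=> //; [lia|left].
case: HB => [|HB]; first lia.
have [h Hh] := good_translate A B.
exists (translate h A `|` B)%fset; split.
- apply: leq_trans (boundary_sizeU _ _) _; rewrite mulSn; apply: leq_add => //.
  exact: boundary_size_translate.
- have := cardfsUI (translate h A) B; rewrite card_translate; lia.
right; have := cardfsUI (translate h A) B; rewrite card_translate.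
move: Hh; set i := #|` _ `&` _|%fset; set u := #|` _ `|` _|%fset => Hh Eu.
have : (4 * i <= #|` A|)%N by nia.
by lia.
Qed.

(** Unless [A] already has a quarter of the cosets, about [n / (3 #|A|)] translates of [A] are enough, [n] being the number of
    cosets; each contributes at most [c #|A|] to the boundary. *)
Lemma almost_invariant_half A (c : R) : 0 < c ->
  (2 * #|` A| <= #|` all_cosets|)%N -> (boundary_size A)%:R < c * #|` A|%:R -> exists B,
  [/\ (#|` all_cosets| <= 4 * #|` B|)%N, (2 * #|` B| <= #|` all_cosets|)%N &
      (boundary_size B)%:R <= c * #|` all_cosets|%:R].
Proof.
move=> c0 A2 bA.
have A0 : (0 < #|` A|)%N.
  by rewrite lt0n; apply: contraTneq bA => ->; rewrite mulr0 -leNgt ler0n.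
have [A4|A4] := leqP #|` all_cosets| (4 * #|` A|).
  exists A; split=> //; apply: le_trans (ltW bA) _; rewrite ler_pM2l // ler_nat.
  by lia.
(* enough steps of [grow] to reach a quarter of the cosets *)
pose k := (#|` all_cosets| %/ (3 * #|` A|)).+1.
have [B [bB B2 HB]] := grow k A0 A4.
have k1 : (#|` all_cosets| <= 3 * k * #|` A|)%N.
  have := ltn_ceil #|` all_cosets| (_ : 0 < 3 * #|` A|)%N; rewrite -/k; lia.
have k2 : (k * #|` A| <= #|` all_cosets|)%N.
  have := leq_trunc_div #|` all_cosets| (3 * #|` A|)%N; rewrite /k; nia.
exists B; split=> //; first by case: HB => //; lia.
apply: (@le_trans _ _ (k%:R * (boundary_size A)%:R)); first by rewrite -natrM ler_nat.
apply: (@le_trans _ _ (k%:R * (c * #|` A|%:R))).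
  by rewrite ler_wpM2l // ltW.
by rewrite mulrCA -natrM ler_pM2l // ler_nat.
Qed.

End Translates.

(** * Almost invariant sets in the limit *)

Section NotStronglyErgodic.
Variables (R : realType) (d : nat) (Gam : subgroup_chain (free_group d)).
Local Notation F := (free_group d).
Local Notation X := (iso_lim_measurable Gam).
Implicit Types (f h t : Iso d) (g x l : F) (z : iso_lim Gam).
Variables (m : forall n, probability (borel (iso_quot (Gam n))) R)
  (mu : probability X R).
Hypothesis Gfin : forall n, finite_index (Gam n).
Hypothesis Gnorm : forall n, normal_subgroup (Gam n).
Hypothesis mH : forall n, is_haar_prob (m n).
Hypothesis muP : projective_limit_measure m mu.
Local Notation act := (@iso_lim_act d Gam).
Local Notation p := (pr mu).

(** The points of the limit whose [n]-th coset belongs to [s]. *)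
Definition over_cosets n (s : seq (coset_space (Gam n))) : set X :=
  [set z | lim_coset n z \in s].

Lemma over_cosets_measurable n s : measurable (over_cosets (n := n) s).
Proof.
apply: (@cyl_measurable d Gam n [:: 1%g] [set f | icoset (Gam n) f \in s]).
  exact: (@icoset_saturated d (Gam n) [set q | q \in s]).
exact: (@icoset_supported d (Gam n) [set q | q \in s]).
Qed.

Lemma over_coset1 n q q' : p (@over_cosets n [:: q]) = p (@over_cosets n [:: q']).
Proof.
have H q0 : p (@over_cosets n [:: q0]) = fine (m n (@qset d (Gam n) [set f | icoset (Gam n) f = q0])).
  have EL := @icoset_saturated d (Gam n) [set q0].
  have ES := @icoset_supported d (Gam n) [set q0].
  rewrite /pr -(mu_cyl muP EL ES); congr (fine (mu _)); apply/seteqP.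
  by split=> z; rewrite /over_cosets /= /lim_coset inE => /eqP.
by rewrite !H (haar_prob_icoset (mH n) q q').
Qed.

Lemma over_cosets_uniq n (s : seq (coset_space (Gam n))) q : uniq s ->
  p (over_cosets s) = (size s)%:R * p (@over_cosets n [:: q]).
Proof.
elim: s => [|q' s IH] /=.
  by rewrite mul0r (_ : over_cosets [::] = set0) ?/pr ?measure0 //; apply/seteqP; split.
move=> /andP[q's us]; rewrite (_ : over_cosets (q' :: s) = over_cosets [:: q'] `|` over_cosets s); last first.
  apply/seteqP; split=> z; rewrite /over_cosets /= !inE; first by case/orP; [left|right].
  by case=> ->; rewrite ?orbT.
rewrite prU ?IH //; try exact: over_cosets_measurable.
  by rewrite (over_coset1 q' q) -[in RHS]natr1 mulrDl mul1r addrC.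
apply/seteqP; split=> // z []; rewrite /over_cosets /= inE => /eqP -> qs.
by rewrite qs in q's.
Qed.

Lemma over_cosets_le n (s : seq (coset_space (Gam n))) q : p (over_cosets s) <= (size s)%:R * p (@over_cosets n [:: q]).
Proof.
rewrite (_ : over_cosets s = over_cosets (undup s)); last first.
  by apply/seteqP; split=> z; rewrite /over_cosets /= mem_undup.
by rewrite (over_cosets_uniq q (undup_uniq s)) ler_wpM2r ?pr_ge0 // ler_nat size_undup.
Qed.

Lemma over_all_cosets n q : (#|` all_cosets (Gam n)|)%:R * p (@over_cosets n [:: q]) = 1.
Proof.
rewrite -(over_cosets_uniq q (fset_uniq (all_cosets (Gam n)))) -(prT mu); congr (p _).
by apply/seteqP; split=> z // _; rewrite /over_cosets /=; exact: in_all_cosets.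
Qed.

(** An isometry sends the edge from [1] to [gl a] to an edge, so a generator moves
    the coset of a point along an edge of the graph. *)
Lemma lim_coset_act n a z :
  @schreier F (Gam n) (@free_gens d) (lim_coset n z) (lim_coset n (act (gl a)^-1%g z)) /\
  @schreier F (Gam n) (@free_gens d) (lim_coset n (act (gl a)^-1%g z)) (lim_coset n z).
Proof.
have [b Eb] : adj (iso_fun (lim_rep z n) 1%g) (iso_fun (lim_rep z n) (gl a)).
  by apply/iso_adj; exists a; rewrite mul1g.
have E : lim_coset n (act (gl a)^-1%g z) = coset_act (gl (letter_inv b)) (lim_coset n z).
  have [l lL El] := repr_proj (Gam n) (iso_comp (lim_rep z n) (iso_left ((gl a)^-1)^-1%g)).
  rewrite {1}/lim_coset {1}/lim_rep act_proj El icoset_left // /icoset.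
  rewrite iso_compE iso_leftE invgK mulg1 Eb invgM glV.
  by rewrite [RHS]coset_actE.
have gb : free_gens (gl (letter_inv b)) by apply/free_gensP; exists (letter_inv b).
by rewrite E; split; apply/asboolP; exists (gl (letter_inv b)) => //; [left|right].
Qed.

Definition shift_error (A : set X) g : R := p (A `+` act g @` A).

Lemma image_measurable g (A : set X) : measurable A -> measurable (act g @` A : set X).
Proof. by move=> mA; rewrite act_image; exact: act_preimage_measurable. Qed.

Lemma setY_measurable (A B : set X) : measurable A -> measurable B -> measurable (A `+` B).
Proof. by move=> mA mB; apply: measurableU; exact: measurableD. Qed.

(** A point that is moved in or out lies over one of the ends of a boundary
    edge. *)
Lemma shift_error_letter n (B : {fset coset_space (Gam n)}) a q :
  shift_error (@over_cosets n B) (gl a) <= (2 * boundary_size B)%:R * p (@over_cosets n [:: q]).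
Proof.
set Z : seq _ := fset_set (edge_boundary (@schreier F (Gam n) (@free_gens d)) B).
have Zfin := boundary_finite (Gfin n) B.
apply: (@le_trans _ _ (p (@over_cosets n (map fst Z ++ map snd Z)))); last first.
  apply: le_trans (over_cosets_le _ q) _; rewrite size_cat !size_map addnn -mul2n.
  exact: lexx.
apply: pr_le; [by apply: setY_measurable; [|apply: image_measurable]; exact: over_cosets_measurable
  |exact: over_cosets_measurable|].
move=> z; rewrite act_image.
have [e1 e2] := lim_coset_act n a z.
case=> -[]; rewrite /over_cosets /= => zB zB'; rewrite mem_cat; apply/orP; [left|right].
  apply/mapP; exists (lim_coset n z, lim_coset n (act (gl a)^-1%g z)) => //.
  by rewrite /Z in_fset_set // inE; split=> //=; apply/negP.
apply/mapP; exists (lim_coset n (act (gl a)^-1%g z), lim_coset n z) => //.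
by rewrite /Z in_fset_set // inE; split=> //=; apply/negP.
Qed.

(** Triangle inequality for the measure of symmetric differences, which is
    invariant under the action. *)
Lemma shift_errorM (A : set X) g g' : measurable A ->
  shift_error A (g * g')%g <= shift_error A g + shift_error A g'.
Proof.
move=> mA; have mg x : measurable (act x @` A : set X) by exact: image_measurable.
have -> : shift_error A g' = p (act g @` A `+` act (g * g')%g @` A).
  rewrite /shift_error; have mS := setY_measurable mA (mg g').
  rewrite /pr -(mu_act mH muP g^-1%g mS); congr (fine (mu _)).
  rewrite !act_image -[LHS]/((act g^-1%g @^-1` A) `+` (act g^-1%g @^-1` (act g'^-1%g @^-1` A))).
  by congr (_ `+` _); apply/seteqP; split=> z /=; rewrite invgM limit_actM.
have mS1 := setY_measurable mA (mg g).
have mS2 := setY_measurable (mg g) (mg (g * g')%g).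
apply: (@le_trans _ _ (p ((A `+` act g @` A) `|` (act g @` A `+` act (g * g')%g @` A)))).
  apply: pr_le; [exact: setY_measurable|exact: measurableU|].
  move=> z; have [gz|ngz] := pselect ((act g @` A) z).
    by case=> -[h1 h2]; [right; left|left; right].
  by case=> -[h1 h2]; [left; left|right; right].
rewrite -lee_fin EFinD -!prE //; last exact: measurableU.
exact: measureU2.
Qed.

Lemma shift_error_le (A : set X) (c : R) g : measurable A -> 0 <= c ->
  (forall a, shift_error A (gl a) <= c) -> shift_error A g <= (size g)%:R * c.
Proof.
move=> mA c0 H; elim/fg_ind: g => [|x a E IH].
  rewrite mul0r /shift_error act_image (_ : A `+` _ = set0) ?/pr ?measure0 //.
  apply/seteqP; split=> // z []; rewrite /= => -[] /=; rewrite invg1 limit_act1 //.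
apply: le_trans (shift_errorM _ _ mA) _.
by rewrite E size_rcons -natr1 mulrDl mul1r lerD.
Qed.

Lemma limit_not_strongly_ergodic :
  ~ expanders R (fun n => @schreier _ (Gam n) (@free_gens d)) ->
  ~ strongly_ergodic mu act.
Proof.
move=> nexp serg.
have small (j : nat) : exists A : set X, [/\ measurable A, 1 / 4 <= p A <= 1 / 2 &
    forall a, shift_error A (gl a) <= 2 / j.+1%:R].
  pose c : R := j.+1%:R^-1.
  have c0 : 0 < c by rewrite invr_gt0 ltr0n.
  have [n [A [A2 bA]]] : exists n (A : {fset coset_space (Gam n)}),
      (2 * #|` A| <= #|` all_cosets (Gam n)|)%N /\ (boundary_size A)%:R < c * #|` A|%:R.
    apply: contrapT => H; apply: nexp; exists c => // n A A2.
    by rewrite leNgt; apply/negP => lt; apply: H; exists n, A.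
  have [B [B4 B2 bB]] := almost_invariant_half (Gfin n) (@Gnorm n) c0 A2 bA.
  exists (@over_cosets n B); pose q := \pi_(coset_space (Gam n)) (1%g : F).
  have := over_all_cosets q; have := over_cosets_uniq q (fset_uniq B).
  set k := p (@over_cosets n [:: q]) => EB EF.
  have k0 : 0 <= k := pr_ge0 _ _.
  split; first exact: over_cosets_measurable.
    rewrite EB.
    have h1 : (#|` all_cosets (Gam n)|)%:R * k <= (4 * #|` B|)%:R * k by rewrite ler_wpM2r // ler_nat.
    have h2 : (2 * #|` B|)%:R * k <= (#|` all_cosets (Gam n)|)%:R * k by rewrite ler_wpM2r // ler_nat.
    by move: h1 h2; rewrite !natrM EF -!mulrA; set w := _ * k => h1 h2; apply/andP; split; lra.
  move=> a; apply: le_trans (shift_error_letter B a q) _; rewrite -/k natrM.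
  have h : (boundary_size B)%:R * k <= c.
    apply: (@le_trans _ _ (c * #|` all_cosets (Gam n)|%:R * k)); first by rewrite ler_wpM2r.
    by rewrite -mulrA EF mulr1.
  by rewrite -mulrA; apply: ler_wpM2l.
have [A AP] := choice small.
have mA j : measurable (A j) by case: (AP j).
have conv := serg A mA.
have : (fun j => p (A j) * (1 - p (A j))) @ \oo --> (0 : R).
  apply: conv => g; rewrite -/(shift_error _ g).
  apply: (@squeeze_cvgr _ _ _ _ (fun=> 0) (fun j => (size g)%:R * 2 * harmonic j)).
  - near=> j; have [_ _ H] := AP j; rewrite pr_ge0 /=.
    apply: le_trans (shift_error_le g (mA j) _ H) _; first by rewrite divr_ge0.
    by rewrite mulrA.
  - exact: cvg_cst.
  - rewrite -[X in _ --> X](mulr0 ((size g)%:R * 2)); apply: cvgM; first exact: cvg_cst.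
    exact: cvg_harmonic.
move=> /cvgrPdist_lt /(_ (1 / 16)) []; first by lra.
move=> j _ /(_ j (leqnn j)); rewrite sub0r normrN.
have [_ /andP[h1 h2] _] := AP j; set a := p (A j) in h1 h2 * => H.
have := le_lt_trans (ler_norm _) H; nra.
Unshelve. all: by end_near.
Qed.

End NotStronglyErgodic.

Theorem theorem1p5 (R : realType) (d : nat)
    (Gam : subgroup_chain (free_group d))
    (m : forall n, probability (borel (iso_quot (Gam n))) R)
    (mu : probability (iso_lim_measurable Gam) R) :
  (2 <= d)%N ->
  (forall x : free_group d, x \in Gam 0%N) ->
  (forall n, finite_index (Gam n)) ->
  (forall n, normal_subgroup (Gam n)) ->
  ~ expanders R (fun n => @schreier _ (Gam n) (@free_gens d)) ->
  (forall n, ~ bipartite (@schreier _ (Gam n) (@free_gens d))) ->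
  (forall n, is_haar_prob (m n)) ->
  projective_limit_measure m mu ->
  [/\ pmp_action mu (@iso_lim_act d Gam),
      mixing mu (@iso_lim_act d Gam) &
      ~ strongly_ergodic mu (@iso_lim_act d Gam)].
Proof.
move=> d2 _ Gfin Gnorm nexp Godd mH muP; split.
- split.
  + exact: limit_standard_borel.
  + exact: limit_act1.
  + exact: limit_actM.
  + exact: act_measurable.
  + exact: act_preserves mH muP.
- exact: limit_mixing d2 Gfin Gnorm Godd mH muP.
- exact: limit_not_strongly_ergodic Gfin Gnorm mH muP nexp.
Qed.
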